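(* Let $\Delta$ be a fan in $V$. Every pure sheaf $\mathcal F^\bullet$ on $\Delta$ admits a direct sum decomposition of sheaves of graded $\mathcal A^\bullet$-modules $$\mathcal F^\bullet\;\cong\;\bigoplus_{\sigma\in\Delta}\bigl({}_\sigma\mathcal E^\bullet\otimes_{\mathbb R}K^\bullet_\sigma\bigr),\qquad K^\bullet_\sigma:=\ker\bigl(\overline{\rho}{}^{\,\sigma}_{\partial\sigma}:\overline F{}^\bullet_\sigma\to\overline F{}^\bullet_{\partial\sigma}\bigr),$$ where each $K^\bullet_\sigma$ is a finite-dimensional graded real vector space.
   Context: $V$ is a real vector space of finite dimension $n$. A cone in $V$ is a strictly convex polyhedral cone: a finite intersection $\sigma=\bigcap_i H_{\alpha_i}$ of half-spaces $H_\alpha=\{v:\alpha(v)\ge0\}$ ($\alpha$ a nonzero linear form) with $\bigcap_i\ker\alpha_i=\{0\}$. $V_\sigma:=\sigma+(-\sigma)$, $\dim\sigma:=\dim V_\sigma$, and $o=\{0\}$ is the zero cone. A face $\tau\preceq\sigma$ is $\sigma\cap\ker\beta$ with $\beta\in V^*$, $\sigma\subset H_\beta$. A fan is a nonempty finite set of cones containing all faces of its members such that the intersection of any two members is a face of both. A subfan is a subset which is a fan. $\Delta^{k}$ is the set of $k$-dimensional cones, $\Delta^{\le k}$ the subfan of cones of dimension $\le k$. $\langle\sigma\rangle$ is the fan of all faces of $\sigma$ and $\partial\sigma=\langle\sigma\rangle\setminus\{\sigma\}$. The fan space: $\Delta$ is a topological space whose open sets are the subfans and $\emptyset$. A sheaf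 $\mathcal F$ on $\Delta$ is determined by the values $\mathcal F(\sigma):=\mathcal F(\langle\sigma\rangle)$, $\sigma\in\Delta$, and the restriction maps $\mathcal F(\sigma)\to\mathcal F(\tau)$ for $\tau\preceq\sigma$; conversely every such functorial collection defines a sheaf. Write $F_\Lambda:=\mathcal F(\Lambda)$, $F_\sigma:=\mathcal F(\sigma)$, and $\rho^\sigma_{\partial\sigma}:F_\sigma\to F_{\partial\sigma}$ for the restriction. $A^\bullet=S^\bullet(V^* )$ is graded by $A^{2q}=S^q(V^* )$ (zero in odd degrees), $\mathfrak m=A^{>0}$; for a graded $A^\bullet$-module $F^\bullet$, $\overline F{}^\bullet:=F^\bullet/\mathfrak mF^\bullet$, and $\overline\rho$ denotes the map induced by $\rho$. $A_\sigma^\bullet:=S^\bullet(V_\sigma^* )$ with the analogous grading, and $\mathcal A^\bullet$ is the sheaf of graded algebras with $\mathcal A^\bullet(\sigma)=A^\bullet_\sigma$ and the natural restriction maps. A pure sheaf on $\Delta$ is a flabby sheaf $\mathcal F^\bullet$ of graded $\mathcal A^\bullet$-modules such that $F^\bullet_\sigma$ is a finitely generated free graded $A^\bullet_\sigma$-module for every $\sigma\in\Delta$. Simple sheaves: for $\sigma\in\Delta$, ${}_\sigma\mathcal E^\bullet$ is constructed inductively. For $\dim\tau\le\dim\sigma$, put ${}_\sigma E^\bullet_\tau:=A^\bullet_\sigma$ if $\tau=\sigma$ and $0$ otherwise. If ${}_\sigma\mathcal E^\bullet$ is defined on $\Delta^{\le m}$, $m\ge\dim\sigma$, then for $\tau\in\Delta^{m+1}$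 put ${}_\sigma E^\bullet_\tau:=A^\bullet_\tau\otimes_{\mathbb R}{}_\sigma\overline E{}^\bullet_{\partial\tau}$, with restriction map to ${}_\sigma E^\bullet_{\partial\tau}$ given by $a\otimes v\mapsto a\cdot s(v)$ for some homogeneous ($\mathbb R$-linear, degree-preserving) section $s:{}_\sigma\overline E{}^\bullet_{\partial\tau}\to{}_\sigma E^\bullet_{\partial\tau}$ of the residue class map. The resulting sheaf is independent of the choices of $s$ up to isomorphism. *)

(* Defs.v *)
From HB Require Import structures.
From mathcomp Require Import all_boot all_order all_algebra.
From mathcomp Require Import finmap boolp classical_sets reals.
From mathcomp Require monalg.
From mathcomp Require Import mpoly.

Set Implicit Arguments.
Unset Strict Implicit.
Unset Printing Implicit Defensive.
Import Order.TTheory GRing.Theory Num.Theory.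

Local Open Scope classical_set_scope.
Local Open Scope ring_scope.

Definition rscal (A B : nzRingType) (f : {rmorphism A -> B}) (M : lmodType B) : Type := M.

Section RestrictionOfScalars.
Context (A B : nzRingType) (f : {rmorphism A -> B}) (M : lmodType B).
Local Notation rscal := (rscal f M).

HB.instance Definition _ := GRing.Zmodule.on rscal.

Definition rscal_scale (a : A) (x : rscal) : rscal := f a *: (x : M).

Fact rscalA a b x : rscal_scale a (rscal_scale b x) = rscal_scale (a * b) x.
Proof. by rewrite /rscal_scale rmorphM scalerA. Qed.
Fact rscal1 : left_id 1 rscal_scale.
Proof. by move=> x; rewrite /rscal_scale rmorph1 scale1r. Qed.
Fact rscalDr : right_distributive rscal_scale +%R.
Proof. by move=> a x y; rewrite /rscal_scale scalerDr. Qed.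
Fact rscalDl x : {morph rscal_scale^~ x : a b / a + b}.
Proof. by move=> a b; rewrite /rscal_scale rmorphD scalerDl. Qed.

HB.instance Definition _ :=
  GRing.Zmodule_isLmodule.Build A rscal rscalA rscal1 rscalDr rscalDl.

Lemma rscalE a (x : rscal) : a *: x = f a *: (x : M) :> M.
Proof. by []. Qed.
End RestrictionOfScalars.

Section DependentProduct.
Context (A : nzRingType) (I : Type) (M : I -> lmodType A).

Definition prodm : Type := forall i, M i.
HB.instance Definition _ := Choice.copy prodm (forall i, M i).

Definition prodm_zero : prodm := fun=> 0.
Definition prodm_opp (x : prodm) : prodm := fun i => - x i.
Definition prodm_add (x y : prodm) : prodm := fun i => x i + y i.
Definition prodm_scale a (x : prodm) : prodm := fun i => a *: x i.

Fact prodm_addA : associative prodm_add.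
Proof. by move=> x y z; apply: functional_extensionality_dep => i; exact: addrA. Qed.
Fact prodm_addC : commutative prodm_add.
Proof. by move=> x y; apply: functional_extensionality_dep => i; exact: addrC. Qed.
Fact prodm_add0 : left_id prodm_zero prodm_add.
Proof. by move=> x; apply: functional_extensionality_dep => i; exact: add0r. Qed.
Fact prodm_addN : left_inverse prodm_zero prodm_opp prodm_add.
Proof. by move=> x; apply: functional_extensionality_dep => i; exact: addNr. Qed.
HB.instance Definition _ := GRing.isZmodule.Build prodm
  prodm_addA prodm_addC prodm_add0 prodm_addN.

Fact prodm_scaleA a b x : prodm_scale a (prodm_scale b x) = prodm_scale (a * b) x.
Proof. by apply: functional_extensionality_dep => i; exact: scalerA. Qed.
Fact prodm_scale1 : left_id 1 prodm_scale.
Proof. by move=> x; apply: functional_extensionality_dep => i; exact: scale1r. Qed.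
Fact prodm_scaleDr : right_distributive prodm_scale +%R.
Proof. by move=> a x y; apply: functional_extensionality_dep => i; exact: scalerDr. Qed.
Fact prodm_scaleDl x : {morph prodm_scale^~ x : a b / a + b}.
Proof. by move=> a b; apply: functional_extensionality_dep => i; exact: scalerDl. Qed.
HB.instance Definition _ := GRing.Zmodule_isLmodule.Build A prodm
  prodm_scaleA prodm_scale1 prodm_scaleDr prodm_scaleDl.

Lemma prodmD (x y : prodm) i : (x + y) i = x i + y i. Proof. by []. Qed.
Lemma prodmZ a (x : prodm) i : (a *: x) i = a *: x i. Proof. by []. Qed.
End DependentProduct.

Definition submod_prop (A : nzRingType) (M : lmodType A) (P : set M) :=
  P 0 /\ forall a u v, P u -> P v -> P (a *: u + v).

Section Submodule.
Context (A : nzRingType) (M : lmodType A) (P : set M) (hP : submod_prop P).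

Definition submod_pred of submod_prop P : {pred M} := fun x => `[< P x >].

Fact submod_pred_closed : submod_closed (submod_pred hP).
Proof.
split; first by apply/asboolP; case: hP.
by move=> a u v /asboolP Pu /asboolP Pv; apply/asboolP; apply: hP.2.
Qed.
HB.instance Definition _ :=
  GRing.isSubmodClosed.Build A M (submod_pred hP) submod_pred_closed.

Definition submod : Type := {x : M | x \in submod_pred hP}.
HB.instance Definition _ := SubChoice.on submod.
HB.instance Definition _ := [SubChoice_isSubLmodule of submod by <:].

Lemma submodP (x : submod) : P (val x).
Proof. by apply/asboolP; exact: (valP x). Qed.

Definition mk_submod (x : M) (Px : P x) : submod :=
  Sub x (introT (asboolP (P x)) Px).
End Submodule.

Section Quotient.
Context (A : nzRingType) (M : lmodType A).

Definition mspan (S : set M) : {pred M} := fun x =>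
  `[< exists s : seq (A * M),
        (forall p, p \in s -> S p.2) /\ x = \sum_(p <- s) p.1 *: p.2 >].

Section FixedSet.
Context (S : set M).

Fact mspan_closed : submod_closed (mspan S).
Proof.
split; first by apply/asboolP; exists [::]; rewrite big_nil.
move=> a u v /asboolP[s [sS ->]] /asboolP[t [tS ->]]; apply/asboolP.
exists ([seq (a * p.1, p.2) | p <- s] ++ t); split.
  by move=> p; rewrite mem_cat => /orP[/mapP[q /sS Sq ->]//|/tS].
rewrite big_cat big_map /= scaler_sumr; congr (_ + _).
by apply: eq_bigr => p _; rewrite scalerA.
Qed.
HB.instance Definition _ :=
  GRing.isSubmodClosed.Build A M (mspan S) mspan_closed.

Definition quotm : Type := Quotient.quot (mspan S).
HB.instance Definition _ := GRing.Zmodule.on quotm.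

Definition qpi (x : M) : quotm := (\pi_(Quotient.quot (mspan S)) x)%qT.


Fact qpi_zmod_morphism : zmod_morphism qpi.
Proof.
by move=> x y; rewrite /qpi (pi_is_zmod_morphism (Quotient.quot (mspan S)) x y).
Qed.
HB.instance Definition _ := GRing.isZmodMorphism.Build M quotm qpi qpi_zmod_morphism.

Definition qrepr (q : quotm) : M := repr (q : Quotient.quot (mspan S)).

Lemma qreprK : cancel qrepr qpi.
Proof. by move=> q; exact: reprK. Qed.

Lemma qpi_eq0 x : (qpi x == 0) = (x \in mspan S).
Proof.
by rewrite -[x in RHS]subr0 Quotient.idealrBE -(raddf0 qpi).
Qed.

Definition quotm_scale (a : A) (q : quotm) : quotm := qpi (a *: qrepr q).

Fact quotm_scaleE a x : quotm_scale a (qpi x) = qpi (a *: x).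
Proof.
apply/eqP; rewrite -subr_eq0 -raddfB qpi_eq0 -scalerBr.
by apply: rpredZ; rewrite -qpi_eq0 raddfB /= qreprK subrr.
Qed.

Fact quotm_scaleA a b x : quotm_scale a (quotm_scale b x) = quotm_scale (a * b) x.
Proof. by rewrite -[x]qreprK !quotm_scaleE scalerA. Qed.
Fact quotm_scale1 : left_id 1 quotm_scale.
Proof. by move=> x; rewrite -[x]qreprK !quotm_scaleE scale1r. Qed.
Fact quotm_scaleDr : right_distributive quotm_scale +%R.
Proof.
move=> a x y; rewrite -[x]qreprK -[y]qreprK -raddfD /= !quotm_scaleE.
by rewrite scalerDr raddfD.
Qed.
Fact quotm_scaleDl x : {morph quotm_scale^~ x : a b / a + b}.
Proof. by move=> a b; rewrite -[x]qreprK !quotm_scaleE scalerDl raddfD. Qed.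
HB.instance Definition _ := GRing.Zmodule_isLmodule.Build A quotm
  quotm_scaleA quotm_scale1 quotm_scaleDr quotm_scaleDl.

Fact qpi_scalable : scalable qpi.
Proof. by move=> a x; rewrite -quotm_scaleE. Qed.
HB.instance Definition _ := GRing.isScalable.Build A M quotm *:%R qpi qpi_scalable.

Lemma mspan_gen x : S x -> x \in mspan S.
Proof.
move=> Sx; apply/asboolP; exists [:: (1, x)]; split.
  by move=> p; rewrite inE => /eqP->.
by rewrite big_seq1 scale1r.
Qed.

Lemma qpi_rel x : S x -> qpi x = 0.
Proof. by move=> Sx; apply/eqP; rewrite qpi_eq0 mspan_gen. Qed.

Section Lift.
Context (N : lmodType A) (f : {linear M -> N}) (fS : forall x, S x -> f x = 0).

Lemma mspan_ker x : x \in mspan S -> f x = 0.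
Proof.
move=> /asboolP[s [sS ->]]; rewrite raddf_sum big1_seq // => p /andP[_ /sS Sp].
by rewrite /= linearZ /= fS ?scaler0.
Qed.

Definition qlift of (forall x, S x -> f x = 0) : quotm -> N := f \o qrepr.
Local Notation lift := (qlift fS).

Lemma qliftE x : lift (qpi x) = f x.
Proof.
apply/eqP; rewrite -subr_eq0 /qlift /= -raddfB; apply/eqP/mspan_ker.
by rewrite -qpi_eq0 raddfB /= qreprK subrr.
Qed.

Fact qlift_linear : linear lift.
Proof.
by move=> a x y; rewrite -[x]qreprK -[y]qreprK -linearP !qliftE linearP.
Qed.
HB.instance Definition _ := GRing.isLinear.Build A quotm N *:%R lift qlift_linear.
End Lift.
End FixedSet.
End Quotient.

Section Tensor.
Import monalg.
Local Notation coef z p := (monalg.mcoeff p z).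
Context (k : comNzRingType) (M K : lmodType k).

Definition tensor_rel : set {malg k[(M * K)%type]} := fun z =>
  (exists c m m' x,
     z = << ((c *: m + m' : M), x) >> - c *: << (m, x) >> - << (m', x) >>) \/
  (exists c m x x',
     z = << (m, (c *: x + x' : K)) >> - c *: << (m, x) >> - << (m, x') >>).

Definition tensor : Type := quotm tensor_rel.
HB.instance Definition _ := GRing.Lmodule.on tensor.

Definition tens (m : M) (x : K) : tensor := qpi tensor_rel << (m, x) >>.

Fact qpi_rel3 (S : set {malg k[(M * K)%type]}) c u v w :
  S (u - c *: v - w) -> qpi S u = c *: qpi S v + qpi S w.
Proof.
move=> /qpi_rel; rewrite !raddfB /= linearZ /= -addrA -opprD => /eqP.
by rewrite subr_eq0 => /eqP.
Qed.

Lemma tensPl c m m' x : tens (c *: m + m') x = c *: tens m x + tens m' x.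
Proof. by apply: qpi_rel3; left; exists c, m, m', x. Qed.

Lemma tensPr c m x x' : tens m (c *: x + x') = c *: tens m x + tens m x'.
Proof. by apply: qpi_rel3; right; exists c, m, x, x'. Qed.

Lemma tens0l x : tens 0 x = 0.
Proof.
have /eqP := tensPl 1 0 0 x; rewrite !scale1r addr0 -subr_eq0 opprD addrA.
by rewrite subrr sub0r oppr_eq0 => /eqP.
Qed.

Lemma tensZl c m x : tens (c *: m) x = c *: tens m x.
Proof. by have := tensPl c m 0 x; rewrite !addr0 tens0l addr0. Qed.

Lemma tens0r m : tens m 0 = 0.
Proof.
have /eqP := tensPr 1 m 0 0; rewrite !scale1r addr0 -subr_eq0 opprD addrA.
by rewrite subrr sub0r oppr_eq0 => /eqP.
Qed.

Lemma tensZr c m x : tens m (c *: x) = c *: tens m x.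
Proof. by have := tensPr c m x 0; rewrite !addr0 tens0r addr0. Qed.

Lemma tensE (t : tensor) :
  exists r (m : 'I_r -> M) (x : 'I_r -> K), t = \sum_(i < r) tens (m i) (x i).
Proof.
rewrite -[t]qreprK [qrepr t]monalgE raddf_sum /=.
set s : seq (M * K) := enum_fset _; set c := fun p => coef (qrepr t) p.
exists (size s), (fun i => c (nth 0 s i) *: (nth 0 s i).1), (fun i => (nth 0 s i).2).
rewrite (big_nth 0) big_mkord; apply: eq_bigr => i _.
rewrite tensZl /tens -surjective_pairing -/(c _).
suff -> : << c (nth 0 s i) *g nth 0 s i >> = c (nth 0 s i) *: << nth 0 s i >>
    :> {malg k[(M * K)%type]} by exact: linearZ.
by apply/malgP => q; rewrite mcoeffZ !mcoeffU mulrnAr mulr1.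
Qed.

Section Lift.
Context (N : lmodType k) (b : M -> K -> N).
Context (bl : forall c m m' x, b (c *: m + m') x = c *: b m x + b m' x).
Context (br : forall c m x x', b m (c *: x + x') = c *: b m x + b m x').

Definition malg_ext (z : {malg k[(M * K)%type]}) : N :=
  \sum_(p <- msupp z) (coef z p) *: b p.1 p.2.

Fact malg_extEw (d : {fset (M * K)%type}) z : (msupp z `<=` d)%fset ->
  malg_ext z = \sum_(p <- d) (coef z p) *: b p.1 p.2.
Proof.
move=> le_zd; rewrite /malg_ext (big_fset_incl _ le_zd) //= => p _ zp.
by rewrite (mcoeff_outdom zp) scale0r.
Qed.

Fact malg_ext_linear : linear malg_ext.
Proof.
move=> c y z; pose d := (msupp y `|` msupp z `|` msupp (c *: y + z))%fset.
have yd : (msupp y `<=` d)%fset by rewrite /d -fsetUA fsubsetUl.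
have zd : (msupp z `<=` d)%fset by rewrite /d fsetUAC fsubsetUr.
rewrite (malg_extEw (fsubsetUr _ _ : msupp (c *: y + z) `<=` d)%fset).
rewrite (malg_extEw yd) (malg_extEw zd).
rewrite scaler_sumr -big_split; apply: eq_bigr => p _ /=.
by rewrite mcoeffD mcoeffZ scalerDl scalerA.
Qed.
HB.instance Definition _ := GRing.isLinear.Build k _ N *:%R malg_ext malg_ext_linear.

Fact malg_extU p : malg_ext << p >> = b p.1 p.2.
Proof.
by rewrite /malg_ext msuppU oner_eq0 big_seq_fset1 mcoeffUU scale1r.
Qed.

Fact malg_ext_rel z : tensor_rel z -> malg_ext z = 0.
Proof.
case=> [[c [m [m' [x ->]]]]|[c [m [x [x' ->]]]]];
  rewrite !raddfB /= linearZ /= !malg_extU /= ?bl ?br -addrA -opprD;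
  exact: subrr.
Qed.

Definition tensor_lift : tensor -> N := qlift malg_ext_rel.
HB.instance Definition _ := GRing.Linear.copy tensor_lift (qlift malg_ext_rel).

Lemma tensor_liftE m x : tensor_lift (tens m x) = b m x.
Proof. by rewrite /tensor_lift /tens qliftE; exact: malg_extU. Qed.
End Lift.

Lemma tensor_ext (N : lmodType k) (f g : {additive tensor -> N}) :
  (forall m x, f (tens m x) = g (tens m x)) -> f =1 g.
Proof.
move=> fg t; have [r [m [x ->]]] := tensE t.
by rewrite !raddf_sum; apply: eq_bigr => i _; exact: fg.
Qed.
End Tensor.

(* For an algebra [iota : k -> A] and an [A]-module [M], the tensor product
   over [k] of [M] and [K], with [A] acting on the left factor. *)
Section ModuleTensor.
Context (k A : comNzRingType) (iota : {rmorphism k -> A}).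
Context (M : lmodType A) (K : lmodType k).

Definition mtensor : Type := tensor (rscal iota M) K.
HB.instance Definition _ := GRing.Zmodule.on mtensor.

Definition mtens (m : M) (x : K) : mtensor := tens (m : rscal iota M) x.

Section Scale.
Context (a : A).
Let b (m : rscal iota M) (x : K) : tensor (rscal iota M) K :=
  mtens (a *: (m : M)) x.

Fact mtensor_scale_l c m m' x : b (c *: m + m') x = c *: b m x + b m' x.
Proof.
rewrite /b /mtens -tensPl rscalE; congr tens.
by rewrite scalerDr !rscalE !scalerA mulrC.
Qed.
Fact mtensor_scale_r c m x x' : b m (c *: x + x') = c *: b m x + b m x'.
Proof. exact: tensPr. Qed.

Definition mtensor_scale : mtensor -> mtensor :=
  tensor_lift mtensor_scale_l mtensor_scale_r.

Fact mtensor_scale_tens m x : mtensor_scale (mtens m x) = mtens (a *: m) x.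
Proof. exact: tensor_liftE. Qed.
Fact mtensor_scale_zmod_morphism : zmod_morphism mtensor_scale.
Proof. exact: (raddfB (tensor_lift mtensor_scale_l mtensor_scale_r)). Qed.
HB.instance Definition _ := GRing.isZmodMorphism.Build mtensor mtensor
  mtensor_scale mtensor_scale_zmod_morphism.
End Scale.

Lemma mtensE (t : mtensor) :
  exists r (m : 'I_r -> M) (x : 'I_r -> K), t = \sum_(i < r) mtens (m i) (x i).
Proof.
have [r [m [x et]]] := @tensE _ (rscal iota M) K t.
by exists r, m, x; rewrite et.
Qed.

Lemma mtensDl m m' x : mtens (m + m') x = mtens m x + mtens m' x.
Proof. by have := @tensPl _ (rscal iota M) K 1 m m' x; rewrite !scale1r. Qed.

Lemma mtensDr m x x' : mtens m (x + x') = mtens m x + mtens m x'.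
Proof. by have := @tensPr _ (rscal iota M) K 1 m x x'; rewrite !scale1r. Qed.

Lemma mtensZ c m x : mtens m (c *: x) = mtens (iota c *: m) x.
Proof.
rewrite /mtens; have -> : iota c *: m = c *: (m : rscal iota M) by [].
by rewrite tensZl tensZr.
Qed.

Lemma mtensor_ext (N : zmodType) (f g : {additive mtensor -> N}) :
  (forall m x, f (mtens m x) = g (mtens m x)) -> f =1 g.
Proof.
move=> fg t; have [r [m [x ->]]] := mtensE t.
by rewrite (raddf_sum f) (raddf_sum g); apply: eq_bigr => i _; exact: fg.
Qed.

Fact mtensor_scaleA a b t :
  mtensor_scale a (mtensor_scale b t) = mtensor_scale (a * b) t.
Proof.
apply: (@mtensor_ext _ (mtensor_scale a \o mtensor_scale b)) => m x /=.
by rewrite !mtensor_scale_tens scalerA.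
Qed.
Fact mtensor_scale1 : left_id 1 mtensor_scale.
Proof.
apply: (@mtensor_ext _ (mtensor_scale 1) idfun) => m x /=.
by rewrite mtensor_scale_tens scale1r.
Qed.
Fact mtensor_scaleDr : right_distributive mtensor_scale +%R.
Proof. by move=> a x y; rewrite raddfD. Qed.
Fact mtensor_scaleDl t : {morph mtensor_scale^~ t : a b / a + b}.
Proof.
move=> a b.
apply: (@mtensor_ext _ (mtensor_scale (a + b))
          (mtensor_scale a \+ mtensor_scale b)) => m x /=.
by rewrite !mtensor_scale_tens scalerDl mtensDl.
Qed.
HB.instance Definition _ := GRing.Zmodule_isLmodule.Build A mtensor
  mtensor_scaleA mtensor_scale1 mtensor_scaleDr mtensor_scaleDl.

Lemma mtensZl a m x : a *: mtens m x = mtens (a *: m) x.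
Proof. exact: mtensor_scale_tens. Qed.
End ModuleTensor.

Section ModuleTensorMap.
Context (k A B : comNzRingType) (iota : {rmorphism k -> A}).
Context (kappa : {rmorphism k -> B}) (g : {rmorphism A -> B}).
Context (gk : forall c, g (iota c) = kappa c).
Context (M : lmodType A) (N : lmodType B) (K : lmodType k).
Context (f : {linear M -> rscal g N}).

Let b (m : rscal iota M) (x : K) : tensor (rscal kappa N) K :=
  mtens kappa (f m : N) x.

Fact mtensor_map_l c m m' x : b (c *: m + m') x = c *: b m x + b m' x.
Proof.
rewrite /b /mtens -tensPl; congr tens.
by rewrite rscalE linearP rscalE gk.
Qed.
Fact mtensor_map_r c m x x' : b m (c *: x + x') = c *: b m x + b m x'.
Proof. exact: tensPr. Qed.

Definition mtensor_map : mtensor iota M K -> rscal g (mtensor kappa N K) :=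
  tensor_lift mtensor_map_l mtensor_map_r.

Lemma mtensor_mapE m x :
  mtensor_map (mtens iota m x) = mtens kappa (f m : N) x.
Proof. exact: (tensor_liftE mtensor_map_l mtensor_map_r). Qed.

Fact mtensor_map_zmod_morphism : zmod_morphism mtensor_map.
Proof. exact: (raddfB (tensor_lift mtensor_map_l mtensor_map_r)). Qed.
HB.instance Definition _ := GRing.isZmodMorphism.Build (mtensor iota M K)
  (rscal g (mtensor kappa N K)) mtensor_map mtensor_map_zmod_morphism.

Fact mtensor_map_scalable : scalable mtensor_map.
Proof.
move=> a t.
apply: (@mtensor_ext _ _ _ _ _ _ (mtensor_map \o *:%R a)
          ( *:%R a \o mtensor_map)) => m x /=.
by rewrite mtensZl !mtensor_mapE rscalE mtensZl linearZ.
Qed.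
HB.instance Definition _ := GRing.isScalable.Build A (mtensor iota M K)
  (rscal g (mtensor kappa N K)) *:%R mtensor_map mtensor_map_scalable.
End ModuleTensorMap.

Section Cones.
Context (R : realType) (V : vectType R).
Implicit Types (s t : set V) (a b : 'Hom(V, R^o)).

Definition halfspace a : set V := [set v | 0 <= a v].
Definition hyperplane a : set V := [set v | a v = 0].

Definition is_cone s := exists2 l : seq 'Hom(V, R^o),
  (forall a, a \in l -> a != 0) /\
    \bigcap_(a in [set` l]) hyperplane a = [set 0] &
  s = \bigcap_(a in [set` l]) halfspace a.

(* The subspace whose underlying set is [s + (- s)], if there is one; see
   [cspanE] for the case of a cone. *)
Definition cspan s : {vspace V} :=
  xget 0%VS [set U | [set` U] = [set x - y | x in s & y in s]].

Definition cdim s := \dim (cspan s).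

Definition face t s := exists2 b, s `<=` halfspace b & t = s `&` hyperplane b.

Definition is_fan (D : {fset set V}) :=
  [/\ D != fset0,
      forall s, s \in D -> is_cone s,
      forall s t, s \in D -> face t s -> t \in D &
      forall s t, s \in D -> t \in D -> face (s `&` t) s /\ face (s `&` t) t].

Lemma set_vspaceP (S : set V) : S 0 ->
  (forall c u v, S u -> S v -> S (c *: u + v)) ->
  exists U : {vspace V}, [set` U] = S.
Proof.
move=> S0 Sl.
pose P n := `[< exists2 U : {vspace V}, \dim U = n & [set` U] `<=` S >].
have exP : exists n, P n.
  exists 0%N; apply/asboolP; exists 0%VS; first by rewrite dimv0.
  by move=> v /=; rewrite memv0 => /eqP->.
have ubP n : P n -> (n <= \dim {:V})%N.
  by move=> /asboolP[U <- _]; rewrite dimvS ?subvf.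
case: (ex_maxnP exP ubP) => n /asboolP[U dU US] nmax.
exists U; apply/seteqP; split=> // v Sv /=; apply: contrapT => vU.
suff /nmax : P (\dim (U + <[v]>)%VS).
  rewrite -dU => dUv; have /eqP eU : U == (U + <[v]>)%VS.
    by rewrite -(geq_leqif (dimv_leqif_eq (addvSl U <[v]>))).
  by apply: vU; rewrite eU; apply: (subvP (addvSr U <[v]>)); rewrite memv_line.
apply/asboolP; exists (U + <[v]>)%VS => // w /= /memv_addP[u uU [_ /vlineP[c ->] ->]].
by rewrite addrC; apply: Sl => //; apply: US.
Qed.

Section OneCone.
Context (s : set V) (cs : is_cone s).

Lemma cone0 : s 0.
Proof. by case: cs => l _ -> a _; rewrite /halfspace /= linear0. Qed.

Lemma coneD x y : s x -> s y -> s (x + y).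
Proof.
case: cs => l _ -> sx sy a al; rewrite /halfspace /= linearD.
by apply: addr_ge0; [exact: sx | exact: sy].
Qed.

Lemma coneZ c x : 0 <= c -> s x -> s (c *: x).
Proof.
case: cs => l _ -> c0 sx a al; rewrite /halfspace /= linearZ /=.
by apply: mulr_ge0 => //; exact: sx.
Qed.

Lemma cspanE : [set` cspan s] = [set x - y | x in s & y in s].
Proof.
rewrite /cspan; case: xgetP => [U _ //|none].
have [||U eU] := @set_vspaceP [set x - y | x in s & y in s].
- by exists 0; [exact: cone0|exists 0; [exact: cone0|rewrite subr0]].
- move=> c _ _ [x sx [y sy <-]] [z sz [w sw <-]].
  have [c0|c0] := leP 0 c.
    exists (c *: x + z); first by apply: coneD => //; exact: coneZ.
    exists (c *: y + w); first by apply: coneD => //; exact: coneZ.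
    by rewrite scalerBr opprD addrACA.
  have c0' : 0 <= - c by rewrite oppr_ge0 ltW.
  exists ((- c) *: y + z); first by apply: coneD => //; exact: coneZ.
  exists ((- c) *: x + w); first by apply: coneD => //; exact: coneZ.
  by rewrite opprD !scaleNr opprK addrACA scalerBr [c *: x - _]addrC.
- by have := none U; rewrite /= eU.
Qed.
End OneCone.

Lemma face_cspan s t : is_cone s -> is_cone t -> face t s ->
  (cspan t <= cspan s)%VS.
Proof.
move=> cs ct [b _ et]; have ts x : t x -> s x by rewrite et => -[].
apply/subvP => v vt; have : [set` cspan t] v by [].
rewrite (cspanE ct) => -[x tx [y ty <-]].
suff : [set` cspan s] (x - y) by [].
by rewrite (cspanE cs); exists x; [exact: ts|exists y; [exact: ts|]].
Qed.
End Cones.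

Record fan (R : realType) (V : vectType R) := Fan {
  fan_cones :> {fset set V};
  fanP : is_fan fan_cones }.

(* The symmetric algebra of [U^*], as the polynomial ring in the coordinate
   forms of the basis [vbasis U]: 'X_i is the i-th coordinate form. *)
Notation Sym R U := {mpoly R[\dim U]}.

Section Restriction.
Context (R : realType) (V : vectType R).
Implicit Types U W : {vspace V}.

(* Substitute for each coordinate form of [U] its restriction to [W]
   (meaningful for [W <= U]). *)
Definition Sres_vars U W : (\dim U).-tuple (Sym R W) :=
  [tuple \sum_(j < \dim W) coord (vbasis U) i (vbasis W)`_j *: 'X_j | i < \dim U].

Definition Sres U W : Sym R U -> Sym R W :=
  comp_mpoly (Sres_vars U W).
Arguments Sres : clear implicits.
HB.instance Definition _ U W :=
  GRing.RMorphism.copy (Sres U W) (comp_mpoly (Sres_vars U W)).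

Lemma SresC U W c : Sres U W c%:MP = c%:MP.
Proof. exact: comp_mpolyC. Qed.

Lemma Sym_ext U (B : nzRingType) (f g : {rmorphism Sym R U -> B}) :
  (forall c, f c%:MP = g c%:MP) -> (forall i, f 'X_i = g 'X_i) -> f =1 g.
Proof.
move=> fgC fgX p; rewrite [p]mpolyE !raddf_sum; apply: eq_bigr => m _ /=.
rewrite -mul_mpolyC !rmorphM /= fgC; congr (_ * _).
rewrite mpolyXE_id !rmorph_prod; apply: eq_bigr => i _.
by rewrite !rmorphXn /= fgX.
Qed.

Lemma SresX U W i : Sres U W 'X_i =
  \sum_(j < \dim W) coord (vbasis U) i (vbasis W)`_j *: 'X_j.
Proof. by rewrite /Sres comp_mpolyXU -tnth_nth tnth_mktuple. Qed.

Lemma SresZ U W c p : Sres U W (c *: p) = c *: Sres U W p.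
Proof. exact: comp_mpolyZ. Qed.

Lemma Sres_id U p : Sres U U p = p.
Proof.
rewrite -[RHS]comp_mpoly_id /Sres; congr comp_mpoly; apply: eq_mktuple => i.
rewrite (bigD1 i) //= big1 => [|j ji];
  rewrite coord_free ?(basis_free (vbasisP U)) //.
  by rewrite eqxx scale1r addr0.
by rewrite (negPf ji) scale0r.
Qed.

Lemma Sres_comp U W T p : (T <= W)%VS -> (W <= U)%VS ->
  Sres W T (Sres U W p) = Sres U T p.
Proof.
move=> TW WU; apply: (@Sym_ext _ _ (Sres W T \o Sres U W)) p => [c|i] /=.
  by rewrite !SresC.
rewrite !SresX (raddf_sum (Sres W T)) /=.
transitivity (\sum_(j < \dim W) \sum_(k < \dim T)
  (coord (vbasis U) i (vbasis W)`_j * coord (vbasis W) j (vbasis T)`_k) *: 'X_k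
    : Sym R T).
  apply: eq_bigr => j _; rewrite SresZ SresX scaler_sumr.
  by apply: eq_bigr => k _; rewrite scalerA.
rewrite exchange_big; apply: eq_bigr => k _ /=; rewrite -scaler_suml.
congr (_ *: _).
have kW : (vbasis T)`_k \in W.
  by apply: (subvP TW); apply: vbasis_mem; rewrite mem_nth // size_tuple.
rewrite [in RHS](coord_vbasis kW) raddf_sum; apply: eq_bigr => j _ /=.
by rewrite linearZ /= mulrC.
Qed.
End Restriction.
Arguments Sres {R V} U W.

(* A module with a family of distinguished subsets, the sets of homogeneous
   elements of the various degrees; [is_graded] says that this is a grading. *)
Record gmod (A : nzRingType) := GMod {
  gsort :> lmodType A;
  gdeg : int -> set gsort }.
Arguments gdeg {A} g.

Definition is_graded (A : nzRingType) (dA : int -> set A) (M : gmod A) :=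
  [/\ forall i, gdeg M i 0 /\
        (forall x y, gdeg M i x -> gdeg M i y -> gdeg M i (x - y)),
      forall i j a x, dA i a -> gdeg M j x -> gdeg M (i + j) (a *: x),
      forall x, exists (s : seq int) (c : int -> M),
        (forall i, gdeg M i (c i)) /\ x = \sum_(i <- s) c i &
      forall (s : seq int) (c : int -> M), uniq s ->
        (forall i, gdeg M i (c i)) -> \sum_(i <- s) c i = 0 ->
        forall i, i \in s -> c i = 0].

Definition gmod_iso (A : nzRingType) (M N : gmod A) (f : {linear M -> N}) :=
  bijective f /\ forall i x, gdeg N i (f x) <-> gdeg M i x.

Definition scalar_deg (k : nzRingType) (i : int) : set k :=
  [set c | i = 0 \/ c = 0].

(* The grading is doubled: forms of polynomial degree [q] have degree [2q]. *)
Definition Sym_deg (k : nzRingType) (n : nat) (i : int) : set {mpoly k[n]} :=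
  [set p | (exists2 q : nat, i = (q.*2)%:Z & p \is q.-homog) \/ p = 0].

Definition graded_space (k : nzRingType) (K : gmod k) := is_graded (@scalar_deg k) K.

Definition graded_Sym_module (k : nzRingType) (n : nat) (M : gmod {mpoly k[n]}) :=
  is_graded (@Sym_deg k n) M.

Definition finite_dim (k : nzRingType) (K : lmodType k) :=
  exists (r : nat) (e : 'I_r -> K),
    forall x, exists c : 'I_r -> k, x = \sum_i c i *: e i.

Definition fg_free_graded (A : nzRingType) (M : gmod A) :=
  exists (r : nat) (d : 'I_r -> int) (e : 'I_r -> M),
    (forall i, gdeg M (d i) (e i)) /\
    forall x, exists! c : {ffun 'I_r -> A}, x = \sum_i c i *: e i.

Definition grscal (A B : nzRingType) (f : {rmorphism A -> B}) (M : gmod B) : gmod A :=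
  @GMod A (rscal f M) (gdeg M).

Section Residue.
Context (k : comNzRingType) (n : nat).
Implicit Types M N : gmod {mpoly k[n]}.

Definition mC : {rmorphism k -> {mpoly k[n]}} := @mpolyC n k.

Definition Sym_self : gmod {mpoly k[n]} :=
  @GMod {mpoly k[n]} ({mpoly k[n]}^o) (@Sym_deg k n).

Definition maxideal : set {mpoly k[n]} := [set p | p@_0%MM = 0].

Definition max_mul M : set (rscal mC M) :=
  [set y | exists a (x : M), maxideal a /\ y = a *: x :> M].
Arguments max_mul : clear implicits.

Definition bar_class M : {linear rscal mC M -> quotm (max_mul M)} :=
  @qpi k (rscal mC M) (max_mul M).

Definition bar M : gmod k :=
  @GMod k (quotm (max_mul M)) (fun i => [set bar_class M x | x in gdeg M i]).

Section BarMap.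
Context (M N : gmod {mpoly k[n]}) (f : {linear M -> N}).

Definition bar_map0 (x : rscal mC M) : quotm (max_mul N) := bar_class N (f x).

Fact bar_map0_zmod_morphism : zmod_morphism bar_map0.
Proof. by move=> x y; rewrite /bar_map0 !raddfB. Qed.
HB.instance Definition _ := GRing.isZmodMorphism.Build
  (rscal mC M) (quotm (max_mul N)) bar_map0 bar_map0_zmod_morphism.

Fact bar_map0_scalable : scalable bar_map0.
Proof.
move=> c x; rewrite /bar_map0 rscalE linearZ.
exact: (linearZZ (bar_class N) c (f x : rscal mC N)).
Qed.
HB.instance Definition _ := GRing.isScalable.Build k
  (rscal mC M) (quotm (max_mul N)) *:%R bar_map0 bar_map0_scalable.

Fact bar_map0_rel x : max_mul M x -> bar_map0 x = 0.
Proof.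
move=> [a [y [ma ->]]]; rewrite /bar_map0 linearZ; apply: qpi_rel.
by exists a, (f y).
Qed.

Definition bar_map : {linear bar M -> bar N} := qlift bar_map0_rel.

Lemma bar_mapE x : bar_map (bar_class M x) = bar_class N (f x).
Proof. exact: (qliftE bar_map0_rel). Qed.
End BarMap.

Definition kernel (K L : gmod k) (f : {linear K -> L}) : set K := [set x | f x = 0].

Fact kernel_submod (K L : gmod k) (f : {linear K -> L}) : submod_prop (kernel f).
Proof.
split; first exact: linear0.
by move=> a u v fu fv; rewrite /kernel /= linearP fu fv scaler0 addr0.
Qed.

Definition gkernel (K L : gmod k) (f : {linear K -> L}) : gmod k :=
  @GMod k (submod (kernel_submod f)) (fun i => [set x | gdeg K i (val x)]).

Definition gtensor M (K : gmod k) : gmod {mpoly k[n]} :=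
  @GMod {mpoly k[n]} (mtensor mC M K) (fun i => [set t |
    exists (r : nat) (m : 'I_r -> M) (x : 'I_r -> K) (p q : 'I_r -> int),
      (forall j, [/\ gdeg M (p j) (m j), gdeg K (q j) (x j) & p j + q j = i]) /\
      t = \sum_j mtens mC (m j) (x j)]).
End Residue.

Definition gprod (A : nzRingType) (I : Type) (M : I -> gmod A) : gmod A :=
  @GMod A (prodm M) (fun i => [set x | forall j, gdeg (M j) i (x j)]).

Notation "\V_ s" := (cspan (val s)) (at level 8, s at level 2, format "\V_ s").

(* A sheaf on the fan space, given by its values on the open sets <s> and the
   restriction maps from <s> to <t> for [face t s]; [res s t] is meaningless
   when [t] is not a face of [s]. Its values on all open sets are the [sections]
   below. *)
Record sheaf (R : realType) (V : vectType R) (D : fan V) := Sheaf {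
  stalk :> forall s : D, gmod (Sym R \V_s);
  res : forall s t : D,
    {linear stalk s -> rscal (Sres \V_s \V_t) (stalk t)};
  res_id : forall (s : D) (x : stalk s), res s s x = x;
  res_comp : forall s t u : D, face (val t) (val s) -> face (val u) (val t) ->
    forall x : stalk s, res t u (res s t x : stalk t) = res s u x }.

Section Sheaves.
Context (R : realType) (V : vectType R) (D : fan V).
Implicit Types (s t u : D) (F E : sheaf D) (L : {fset set V}).

Lemma face_space s t : face (val t) (val s) -> (\V_t <= \V_s)%VS.
Proof.
have [_ cD _ _] := fanP D.
by apply: face_cspan; apply: cD; exact: valP.
Qed.

Definition fan_open L := L = fset0 \/ ((L `<=` D)%fset /\ is_fan L).

Definition boundary s : {fset set V} :=
  [fset t in fan_cones D | `[< face t (val s) >] && (t != val s)]%fset.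

Definition idx L := {t : D | val t \in L}.

Lemma boundaryP s (t : idx (boundary s)) : face (val (val t)) (val s).
Proof.
by case: t => t /=; rewrite !inE /= => /and3P[_ /asboolP].
Qed.

Section Sections.
Context (F : sheaf D) (L : {fset set V}).

Definition stalkV s : gmod (Sym R {:V}) := grscal (Sres fullv \V_s) (F s).

Definition families : gmod (Sym R {:V}) :=
  gprod (fun t : idx L => stalkV (val t)).

Definition compatible : set families := [set x |
  forall t u : idx L, face (val (val u)) (val (val t)) ->
    res F (val t) (val u) (x t) = x u].

Fact compatible_submod : submod_prop compatible.
Proof.
split=> [t u _|a x y cx cy t u ut]; first exact: linear0.
rewrite !prodmD !prodmZ !rscalE linearD linearZ /= cx // cy //.
by rewrite -(Sres_comp a (face_space ut) (subvf _)).
Qed.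

Definition sections : gmod (Sym R {:V}) :=
  @GMod _ (submod compatible_submod) (fun i => [set x | gdeg families i (val x)]).

Definition section_at (x : sections) t (tL : val t \in L) : F t :=
  (val x : families) (exist _ t tL).
End Sections.

Section Rho.
Context (F : sheaf D) (s : D).

Definition rho_family (x : F s) : families F (boundary s) :=
  fun t : idx (boundary s) => res F s (val t) x.

Fact rho_compatible x : compatible (rho_family x).
Proof. by move=> t u ut; apply: res_comp => //; exact: boundaryP. Qed.

Definition rho_fun (x : stalkV F s) : sections F (boundary s) :=
  mk_submod (compatible_submod F (boundary s)) (rho_compatible x).

Fact rho_zmod_morphism : zmod_morphism rho_fun.
Proof.
move=> x y; apply: val_inj; rewrite raddfB /=.
by apply: functional_extensionality_dep => t; rewrite /rho_family raddfB.
Qed.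
HB.instance Definition _ := GRing.isZmodMorphism.Build
  (stalkV F s) (sections F (boundary s)) rho_fun rho_zmod_morphism.

Fact rho_scalable : scalable rho_fun.
Proof.
move=> a x; apply: val_inj; rewrite linearZ /=.
apply: functional_extensionality_dep => t; rewrite prodmZ /rho_family !rscalE.
rewrite linearZ; have e := Sres_comp a (face_space (boundaryP t)) (subvf _).
exact: (congr1 (fun b => b *: (res F s (val t) x : F (val t))) e).
Qed.
HB.instance Definition _ := GRing.isScalable.Build _
  (stalkV F s) (sections F (boundary s)) *:%R rho_fun rho_scalable.

Definition rho : {linear stalkV F s -> sections F (boundary s)} := rho_fun.

Definition Kspace : gmod R := gkernel (bar_map rho).
End Rho.

Definition graded_sheaf F :=
  (forall s, graded_Sym_module (F s)) /\
  (forall s t, face (val t) (val s) ->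
     forall i x, gdeg (F s) i x -> gdeg (F t) i (res F s t x)).

Definition flabby F := forall L, fan_open L -> forall x : sections F L,
  exists y : sections F D,
    forall t (tL : val t \in L), section_at y (valP t) = section_at x tL.

Definition pure F :=
  [/\ graded_sheaf F, flabby F & forall s, fg_free_graded (F s)].

Definition sheaf_iso F E := exists f : forall s, {linear F s -> E s},
  (forall s, gmod_iso (f s)) /\
  forall s t, face (val t) (val s) ->
    forall x, f t (res F s t x) = res E s t (f s x).

(* [E] results, up to isomorphism at each stage, from the inductive
   construction of the simple sheaf of [s], for some choice of the sections
   [sec] of the residue class maps. *)
Definition is_simple s E :=
  [/\ graded_sheaf E,
      forall t, (cdim (val t) <= cdim (val s))%N -> t != s -> forall x : E t, x = 0,
      exists f : {linear Sym_self R (\dim \V_s) -> E s}, gmod_iso f &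
      forall t, (cdim (val s) < cdim (val t))%N ->
        let Ebd := sections E (boundary t) in
        exists sec : {linear bar Ebd -> rscal (mC R _) Ebd},
        exists f : {linear gtensor (Sym_self R (\dim \V_t)) (bar Ebd) -> E t},
          [/\ forall v, bar_class Ebd (sec v) = v,
              forall i v, gdeg (bar Ebd) i v -> gdeg Ebd i (sec v),
              gmod_iso f &
              forall (a : Sym R \V_t) v u (ut : val u \in boundary t),
                res E t u (f (mtens (mC R _) (a : Sym_self R _) v)) =
                Sres \V_t \V_u a *: section_at (sec v) ut]].

Section TensorSheaf.
Context (E : sheaf D) (K : gmod R).

Definition tensor_res s t :
    {linear gtensor (E s) K -> rscal (Sres \V_s \V_t) (gtensor (E t) K)} :=
  mtensor_map (@SresC R V \V_s \V_t) (res E s t).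

Fact tensor_res_id s (x : gtensor (E s) K) : tensor_res s s x = x.
Proof.
apply: (@mtensor_ext _ _ _ _ _ _ (tensor_res s s) idfun) => m y.
by rewrite /tensor_res /= mtensor_mapE res_id.
Qed.

Fact tensor_res_comp s t u : face (val t) (val s) -> face (val u) (val t) ->
  forall x : gtensor (E s) K,
    tensor_res t u (tensor_res s t x : gtensor (E t) K) = tensor_res s u x.
Proof.
move=> ts ut; apply: (@mtensor_ext _ _ _ _ _ _
  (tensor_res t u \o tensor_res s t) (tensor_res s u)) => m y.
by rewrite /tensor_res /= !mtensor_mapE res_comp.
Qed.

Definition tensor_sheaf : sheaf D :=
  @Sheaf R V D (fun s => gtensor (E s) K) tensor_res tensor_res_id tensor_res_comp.
End TensorSheaf.

(* Finite direct sums of modules are realised as products. *)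
Section DirectSum.
Context (G : D -> sheaf D).

Definition dsum_stalk t := gprod (fun s => G s t).

Definition dsum_fun t u (x : dsum_stalk t) : rscal (Sres \V_t \V_u) (dsum_stalk u) :=
  fun s => res (G s) t u (x s).

Fact dsum_zmod_morphism t u : zmod_morphism (@dsum_fun t u).
Proof.
by move=> x y; apply: functional_extensionality_dep => s; rewrite /dsum_fun raddfB.
Qed.
HB.instance Definition _ t u := GRing.isZmodMorphism.Build (dsum_stalk t)
  (rscal (Sres \V_t \V_u) (dsum_stalk u)) (@dsum_fun t u) (@dsum_zmod_morphism t u).

Fact dsum_scalable t u : scalable (@dsum_fun t u).
Proof.
by move=> a x; apply: functional_extensionality_dep => s; rewrite /dsum_fun linearZ.
Qed.
HB.instance Definition _ t u := GRing.isScalable.Build _ (dsum_stalk t)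
  (rscal (Sres \V_t \V_u) (dsum_stalk u)) *:%R (@dsum_fun t u) (@dsum_scalable t u).

Definition dsum_res t u :
    {linear dsum_stalk t -> rscal (Sres \V_t \V_u) (dsum_stalk u)} := @dsum_fun t u.

Fact dsum_res_id t (x : dsum_stalk t) : dsum_res t t x = x.
Proof. by apply: functional_extensionality_dep => s; exact: res_id. Qed.

Fact dsum_res_comp s t u : face (val t) (val s) -> face (val u) (val t) ->
  forall x : dsum_stalk s,
    dsum_res t u (dsum_res s t x : dsum_stalk t) = dsum_res s u x.
Proof.
by move=> ts ut x; apply: functional_extensionality_dep => v; exact: res_comp.
Qed.

Definition dsum_sheaf : sheaf D :=
  @Sheaf R V D dsum_stalk dsum_res dsum_res_id dsum_res_comp.
End DirectSum.
End Sheaves.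

(* Main.v *)
(** The isomorphism is built cone by cone, by induction on the dimension.
    Suppose that the pure sheaf F and the sum G of the E_s (x) K_s are identified
    on the boundary of a cone t.  By flabbiness F_t maps onto the sections over
    the boundary, so a basis of K_t lifts to elements of F_t restricting to zero,
    and a minimal homogeneous generating family of the sections over the boundary
    lifts to F_t as well; together, the residue classes of these lifts form a
    basis of F_t / m F_t.  The transition matrix from a homogeneous basis of F_t
    then has a homogeneous determinant with nonzero constant term, that is, an
    invertible one, so the lifts form a basis of F_t.  By construction G_t has a
    basis with the same degrees and the same restrictions to the boundary, and
    matching the two bases extends the isomorphism to t.

    No noetherianity is needed: the sections of E_s over the boundary of t have to
    be finitely generated only when K_s is nonzero, and then they are a quotient
    of F_t.  In the construction of the simple sheaves, where these residue spaces
    are not known to be finite-dimensional, graded sections of the residue class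
    maps come from Zorn's lemma. *)

From mathcomp Require Import perm.
Require Import Defs.
From HB Require Import structures.
From mathcomp Require Import all_boot all_order all_algebra.
From mathcomp Require Import finmap boolp classical_sets reals.
From mathcomp Require Import mpoly.

Set Implicit Arguments.
Unset Strict Implicit.
Unset Printing Implicit Defensive.
Import Order.TTheory GRing.Theory Num.Theory.

Local Open Scope classical_set_scope.
Local Open Scope ring_scope.

(** * Gradings *)

(** Residues are taken over Sym V, whereas [F t] is free over Sym V_t. The restriction Sym V -> Sym
    V_t is surjective and preserves constant coefficients, so both algebras give the same residue
    module, and coordinates over Sym V_t decide which elements vanish modulo m. A homogeneous basis
    of K_s turns E_s (x) K_s into a finite sum of shifted copies of E_s, and G is handled only
    through its projections to these copies. What a copy of E_s contributes to the stalk at t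
    depends on s and t: one generator with zero restriction to the boundary if s = t, nothing if t
    is another cone of dimension at most dim s, and otherwise generators whose restrictions form a
    minimal generating family over the boundary. The generators of the first kind match the basis of
    K_t. The isomorphism is built from G to F, because in G a basis of the stalk and its boundary
    values are given by construction, while in F they have to be produced by lifting. It is inverted
    only at the end. *)

Section LinearOf.
Context (A : nzRingType) (U W : lmodType A) (f : U -> W).

(** The proof of linearity is an argument, so that the linear structure can be attached to the
    function itself. *)
Definition lin_fun of linear f := f.
Context (fL : linear f).
HB.instance Definition _ := GRing.isLinear.Build A U W *:%R (lin_fun fL) fL.
Definition lin_of : {linear U -> W} := lin_fun fL.
End LinearOf.

Section Grading.
Context (A : nzRingType) (dA : int -> set A).
Implicit Type M : gmod A.

(** The function [c] is required to vanish off the list [s]: decompositions with different lists can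
    then be compared as functions. *)
Definition hdec M (x : M) (c : int -> M) := (forall i, gdeg M i (c i)) /\
  exists s : seq int,
    [/\ uniq s, forall i, i \notin s -> c i = 0 & x = \sum_(i <- s) c i].

(* The homogeneous component of degree [i], a junk value unless [M] is graded. *)
Definition hp M (i : int) (x : M) : M := xget (fun=> 0) [set c | hdec x c] i.
Arguments hp {M} i x.

Section Graded.
Context (M : gmod A) (hM : is_graded dA M).

Lemma gdeg0 i : gdeg M i 0. Proof. by case: hM => h _ _ _; case: (h i). Qed.

Lemma gdegB i x y : gdeg M i x -> gdeg M i y -> gdeg M i (x - y).
Proof. by case: hM => h _ _ _; case: (h i) => _; apply. Qed.

Lemma gdegN i x : gdeg M i x -> gdeg M i (- x).
Proof. by move=> xi; rewrite -sub0r; apply: gdegB => //; exact: gdeg0. Qed.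

Lemma gdegD i x y : gdeg M i x -> gdeg M i y -> gdeg M i (x + y).
Proof. by move=> xi yi; rewrite -[y]opprK; apply: gdegB => //; exact: gdegN. Qed.

Lemma gdegZ i j a x : dA i a -> gdeg M j x -> gdeg M (i + j) (a *: x).
Proof. by case: hM => _ h _ _; exact: h. Qed.

Lemma gdeg_sum i (I : Type) (r : seq I) (P : pred I) (F : I -> M) :
  (forall j, P j -> gdeg M i (F j)) -> gdeg M i (\sum_(j <- r | P j) F j).
Proof.
by move=> hF; apply: big_ind => //; [exact: gdeg0|move=> *; exact: gdegD].
Qed.

Lemma hdec_widen (c : int -> M) (s t : seq int) : uniq s -> uniq t -> {subset s <= t} ->
  (forall i, i \notin s -> c i = 0) ->
  \sum_(i <- s) c i = \sum_(i <- t) c i :> M.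
Proof.
move=> us ut st c0; rewrite [RHS](bigID (mem s)) /= [X in _ + X]big1 ?addr0.
  rewrite -[RHS]big_filter; apply/perm_big/uniq_perm; rewrite ?filter_uniq //.
  by move=> i; rewrite mem_filter; case: (boolP (i \in s)) => // /st ->.
by move=> i /c0.
Qed.

Lemma hdec_uniq (x : M) c d : hdec x c -> hdec x d -> c =1 d.
Proof.
move=> [cd [s [us s0 xs]]] [dd [t [ut t0 xt]]] i.
pose w := undup (s ++ t).
have uw : uniq w by exact: undup_uniq.
have sw : {subset s <= w} by move=> j js; rewrite mem_undup mem_cat js.
have tw : {subset t <= w} by move=> j js; rewrite mem_undup mem_cat js orbT.
have [iw|] := boolP (i \in w); last first.
  by rewrite mem_undup mem_cat negb_or => /andP[/s0 -> /t0 ->].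
apply/eqP; rewrite -subr_eq0; apply/eqP.
case: hM => _ _ _ /(_ w (fun i => c i - d i) uw); apply => //.
  by move=> j; exact: gdegB.
rewrite sumrB -(hdec_widen us uw sw s0) -(hdec_widen ut uw tw t0).
by rewrite -xs -xt subrr.
Qed.

Lemma hp_hdec (x : M) : hdec x (hp ^~ x).
Proof.
suff [c xc] : exists c, hdec x c.
  by rewrite /hp; case: xgetP => [y -> //|/(_ c)].
case: hM => _ _ /(_ x)[s [c [cd xs]]] _.
(* The list provided by [is_graded] may contain repetitions, so each component is taken with the
   multiplicity of its degree. *)
exists (fun i => c i *+ count_mem i s); split.
  move=> i; elim: (count_mem i s) => [|m IH]; first by rewrite mulr0n; exact: gdeg0.
  by rewrite mulrS; apply: gdegD.
exists (undup s); split; first exact: undup_uniq.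
  by move=> i; rewrite mem_undup => /count_memPn ->; rewrite mulr0n.
rewrite xs -big_undup_iterop_count; apply: eq_bigr => i _.
by rewrite Monoid.iteropE iter_addr addr0.
Qed.

Lemma hp_deg i (x : M) : gdeg M i (hp i x).
Proof. by case: (hp_hdec x). Qed.

Lemma hp_sum (x : M) : exists s : seq int,
  [/\ uniq s, forall i, i \notin s -> hp i x = 0 & x = \sum_(i <- s) hp i x].
Proof. by case: (hp_hdec x). Qed.

Lemma hp_dec (x : M) c : hdec x c -> forall i, hp i x = c i.
Proof. by move=> xc i; apply: (hdec_uniq (hp_hdec x) xc). Qed.

Lemma hpE i j (x : M) : gdeg M j x -> hp i x = if i == j then x else 0.
Proof.
move=> xj; apply: (hp_dec (c := fun i => if i == j then x else 0)); split.
  by move=> l; case: eqP => [-> //|_]; exact: gdeg0.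
exists [:: j]; split=> // [l|]; last by rewrite big_seq1 eqxx.
by rewrite inE => /negPf ->.
Qed.

Lemma hp_id i (x : M) : gdeg M i x -> hp i x = x.
Proof. by move=> /hpE ->; rewrite eqxx. Qed.

Lemma hp_ne i j (x : M) : gdeg M i x -> j != i -> hp j x = 0.
Proof. by move=> /hpE -> /negPf ->. Qed.

Lemma hpB i : {morph hp (M := M) i : x y / x - y}.
Proof.
move=> x y; apply: (hp_dec (c := fun i => hp i x - hp i y)); split.
  by move=> j; apply: gdegB; exact: hp_deg.
have [s [us s0 xs]] := hp_sum x; have [t [ut t0 xt]] := hp_sum y.
pose w := undup (s ++ t).
have uw : uniq w by exact: undup_uniq.
exists w; split=> // [j|].
  by rewrite mem_undup mem_cat negb_or => /andP[/s0 -> /t0 ->]; rewrite subrr.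
rewrite sumrB {1}xs {1}xt; congr (_ - _); apply: hdec_widen => // j js.
  by rewrite mem_undup mem_cat js.
by rewrite mem_undup mem_cat js orbT.
Qed.

Lemma hp0 i : hp (M := M) i 0 = 0.
Proof. by have := hpB i 0 0; rewrite !subrr. Qed.

Lemma hpN i : {morph hp (M := M) i : x / - x}.
Proof. by move=> x; rewrite -[X in hp i X]sub0r hpB hp0 sub0r. Qed.

Lemma hpD i : {morph hp (M := M) i : x y / x + y}.
Proof. by move=> x y; rewrite -[X in hp i (_ + X)]opprK hpB hpN opprK. Qed.

Lemma hp_bigsum i (I : Type) (r : seq I) (P : pred I) (F : I -> M) :
  hp i (\sum_(j <- r | P j) F j) = \sum_(j <- r | P j) hp i (F j).
Proof. by apply: big_morph => [x y|]; [exact: hpD|exact: hp0]. Qed.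

Lemma hpZ0 c i (x : M) : dA 0 c -> hp i (c *: x) = c *: hp i x.
Proof.
move=> c0; apply: (hp_dec (c := fun i => c *: hp i x)); split.
  by move=> j; rewrite -[j]add0r; apply: gdegZ => //; rewrite add0r; exact: hp_deg.
have [s [us s0 xs]] := hp_sum x; exists s; split=> // [j /s0 -> |].
  by rewrite scaler0.
by rewrite -scaler_sumr -xs.
Qed.

Lemma hp_sum_in (x : M) s : uniq s -> (forall i, i \notin s -> hp i x = 0) ->
  x = \sum_(i <- s) hp i x.
Proof.
move=> us s0; have [t [ut t0 xt]] := hp_sum x.
pose w := undup (s ++ t).
have uw : uniq w by exact: undup_uniq.
rewrite {1}xt (hdec_widen ut uw _ t0); last first.
  by move=> j js; rewrite mem_undup mem_cat js orbT.
rewrite (hdec_widen us uw _ s0) // => j js.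
by rewrite mem_undup mem_cat js.
Qed.

Lemma hp_eq0 (x : M) : (forall i, hp i x = 0) -> x = 0.
Proof. by move=> x0; rewrite (@hp_sum_in x [::]) // big_nil. Qed.

Lemma hp_eq (x y : M) : (forall i, hp i x = hp i y) -> x = y.
Proof.
move=> xy; apply/eqP; rewrite -subr_eq0; apply/eqP/hp_eq0 => i.
by rewrite hpB xy subrr.
Qed.

End Graded.

(** Applying [P i] to a vanishing sum of homogeneous elements isolates the term of degree [i], hence
    uniqueness of components. Submodules, quotients, products and the symmetric algebra are graded
    through this criterion. *)
Lemma graded_of_proj M (P : int -> M -> M) :
  (forall i, gdeg M i 0 /\
     (forall x y, gdeg M i x -> gdeg M i y -> gdeg M i (x - y))) ->
  (forall i j a x, dA i a -> gdeg M j x -> gdeg M (i + j) (a *: x)) ->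
  (forall i x, gdeg M i (P i x)) ->
  (forall i j x, gdeg M j x -> P i x = if i == j then x else 0) ->
  (forall i, {morph P i : x y / x - y}) ->
  (forall x, exists s : seq int, x = \sum_(i <- s) P i x) ->
  is_graded dA M.
Proof.
move=> dB dZ Pd Pid PB Psum; split=> // [x|s c us cd cs i si].
  by have [s xs] := Psum x; exists s, (P ^~ x).
have P0 : P i 0 = 0 by have := PB i 0 0; rewrite !subrr.
have PD : {morph P i : x y / x + y}.
  move=> x y; rewrite -[X in P i (_ + X)]opprK -[X in P i (_ - X)]sub0r !PB P0.
  by rewrite sub0r opprK.
move: (congr1 (P i) cs); rewrite P0 (big_morph (P i) PD P0) (bigD1_seq i) //=.
rewrite (Pid _ _ _ (cd i)) eqxx big1 ?addr0 // => j ji.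
by rewrite (Pid _ _ _ (cd j)) eq_sym (negPf ji).
Qed.

Definition self_gmod : gmod A := @GMod A A^o dA.

Section Action.
Context (hA : is_graded dA self_gmod) (M : gmod A) (hM : is_graded dA M).

Definition hpa i (a : A) : A := hp (M := self_gmod) i a.

Lemma hpZ i j a (x : M) : gdeg M j x -> hp i (a *: x) = hpa (i - j) a *: x.
Proof.
move=> xj; have [s [us s0 ea]] := hp_sum hA a.
rewrite {1}ea scaler_suml (hp_bigsum hM) /hpa.
have [ijs|ijs] := boolP (i - j \in s); last first.
  rewrite s0 // scale0r big1_seq // => l /andP[_ ls]; apply: (hp_ne hM).
    by apply: (gdegZ hM) xj; exact: (hp_deg hA).
  by apply: contraNneq ijs => ->; rewrite addrK.
rewrite (bigD1_seq _ ijs) //= (hpE hM i (j := i)); last first.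
  rewrite -[X in gdeg M X](subrK j); apply: (gdegZ hM) xj; exact: (hp_deg hA).
rewrite eqxx big1 ?addr0 // => l lij; apply: (hp_ne hM).
  by apply: (gdegZ hM) xj; exact: (hp_deg hA).
by apply: contraNneq lij => ->; rewrite addrK.
Qed.
End Action.
End Grading.
Arguments hp {A M} i x.

(** Only additivity is asked and the two base rings may differ, so that restriction maps, residue
    class maps and the evaluation of sections at a cone are all covered. *)
Lemma hp_map (A B : nzRingType) (dA : int -> set A) (dB : int -> set B)
    (M : gmod A) (N : gmod B) (hM : is_graded dA M) (hN : is_graded dB N)
    (f : M -> N) (m : int) : {morph f : x y / x - y} ->
  (forall i x, gdeg M i x -> gdeg N (i + m) (f x)) ->
  forall i x, hp (i + m) (f x) = f (hp i x).
Proof.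
move=> fB fd i x.
have f0 : f 0 = 0 by have := fB 0 0; rewrite !subrr.
have fD : {morph f : x y / x + y}.
  by move=> a b; rewrite -[X in f (_ + X)]opprK -[X in f (_ - X)]sub0r !fB f0 sub0r opprK.
have [s [us s0 xs]] := hp_sum hM x.
rewrite {1}xs (big_morph f fD f0) (hp_bigsum hN).
have [ijs|ijs] := boolP (i \in s); last first.
  rewrite s0 // f0 big1_seq // => l /andP[_ ls]; apply: (hp_ne hN).
    by apply: fd; exact: (hp_deg hM).
  by apply: contraNneq ijs => /addIr ->.
rewrite (bigD1_seq _ ijs) //= (hp_id hN) ?big1 ?addr0 // => [l li|].
  apply: (hp_ne hN); first by apply: fd; exact: (hp_deg hM).
  by apply: contraNneq li => /addIr ->.
by apply: fd; exact: (hp_deg hM).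
Qed.

(** * Gradings of restrictions of scalars, submodules, quotients and products *)

Section GradedConstructions.
Context (A : nzRingType) (dA : int -> set A).

Lemma graded_rscal (B : nzRingType) (dB : int -> set B) (phi : {rmorphism A -> B})
    (M : gmod B) :
  (forall i a, dA i a -> dB i (phi a)) -> is_graded dB M ->
  is_graded dA (grscal phi M).
Proof.
move=> hphi [h1 h2 h3 h4]; split=> // i j a x da xj.
exact: (h2 i j (phi a) x (hphi _ _ da) xj).
Qed.

Lemma graded_submod (M : gmod A) (P : set M) (hP : submod_prop P) :
  is_graded dA M -> (forall x, P x -> forall i, P (hp i x)) ->
  is_graded dA (@GMod A (submod hP) (fun i => [set x | gdeg M i (val x)])).
Proof.
move=> hM Php; set N := GMod _.
pose P' i (x : N) : N := mk_submod hP (Php _ (submodP x) i).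
apply: (@graded_of_proj _ _ N P') => /=.
- move=> i; split=> [|x y xi yi]; first exact: (gdeg0 hM).
  exact: (gdegB hM).
- by move=> i j a x da xj; exact: (gdegZ hM).
- by move=> i x; exact: (hp_deg hM).
- move=> i j x xj; apply: val_inj => /=; rewrite (hpE hM _ xj).
  by case: eqP => // _; rewrite raddf0.
- by move=> i x y; apply: val_inj; exact: (hpB hM).
- move=> x; have [s [_ _ xs]] := hp_sum hM (val x); exists s; apply: val_inj.
  by rewrite raddf_sum /= -xs.
Qed.

Lemma graded_quot (M : gmod A) (S : set M) : (forall a, dA 0 a) ->
  is_graded dA M -> (forall x, S x -> forall i, hp i x \in mspan S) ->
  is_graded dA (@GMod A (quotm S) (fun i => [set qpi S x | x in gdeg M i])).
Proof.
move=> dA0 hM Shp.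
have hS x i : x \in mspan S -> hp i x \in mspan S.
  move=> /asboolP[s [sS ->]]; rewrite (hp_bigsum hM) big_seq rpred_sum // => p ps.
  by rewrite (hpZ0 hM) // rpredZ // Shp //; exact: sS.
(* The component of a class does not depend on the representative, so it may be computed on the
   chosen one. *)
have hpE' i x : qpi S (hp i (qrepr (qpi S x))) = qpi S (hp i x).
  apply/eqP; rewrite -subr_eq0 -raddfB qpi_eq0 -(hpB hM) hS //.
  by rewrite -qpi_eq0 raddfB /= qreprK subrr.
set N := GMod _; pose P i (q : N) : N := qpi S (hp i (qrepr q)).
apply: (@graded_of_proj _ _ N P) => /=.
- move=> i; split=> /=; first by exists 0; [exact: (gdeg0 hM)|rewrite raddf0].
  move=> _ _ [x xi <-] [y yi <-]; exists (x - y); first exact: (gdegB hM).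
  by rewrite raddfB.
- move=> i j a _ da [x xj <-]; exists (a *: x); first exact: (gdegZ hM).
  by rewrite linearZ.
- by move=> i q; exists (hp i (qrepr q)) => //; exact: (hp_deg hM).
- move=> i j _ [x xj <-]; rewrite /P hpE' (hpE hM _ xj).
  by case: eqP => // _; rewrite raddf0.
- by move=> i q r; rewrite -[q]qreprK -[r]qreprK -raddfB /P !hpE' (hpB hM) raddfB.
- move=> q; rewrite -[q]qreprK; have [s [_ _ xs]] := hp_sum hM (qrepr q).
  by exists s; rewrite {1}xs raddf_sum; apply: eq_bigr => i _; rewrite /P hpE'.
Qed.

Lemma graded_prod (I : Type) (n : nat) (g : 'I_n -> I) (M : I -> gmod A) :
  (forall i, exists j, g j = i) -> (forall i, is_graded dA (M i)) ->
  is_graded dA (gprod M).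
Proof.
move=> gsurj hM.
pose P i (x : gprod M) : gprod M := fun j => hp i (x j).
apply: (@graded_of_proj _ _ _ P) => /=.
- move=> i; split=> [j|x y xi yi j]; first exact: (gdeg0 (hM j)).
  exact: (gdegB (hM j)).
- by move=> i j a x da xj l; exact: (gdegZ (hM l)).
- by move=> i x j; exact: (hp_deg (hM j)).
- move=> i j x xj; apply: functional_extensionality_dep => l.
  by rewrite /P (hpE (hM l) _ (xj l)); case: eqP.
- move=> i x y; apply: functional_extensionality_dep => l.
  exact: (hpB (hM l)).
- move=> x; have /choice[s hs] : forall j, exists s : seq int,
      [/\ uniq s, forall i, i \notin s -> hp i (x (g j)) = 0
        & x (g j) = \sum_(i <- s) hp i (x (g j))].
    by move=> j; exact: (hp_sum (hM (g j))).
  (* As there are finitely many factors, all supports lie in one list. *)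
  pose w := undup (flatten [seq s j | j <- enum 'I_n]).
  exists w; apply: functional_extensionality_dep => l.
  have [j <-] := gsurj l; have [us s0 _] := hs j.
  transitivity (\sum_(i <- w) hp i (x (g j))).
    apply: (hp_sum_in (hM (g j))); first exact: undup_uniq.
    move=> i iw; apply: s0; apply: contraNN iw => iw; rewrite mem_undup.
    by apply/flattenP; exists (s j) => //; apply/map_f; rewrite mem_enum.
  elim: w => [|i w IH]; first by rewrite !big_nil.
  by rewrite !big_cons IH.
Qed.
End GradedConstructions.

Lemma scalar_deg0 (k : nzRingType) (c : k) : scalar_deg 0 c.
Proof. by left. Qed.

(** * Gradings of the symmetric algebra and of residue modules *)

Section SymGrading.
Context (k : comNzRingType) (n : nat).
Implicit Types (a b : {mpoly k[n]}) (i j : int).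
Local Notation Sdeg := (@Sym_deg k n).

Lemma Sym_degB i a b : Sdeg i a -> Sdeg i b -> Sdeg i (a - b).
Proof.
case=> [[q -> aq]|->]; last first.
  case=> [[q -> bq]|->]; last by right; rewrite subrr.
  by left; exists q => //; rewrite sub0r rpredN.
case=> [[r /eqP]|->]; last by left; exists q => //; rewrite subr0.
rewrite eqz_nat => /eqP/double_inj <- br.
by left; exists q => //; rewrite rpredB.
Qed.

Lemma Sym_degM i j a b : Sdeg i a -> Sdeg j b -> Sdeg (i + j) (a * b).
Proof.
case=> [[q -> aq]|->]; last by right; rewrite mul0r.
case=> [[r -> br]|->]; last by right; rewrite mulr0.
by left; exists (q + r)%N; [rewrite doubleD|exact: dhomogM].
Qed.

Lemma Sym_degC (c : k) : Sdeg 0 c%:MP.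
Proof.
left; exists 0%N => //; rewrite -[c%:MP]mulr1 mul_mpolyC.
by apply: rpredZ; exact: dhomog1.
Qed.

Lemma Sym_deg_const i a : Sdeg i a -> i != 0 -> a@_0%MM = 0.
Proof.
case=> [[q -> aq] q0|-> _]; last exact: mcoeff0.
apply: (dhomog_nemf_coeff aq); rewrite /= mdeg0.
by apply: contraNneq q0 => <-.
Qed.

(** A nonzero constant coefficient forces degree 0, and forms of degree 0 are constants. This is
    what makes homogeneous determinants invertible. *)
Lemma Sym_deg_unit i a : Sdeg i a -> a@_0%MM != 0 -> a = (a@_0%MM)%:MP.
Proof.
move=> ai a0; have := ai; case=> [[q eq aq]|a00]; last by rewrite a00 mcoeff0 eqxx in a0.
have q0 : q = 0%N.
  apply/eqP; apply: contraNT a0 => q0; apply/eqP; apply: (Sym_deg_const ai).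
  by rewrite eq eqz_nat double_eq0.
apply/mpolyP => m; rewrite mcoeffC; have [<-|m0] := eqVneq 0%MM m.
  by rewrite mulr1.
rewrite mulr0; apply: (dhomog_nemf_coeff aq); rewrite /= q0 mdeg_eq0.
by rewrite eq_sym.
Qed.

Lemma graded_Sym : is_graded Sdeg (Sym_self k n).
Proof.
(* The grading is doubled: an even degree [m] selects the forms of polynomial degree [m./2], odd and
   negative degrees give 0. *)
pose P (i : int) (a : Sym_self k n) : Sym_self k n :=
  if i is Posz m then if odd m then 0 else pihomog mdeg m./2 a else 0.
apply: (@graded_of_proj _ _ _ P) => /=.
- by move=> i; split; [right|move=> x y; exact: Sym_degB].
- by move=> i j a x; exact: Sym_degM.
- move=> [m|m] x /=; last by right.
  case: ifP => [_|/negbT modd]; first by right.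
  left; exists m./2; last exact: pihomogP.
  by rewrite -[m in LHS]odd_double_half (negPf modd).
- move=> i j x; case=> [[q -> xq]|->]; last first.
    by case: i => [m|m]; rewrite /= if_same //; case: ifP => // _; rewrite pihomog0.
  case: i => [m|m] //=; rewrite eqz_nat; case: ifP => modd.
    by case: eqP => // em; rewrite em odd_double in modd.
  have em : m = m./2.*2 by rewrite -[LHS]odd_double_half modd.
  have [mq|mq] := eqVneq m q.*2; first by rewrite mq doubleK pihomog_dE.
  by apply: (pihomog_ne0 _ xq); apply: contra_neq mq => ->.
- move=> [m|m] x y /=; last by rewrite subrr.
  by case: ifP => _; rewrite ?subrr // pihomogB.
- move=> x; exists (map (fun i : nat => (i.*2)%N : int) (iota 0 (msize (x : {mpoly k[n]})))).
  rewrite {1}(pihomog_partitionE (mf := mdeg) (k := msize (x : {mpoly k[n]})) (p := x)) // big_map.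
  rewrite -(big_mkord xpredT (fun d => pihomog mdeg d x)) /index_iota subn0.
  apply: eq_bigr => i _ /=.
  by rewrite odd_double doubleK.
Qed.

(** Components of nonzero degree have no constant coefficient, so the component of degree 0 carries
    that of [a]. Homogeneity of the maximal ideal is what makes [bar M] graded. *)
Lemma maxideal_hpa a i : maxideal a -> maxideal (hpa Sdeg i a).
Proof.
move=> ma; have [i0|i0] := eqVneq i 0; last first.
  by apply: Sym_deg_const i0; exact: (hp_deg graded_Sym).
have [s [us s0 ea]] := hp_sum graded_Sym a.
have c0 j : j != 0 -> (hp (M := Sym_self k n) j a)@_0%MM = 0.
  by apply: Sym_deg_const; exact: (hp_deg graded_Sym).
move: ma; rewrite /maxideal /= {1}ea raddf_sum /= => ma.
rewrite i0; have [s1|s1] := boolP (0 \in s); last first.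
  by rewrite /hpa s0 ?mcoeff0.
by move: ma; rewrite (bigD1_seq _ s1) //= big1 ?addr0 // => j; exact: c0.
Qed.

Section Residue.
Context (M : gmod {mpoly k[n]}) (hM : graded_Sym_module M).

Lemma graded_mC : is_graded (@scalar_deg k) (grscal (mC k n) M).
Proof.
apply: graded_rscal hM => i c [->|->]; first exact: Sym_degC.
by right; exact: mpolyC0.
Qed.

Lemma hp_mC i (x : M) : hp (M := grscal (mC k n) M) i x = hp i x.
Proof.
by apply: (hp_dec graded_mC); exact: (hp_hdec hM x).
Qed.

Lemma graded_bar : is_graded (@scalar_deg k) (bar M).
Proof.
apply: (graded_quot (M := grscal (mC k n) M) (@scalar_deg0 k) graded_mC).
move=> _ [a [x [ma ->]]] i; have [s [us s0 ex]] := hp_sum hM x.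
rewrite hp_mC ex scaler_sumr (hp_bigsum hM) rpred_sum // => j _.
rewrite (hpZ graded_Sym hM i a (hp_deg hM j x)).
apply: mspan_gen; exists (hpa Sdeg (i - j) a), (hp j x); split=> //.
exact: maxideal_hpa.
Qed.

Lemma hp_bar i (x : M) : hp (M := bar M) i (bar_class M x) = bar_class M (hp i x).
Proof.
have := hp_map graded_mC graded_bar (f := bar_class M) (m := 0) _ _ i x.
rewrite addr0 hp_mC; apply; first exact: raddfB.
by move=> j y yj; rewrite addr0; exists y.
Qed.
End Residue.
End SymGrading.

Lemma graded_kernel (k : comNzRingType) (K L : gmod k) (f : {linear K -> L}) :
  is_graded (@scalar_deg k) K -> is_graded (@scalar_deg k) L ->
  (forall i x, gdeg K i x -> gdeg L i (f x)) ->
  is_graded (@scalar_deg k) (gkernel f).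
Proof.
move=> hK hL hf; apply: (graded_submod (kernel_submod f) hK) => x fx i.
rewrite /kernel /=; have := hp_map hK hL (f := f) (m := 0) _ _ i x.
rewrite addr0 fx (hp0 hL) => <- //; first exact: raddfB.
by move=> j y; rewrite addr0; exact: hf.
Qed.

(** * Homogeneous bases *)

Section LinearBases.
Context (k : fieldType).
Implicit Type W : lmodType k.

(** The basis is indexed by the [x] satisfying [P]: one index type will carry both the kernel
    generators and the boundary generators of a stalk. *)
Definition rbasis W (X : finType) (P : pred X) (b : X -> W) :=
  (forall w, exists c : X -> k, w = \sum_(x | P x) c x *: b x) /\
  (forall c : X -> k, \sum_(x | P x) c x *: b x = 0 -> forall x, P x -> c x = 0).

Definition independent W m (b : 'I_m -> W) :=
  forall c : 'I_m -> k, \sum_i c i *: b i = 0 -> forall i, c i = 0.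

(** A finiteness condition that passes to subspaces without a basis of the subspace being known; it
    will be applied to the kernels K_t. *)
Definition indep_bounded W :=
  exists r : nat, forall m (b : 'I_m -> W), independent b -> (m <= r)%N.

(** More than [r] vectors have a coordinate matrix with more rows than columns. A nonzero row of its
    left kernel is a linear relation, which injectivity of [f] pulls back to [W]. *)
Lemma indep_bounded_inj W W' (f : {linear W -> W'}) : injective f ->
  finite_dim W' -> indep_bounded W.
Proof.
move=> finj [r [e he]]; exists r => m b bind; rewrite leqNgt; apply/negP => rm.
have /choice[P hP] : forall i, exists c : 'I_r -> k, f (b i) = \sum_j c j *: e j.
  by move=> i; exact: he.
pose Q : 'M_(m, r) := \matrix_(i, j) P i j.
have : kermx Q != 0.
  rewrite -mxrank_eq0 mxrank_ker subn_eq0 -ltnNge.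
  exact: leq_ltn_trans (rank_leq_col Q) rm.
move=> /matrix0Pn[i0 [j0 nz]].
pose c j := kermx Q i0 j.
suff /bind/(_ j0) c0 : \sum_i c i *: b i = 0 by rewrite -/(c j0) c0 eqxx in nz.
apply: finj; rewrite raddf0 raddf_sum /=.
under eq_bigr => i _ do rewrite linearZ /= hP scaler_sumr.
rewrite exchange_big big1 // => j _.
under eq_bigr => i _ do rewrite scalerA.
rewrite -scaler_suml; have /matrixP/(_ i0 j) := mulmx_ker Q.
rewrite mxE [RHS]mxE => h; rewrite (_ : \sum_i _ = 0) ?scale0r //.
by rewrite -[RHS]h; apply: eq_bigr => i _; rewrite [Q i j]mxE.
Qed.

(** An independent homogeneous family of maximal length spans: a homogeneous vector outside its span
    could be adjoined, and every vector is a sum of homogeneous ones. *)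
Lemma hombasis (W : gmod k) : is_graded (@scalar_deg k) W -> indep_bounded W ->
  exists (m : nat) (d : 'I_m -> int) (b : 'I_m -> W),
    (forall i, gdeg W (d i) (b i)) /\ rbasis xpredT b.
Proof.
move=> hW [r hr].
pose Q m := `[< exists (d : 'I_m -> int) (b : 'I_m -> W),
  (forall i, gdeg W (d i) (b i)) /\ independent b >].
have exQ : exists m, Q m.
  exists 0%N; apply/asboolP; exists (fun=> 0), (fun=> 0); split; first by case.
  by move=> c _ [].
have ubQ m : Q m -> (m <= r)%N by move=> /asboolP[d [b [_ /hr]]].
case: (ex_maxnP exQ ubQ) => m /asboolP[d [b [bd bind]]] mmax.
exists m, d, b; split=> //; split; last by move=> c /bind c0 x _.
have hom i w : gdeg W i w -> exists c : 'I_m -> k, w = \sum_x c x *: b x.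
  move=> wi; apply: contrapT => nw.
  have : Q m.+1.
    apply/asboolP.
    exists (fun j => if unlift ord0 j is Some l then d l else i).
    exists (fun j => if unlift ord0 j is Some l then b l else w); split.
      by move=> j; case: unliftP.
    move=> c; rewrite big_ord_recl unlift_none => c0.
    have {}c0 : c ord0 *: w + \sum_l c (lift ord0 l) *: b l = 0.
      rewrite -[RHS]c0; congr (_ + _); apply: eq_bigr => l _.
      by rewrite liftK.
    have cz : c ord0 = 0.
      apply: contrapT => /eqP cnz; apply: nw.
      exists (fun l => - (c ord0)^-1 * c (lift ord0 l)).
      apply: (scalerI cnz); rewrite scaler_sumr.
      move/eqP: c0; rewrite addr_eq0 => /eqP ->.
      rewrite -sumrN; apply: eq_bigr => l _.
      by rewrite scalerA mulNr mulrN mulVKf // scaleNr.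
    move: c0; rewrite cz scale0r add0r => /bind c0 j.
    by case: (unliftP ord0 j) => [l ->|-> //]; exact: c0.
  by move=> /mmax; rewrite ltnn.
move=> w; have [s [_ _ ->]] := hp_sum hW w.
elim: s => [|i s [c IH]].
  by exists (fun=> 0); rewrite big_nil big1 // => x _; rewrite scale0r.
have [e he] := hom i _ (hp_deg hW i w).
exists (fun x => e x + c x); rewrite big_cons IH {1}he -big_split.
by apply: eq_bigr => x _; rewrite scalerDl.
Qed.

Lemma rbasis_finite_dim W m (b : 'I_m -> W) : rbasis xpredT b -> finite_dim W.
Proof. by case=> hb _; exists m, b. Qed.

Lemma rbasis_coord W (X : finType) (b : X -> W) : rbasis xpredT b ->
  exists c : X -> {linear W -> k^o},
    (forall w, w = \sum_x c x w *: b x) /\ forall x y, c x (b y) = (x == y)%:R.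
Proof.
move=> [bs bi].
have /choice[c hc] : forall w, exists c : X -> k, w = \sum_x c x *: b x by exact: bs.
have bI (a a' : X -> k) : \sum_x a x *: b x = \sum_x a' x *: b x -> a =1 a'.
  move=> /eqP; rewrite -subr_eq0 -sumrB => /eqP h x; apply/eqP.
  rewrite -subr_eq0; apply/eqP/(bi (fun x => a x - a' x)) => //.
  by rewrite -[RHS]h; apply: eq_bigr => y _; rewrite scalerBl.
have cL x : linear (fun w => c w x : k^o).
  move=> a u v; apply: (bI (c (a *: u + v)) (fun x => a * c u x + c v x)).
  rewrite -hc {1}[u]hc {1}[v]hc scaler_sumr -big_split; apply: eq_bigr => y _ /=.
  by rewrite scalerDl scalerA.
exists (fun x => lin_of (cL x)); split=> [w|x y]; first exact: hc.
apply: (bI (c (b y)) (fun x => (x == y)%:R)); rewrite -hc (bigD1 y) //= eqxx scale1r.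
by rewrite big1 ?addr0 // => z /negPf ->; rewrite scale0r.
Qed.
End LinearBases.

(** * Homogeneous bases of graded modules and their recognition modulo m *)

Section HomogeneousBases.
Context (k : fieldType) (n : nat).
Local Notation A := {mpoly k[n]}.
Local Notation Sdeg := (@Sym_deg k n).
Implicit Type M : gmod A.

(** Any finite index type is allowed, because the bases of direct sums are indexed by dependent
    sums. *)
Definition hbasis M (X : finType) (d : X -> int) (e : X -> M) :=
  [/\ forall x, gdeg M (d x) (e x),
      forall y, exists c : X -> A, y = \sum_x c x *: e x &
      forall c : X -> A, \sum_x c x *: e x = 0 -> forall x, c x = 0].

Lemma hbasis_inj M (X : finType) d (e : X -> M) : hbasis d e ->
  forall c c' : X -> A, \sum_x c x *: e x = \sum_x c' x *: e x -> c =1 c'.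
Proof.
move=> [_ _ ei] c c' /eqP; rewrite -subr_eq0 -sumrB => /eqP h x; apply/eqP.
rewrite -subr_eq0; apply/eqP/(ei (fun x => c x - c' x)).
by rewrite -[RHS]h; apply: eq_bigr => y _; rewrite scalerBl.
Qed.

(** Subtracting from the sum its component of degree [i] gives a relation between the basis
    elements; its coefficients are the differences of [c x] and its component of degree
    [i - d x]. *)
Lemma hbasis_coef_deg M (X : finType) (d : X -> int) (e : X -> M) :
  graded_Sym_module M -> hbasis d e ->
  forall i (c : X -> A), gdeg M i (\sum_x c x *: e x) ->
    forall x, Sdeg (i - d x) (c x).
Proof.
move=> hM [ed es ei] i c ci x.
suff -> : c x = hpa Sdeg (i - d x) (c x) by exact: (hp_deg (@graded_Sym k n)).
apply/eqP; rewrite -subr_eq0; apply/eqP.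
apply: (ei (fun x => c x - hpa Sdeg (i - d x) (c x))).
transitivity (\sum_x c x *: e x - hp i (\sum_x c x *: e x)); last first.
  by rewrite (hp_id hM ci) subrr.
rewrite (hp_bigsum hM) -sumrB; apply: eq_bigr => y _.
by rewrite scalerBl (hpZ (@graded_Sym k n) hM _ _ (ed y)).
Qed.

Lemma hbasis_reindex M (X Y : finType) (d : X -> int) (e : X -> M)
    (g : Y -> X) (h : X -> Y) : cancel g h -> cancel h g ->
  hbasis d e -> hbasis (d \o g) (e \o g).
Proof.
move=> gK hK [ed es ei].
have sumE (c : Y -> A) : \sum_y c y *: e (g y) = \sum_x c (h x) *: e x.
  rewrite (reindex_onto g h) /=; last by move=> x _; exact: hK.
  by apply: eq_big => [y|y _]; rewrite gK ?eqxx.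
split=> [y|y|c]; first exact: ed.
- have [c ->] := es y; exists (c \o g); rewrite sumE.
  by apply: eq_bigr => x _; rewrite /= hK.
- by rewrite sumE => /ei c0 y; rewrite -[y]gK c0.
Qed.

Lemma Sym_deg_prod (I : Type) (s : seq I) (d : I -> int) (F : I -> A) :
  (forall i, Sdeg (d i) (F i)) -> Sdeg (\sum_(i <- s) d i) (\prod_(i <- s) F i).
Proof.
move=> dF; elim: s => [|i s IH]; first by rewrite !big_nil; exact: Sym_degC.
by rewrite !big_cons; apply: Sym_degM.
Qed.

(* The determinant of the transition matrix is homogeneous, so it is a constant
   as soon as its constant coefficient is nonzero. *)
Lemma transition_unitmx p (d d0 : 'I_p -> int) (P : 'M[A]_p) :
  (forall i j, Sdeg (d i - d0 j) (P i j)) ->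
  \det (map_mx (mcoeff 0%MM) P) != 0 -> P \in unitmx.
Proof.
move=> dP; rewrite det_map_mx unitmxE => nz.
suff dd : Sdeg (\sum_i d i - \sum_i d0 i) (\det P).
  rewrite (Sym_deg_unit dd nz) (rmorph_unit (mC k n)) // unitfE //.
rewrite /determinant; apply: (gdeg_sum (@graded_Sym k n)) => s _ /=.
(* Every permutation contributes a term of the same degree, since it merely reorders the [d0 j]. *)
have -> : \sum_i d i - \sum_i d0 i = 0 + \sum_i (d i - d0 (s i)).
  by rewrite add0r sumrB; congr (_ - _); rewrite (reindex_inj (@perm_inj _ s)).
apply: Sym_degM; last exact: Sym_deg_prod.
rewrite -(rmorph_sign (mC k n)); exact: Sym_degC.
Qed.

(** Modulo m the matrix [P] has the left inverse [Q] and trivial left kernel, hence it is square and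
    invertible. [transition_unitmx] then makes [P] itself invertible. *)
Lemma hbasis_of_residue_ord M p q (d : 'I_p -> int) (v : 'I_p -> M)
    (d0 : 'I_q -> int) (e : 'I_q -> M) (P : 'M[A]_(p, q)) (Q : 'M[k]_(q, p)) :
  graded_Sym_module M -> hbasis d0 e -> (forall x, gdeg M (d x) (v x)) ->
  (forall x, v x = \sum_i P x i *: e i) ->
  Q *m map_mx (mcoeff 0%MM) P = 1%:M ->
  (forall u : 'rV_p, u *m map_mx (mcoeff 0%MM) P = 0 -> u = 0) ->
  hbasis d v.
Proof.
move=> hM he dv vE QP Pfree; set Pb := map_mx _ P in QP Pfree.
have PQ : Pb *m Q = 1%:M.
  apply/row_matrixP => i; apply/eqP; rewrite -subr_eq0 -raddfB; apply/eqP/Pfree.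
  rewrite -row_mul mulmxBl mul1mx -mulmxA QP mulmx1 subrr.
  by apply/rowP => j; rewrite !mxE.
have epq : q = p by apply/eqP; rewrite eqn_leq (mulmx1_min PQ) (mulmx1_min QP).
subst q; have [ed es ei] := he.
have Pu : P \in unitmx.
  apply: (@transition_unitmx _ d d0).
    move=> i j; apply: (hbasis_coef_deg hM he (c := P i)).
    by rewrite -vE.
  by have [] := mulmx1_unit PQ; rewrite unitmxE unitfE.
have sumE (c : 'rV[A]_p) : \sum_x c 0 x *: v x = \sum_i (c *m P) 0 i *: e i.
  under eq_bigr => x _ do rewrite vE scaler_sumr.
  rewrite exchange_big; apply: eq_bigr => i _; rewrite mxE scaler_suml.
  by apply: eq_bigr => x _; rewrite scalerA.
split=> // [y|c c0 x].
  have [c ->] := es y; pose C : 'rV_p := \row_i c i.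
  exists (fun x => (C *m invmx P) 0 x); rewrite sumE mulmxKV //.
  by apply: eq_bigr => i _; rewrite mxE.
pose C : 'rV_p := \row_i c i; suff /rowP/(_ x) : C = 0 by rewrite !mxE.
rewrite -(mulmxK Pu C) (_ : C *m P = 0) ?mul0mx //; apply/rowP => i.
rewrite [RHS]mxE; apply: (ei (fun i => (C *m P) 0 i)); rewrite -sumE -[RHS]c0.
by apply: eq_bigr => z _; rewrite mxE.
Qed.

(** The two conditions on constant coefficients say that the residue classes of the [v x] span and
    are independent, in the coordinates given by [e]. *)
Lemma hbasis_of_residue M (X I : finType) (d : X -> int) (v : X -> M)
    (d0 : I -> int) (e : I -> M) (P : X -> I -> A) :
  graded_Sym_module M -> hbasis d0 e -> (forall x, gdeg M (d x) (v x)) ->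
  (forall x, v x = \sum_i P x i *: e i) ->
  (forall i, exists c : X -> k,
     forall j, \sum_x c x * (P x j)@_0%MM = (i == j)%:R) ->
  (forall c : X -> k, (forall j, \sum_x c x * (P x j)@_0%MM = 0) ->
     forall x, c x = 0) ->
  hbasis d v.
Proof.
move=> hM he dv vE /choice[Q hQ] hind.
have ev := enum_valK; have er := enum_rankK.
suff H : hbasis (d \o enum_val (A := X)) (v \o enum_val (A := X)).
  have := hbasis_reindex (er X) (ev X) H.
  have -> : (d \o enum_val) \o enum_rank = d by apply/funext => x /=; rewrite er.
  by have -> : (v \o enum_val) \o enum_rank = v by apply/funext => x /=; rewrite er.
apply: (@hbasis_of_residue_ord M _ _ _ _ _ _
  (\matrix_(x, i) P (enum_val x) (enum_val i))
  (\matrix_(i, x) Q (enum_val i) (enum_val x)) hM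
  (hbasis_reindex (ev I) (er I) he)).
- by move=> x; exact: dv.
- move=> x; rewrite /= vE (reindex (enum_val (A := I))); last first.
    by exists enum_rank => i _; rewrite ?ev ?er.
  by apply: eq_bigr => i _; rewrite mxE.
- apply/matrixP => i j; rewrite !mxE -(inj_eq enum_val_inj) -hQ.
  rewrite [RHS](reindex (enum_val (A := X))); last first.
    by exists enum_rank => y _; rewrite ?ev ?er.
  by apply: eq_bigr => x _; rewrite !mxE.
- move=> u /rowP u0; apply/rowP => x; rewrite [RHS]mxE -[x]ev.
  apply: (hind (fun x => u 0 (enum_rank x))) => j.
  have := u0 (enum_rank j); rewrite mxE [RHS]mxE => h.
  rewrite -[RHS]h (reindex (enum_val (A := X))); last first.
    by exists enum_rank => y _; rewrite ?ev ?er.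
  by apply: eq_bigr => y _; rewrite !mxE /= ev er.
Qed.

Lemma hbasis_lift M (X : finType) d (e : X -> M) (N : lmodType A) (y : X -> N) :
  hbasis d e -> exists f : {linear M -> N},
    forall c : X -> A, f (\sum_x c x *: e x) = \sum_x c x *: y x.
Proof.
move=> he; have [ed es ei] := he.
have /choice[c hc] : forall z, exists c : X -> A, z = \sum_x c x *: e x by exact: es.
have fE (a : X -> A) : \sum_x c (\sum_x a x *: e x) x *: y x = \sum_x a x *: y x.
  by apply: eq_bigr => x _; rewrite (hbasis_inj he (esym (hc (\sum_x a x *: e x)))).
have fL : linear (fun z => \sum_x c z x *: y x).
  move=> a u w.
  have -> : a *: u + w = \sum_x (a * c u x + c w x) *: e x.
    rewrite {1}[u]hc {1}[w]hc scaler_sumr -big_split; apply: eq_bigr => x _ /=.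
    by rewrite scalerDl scalerA.
  rewrite fE scaler_sumr -big_split; apply: eq_bigr => x _ /=.
  by rewrite scalerDl scalerA.
by exists (lin_of fL).
Qed.

(** Degree [i] means that the coefficient at [x] has degree [i - d x] for all [x], a condition that
    reads the same in both bases. *)
Lemma hbasis_iso M (N : gmod A) (X : finType) (d : X -> int) (e : X -> M) (e' : X -> N)
    (f : {linear M -> N}) : graded_Sym_module M -> graded_Sym_module N ->
  hbasis d e -> hbasis d e' ->
  (forall c : X -> A, f (\sum_x c x *: e x) = \sum_x c x *: e' x) -> gmod_iso f.
Proof.
move=> hM hN he he' fE; have [ed es ei] := he; have [ed' es' ei'] := he'.
have [g gE] := hbasis_lift e he'.
split.
  exists g => x; first by have [c ->] := es x; rewrite fE gE.
  by have [c ->] := es' x; rewrite gE fE.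
move=> i x; have [c ->] := es x; rewrite fE; split.
  move=> /(hbasis_coef_deg hN he') ci; apply: (gdeg_sum hM) => y _.
  by rewrite -[i](subrK (d y)); apply: (gdegZ hM).
move=> /(hbasis_coef_deg hM he) ci; apply: (gdeg_sum hN) => y _.
by rewrite -[i](subrK (d y)); apply: (gdegZ hN).
Qed.
End HomogeneousBases.

(** * Tensor products *)

Section TensorAdditiveLift.
Context (k A : comNzRingType) (iota : {rmorphism k -> A}).
Context (M : lmodType A) (K : lmodType k) (N : lmodType A) (b : M -> K -> N).
Context (bl : forall c m m' x, b (iota c *: m + m') x = iota c *: b m x + b m' x).
Context (br : forall c m x x', b m (c *: x + x') = iota c *: b m x + b m x').

Let b' (m : rscal iota M) (x : K) : rscal iota N := b m x.

Let bl' c m m' x : b' (c *: m + m') x = c *: b' m x + b' m' x.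
Proof. exact: bl. Qed.

Let br' c m x x' : b' m (c *: x + x') = c *: b' m x + b' m x'.
Proof. exact: br. Qed.

(** Only bilinearity over [k] is asked, because the projections to the components of a tensor
    product are not linear over [A]. *)
Definition alift (t : mtensor iota M K) : N := tensor_lift bl' br' t.

Lemma aliftE m x : alift (mtens iota m x) = b m x.
Proof. exact: (tensor_liftE bl' br'). Qed.

Lemma aliftB : {morph alift : x y / x - y}.
Proof. exact: (raddfB (tensor_lift bl' br')). Qed.

Lemma alift0 : alift 0 = 0.
Proof. by have := aliftB 0 0; rewrite !subrr. Qed.

Lemma aliftD : {morph alift : x y / x + y}.
Proof.
move=> x y; rewrite -[X in alift (_ + X)]opprK.
by rewrite -[X in alift (_ - X)]sub0r !aliftB alift0 sub0r opprK.
Qed.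

Lemma alift_sum (I : Type) (s : seq I) (F : I -> mtensor iota M K) :
  alift (\sum_(i <- s) F i) = \sum_(i <- s) alift (F i).
Proof. exact: (big_morph _ aliftD alift0). Qed.
End TensorAdditiveLift.

Section TensorLift.
Context (k A : comNzRingType) (iota : {rmorphism k -> A}).
Context (M : lmodType A) (K : lmodType k) (N : lmodType A) (b : M -> K -> N).
Context (bl : forall a m m' x, b (a *: m + m') x = a *: b m x + b m' x).
Context (br : forall c m x x', b m (c *: x + x') = iota c *: b m x + b m x').

Let bl' c m m' x : b (iota c *: m + m') x = iota c *: b m x + b m' x.
Proof. exact: bl. Qed.

Let fL : linear (alift bl' br).
Proof.
have b0 x : b 0 x = 0.
  have /eqP := bl 1 0 0 x; rewrite !scale1r addr0 -subr_eq0 opprD addrA.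
  by rewrite subrr sub0r oppr_eq0 => /eqP.
move=> a x y; rewrite aliftD; congr (_ + _).
have [r [m [z ->]]] := mtensE x.
rewrite scaler_sumr !alift_sum scaler_sumr; apply: eq_bigr => i _.
by rewrite mtensZl !aliftE; have := bl a (m i) 0 (z i); rewrite !addr0 b0 addr0.
Qed.

Definition mlift : {linear mtensor iota M K -> N} := lin_of fL.

Lemma mliftE m x : mlift (mtens iota m x) = b m x.
Proof. exact: (aliftE bl' br). Qed.
End TensorLift.

Section TensorAlgebra.
Context (k A : comNzRingType) (iota : {rmorphism k -> A}).
Context (M : lmodType A) (K : lmodType k).
Implicit Types (m : M) (x : K).

Lemma mtens0l x : mtens iota (0 : M) x = 0.
Proof. by have := mtensZl iota 0 (0 : M) x; rewrite !scale0r. Qed.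

Lemma mtens0r m : mtens iota m (0 : K) = 0.
Proof.
by have := mtensZ iota 0 m (0 : K); rewrite scaler0 rmorph0 scale0r mtens0l.
Qed.

Lemma mtens_suml (I : Type) (s : seq I) (P : pred I) (F : I -> M) x :
  mtens iota (\sum_(i <- s | P i) F i) x = \sum_(i <- s | P i) mtens iota (F i) x.
Proof.
exact: (big_morph (fun m => mtens iota m x : mtensor iota M K)
  (fun m m' => mtensDl iota m m' x) (mtens0l x)).
Qed.

Lemma mtens_sumr (I : Type) (s : seq I) (P : pred I) (F : I -> K) m :
  mtens iota m (\sum_(i <- s | P i) F i) = \sum_(i <- s | P i) mtens iota m (F i).
Proof.
exact: (big_morph (fun x => mtens iota m x : mtensor iota M K)
  (fun x x' => mtensDr iota m x x') (mtens0r m)).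
Qed.
End TensorAlgebra.

Section TensorCoordinates.
Context (k : fieldType) (A : comNzRingType) (iota : {rmorphism k -> A}).
Context (M : lmodType A) (K : lmodType k) (X : finType) (b : X -> K).
Context (c : X -> {linear K -> k^o}).
Hypothesis (bc : forall w, w = \sum_x c x w *: b x).
Hypothesis (cb : forall x y, c x (b y) = (x == y)%:R).

Let beta x (m : M) (w : K) : M := iota (c x w) *: m.

Let beta_l x a m m' w : beta x (a *: m + m') w = a *: beta x m w + beta x m' w.
Proof. by rewrite /beta scalerDr !scalerA mulrC. Qed.

Let beta_r x d m w w' : beta x m (d *: w + w') = iota d *: beta x m w + beta x m w'.
Proof. by rewrite /beta linearP rmorphD rmorphM scalerDl scalerA. Qed.

(** The basis [b] of [K] makes the tensor product a sum of copies of [M]; this is the projection to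
    the copy of [b x]. *)
Definition tcoord x : {linear mtensor iota M K -> M} := mlift (beta_l x) (beta_r x).

Lemma tcoordE x m w : tcoord x (mtens iota m w) = iota (c x w) *: m.
Proof. exact: (mliftE (beta_l x) (beta_r x)). Qed.

Lemma tcoord_basis x y m : tcoord x (mtens iota m (b y)) = if x == y then m else 0.
Proof.
rewrite tcoordE cb; case: eqP => _; first by rewrite rmorph1 scale1r.
by rewrite rmorph0 scale0r.
Qed.

Lemma tcoord_sum t : t = \sum_x mtens iota (tcoord x t) (b x).
Proof.
have [r [m [w ->]]] := mtensE t.
under [RHS]eq_bigr => x _ do rewrite raddf_sum mtens_suml.
rewrite exchange_big; apply: eq_bigr => i _ /=.
rewrite {1}[w i]bc mtens_sumr; apply: eq_bigr => x _.
by rewrite mtensZ tcoordE.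
Qed.
End TensorCoordinates.

(** * The grading of a tensor product *)

Section GradedTensor.
Context (k : fieldType) (n : nat).
Local Notation A := {mpoly k[n]}.
Local Notation iota := (mC k n).
Context (M : gmod A) (K : gmod k).
Hypotheses (hM : graded_Sym_module M) (hK : graded_space K).

Lemma common_support (B : nzRingType) (dB : int -> set B) (N : gmod B) r
    (x : 'I_r -> N) : is_graded dB N ->
  exists s : seq int, uniq s /\ forall j i, i \notin s -> hp i (x j) = 0.
Proof.
move=> hN; have /choice[s hs] : forall j, exists s : seq int,
    [/\ uniq s, forall i, i \notin s -> hp i (x j) = 0
      & x j = \sum_(i <- s) hp i (x j)] by move=> j; exact: hp_sum hN _.
exists (undup (flatten [seq s j | j <- enum 'I_r])); split.
  exact: undup_uniq.
move=> j i; rewrite mem_undup => iw; have [_ s0 _] := hs j.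
apply: s0; apply: contraNN iw => iw.
by apply/flattenP; exists (s j) => //; apply/map_f; rewrite mem_enum.
Qed.

Lemma gtensor_gdeg p q i (m : M) (x : K) : gdeg M p m -> gdeg K q x -> p + q = i ->
  gdeg (gtensor M K) i (mtens iota m x).
Proof.
move=> mp xq pq; exists 1%N, (fun=> m), (fun=> x), (fun=> p), (fun=> q).
by split=> //; rewrite big_ord1.
Qed.

Lemma gtensor_gdegD i (t u : gtensor M K) :
  gdeg (gtensor M K) i t -> gdeg (gtensor M K) i u -> gdeg (gtensor M K) i (t + u).
Proof.
move=> [r [m [x [p [q [h ->]]]]]] [r' [m' [x' [p' [q' [h' ->]]]]]].
pose J T (g : 'I_r -> T) (g' : 'I_r' -> T) (j : 'I_(r + r')) :=
  match split j with inl a => g a | inr a => g' a end.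
have JL T g g' a : J T g g' (lshift r' a) = g a.
  by rewrite /J (unsplitK (inl a)).
have JR T g g' a : J T g g' (rshift r a) = g' a.
  by rewrite /J (unsplitK (inr a)).
exists (r + r')%N, (J _ m m'), (J _ x x'), (J _ p p'), (J _ q q'); split.
  by move=> j; rewrite -(splitK j); case: (split j) => a /=; rewrite ?JL ?JR.
rewrite big_split_ord; congr (_ + _); apply: eq_bigr => a _.
  by rewrite !JL.
by rewrite !JR.
Qed.

Lemma gtensor_gdegZ i j a (t : gtensor M K) : @Sym_deg k n i a ->
  gdeg (gtensor M K) j t -> gdeg (gtensor M K) (i + j) (a *: t).
Proof.
move=> ai [r [m [x [p [q [h ->]]]]]].
exists r, (fun l => a *: m l), x, (fun l => i + p l), q; split.
  move=> l; have [mp xq pq] := h l; split=> //; first exact: (gdegZ hM).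
  by rewrite -addrA pq.
by rewrite scaler_sumr; apply: eq_bigr => l _; rewrite mtensZl.
Qed.

Section Component.
Context (p q : int).

Let T0 (m : M) (x : K) : gtensor M K := mtens iota (hp p m) (hp q x).

Let T0l c m m' x : T0 (iota c *: m + m') x = iota c *: T0 m x + T0 m' x.
Proof.
rewrite /T0 (hpD hM) (hpZ0 hM) ?mtensDl ?mtensZl //; exact: Sym_degC.
Qed.

Let T0r c m x x' : T0 m (c *: x + x') = iota c *: T0 m x + T0 m x'.
Proof.
by rewrite /T0 (hpD hK) (hpZ0 hK) ?mtensDr ?mtensZ ?mtensZl //; exact: scalar_deg0.
Qed.

(** The component of bidegree [(p, q)]. Coordinates with respect to a basis of [K] would need finite
    dimension, which is not known for the residue spaces in the construction of simple sheaves. *)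
Definition gtensor_comp : gtensor M K -> gtensor M K := alift T0l T0r.

Lemma gtensor_compE m x :
  gtensor_comp (mtens iota m x) = mtens iota (hp p m) (hp q x).
Proof. exact: (aliftE T0l T0r). Qed.

Lemma gtensor_comp_sum (I : Type) (s : seq I) (F : I -> gtensor M K) :
  gtensor_comp (\sum_(i <- s) F i) = \sum_(i <- s) gtensor_comp (F i).
Proof. exact: alift_sum. Qed.

Lemma gtensor_comp0 : gtensor_comp 0 = 0.
Proof. exact: alift0. Qed.

Lemma gtensor_comp_deg i (t : gtensor M K) : gdeg (gtensor M K) i t ->
  p + q != i -> gtensor_comp t = 0.
Proof.
move=> [r [m [x [p' [q' [h et]]]]]] pqi; rewrite et gtensor_comp_sum.
apply: big1 => j _; have [mp xq pq] := h j.
rewrite gtensor_compE (hpE hM _ mp) (hpE hK _ xq).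
case: eqP => [pp|_]; last exact: mtens0l.
case: eqP => [qq|_]; last exact: mtens0r.
by case/eqP: pqi; rewrite pp qq.
Qed.
End Component.

Lemma gtensor_comp_eq0 (t : gtensor M K) :
  (forall p q, gtensor_comp p q t = 0) -> t = 0.
Proof.
have [r [m [x et]]] := mtensE t => t0.
have [s [us s0]] := common_support m hM; have [s' [us' s0']] := common_support x hK.
have {}t0 p q : \sum_j (mtens iota (hp p (m j)) (hp q (x j)) : gtensor M K) = 0.
  rewrite -[RHS](t0 p q) et gtensor_comp_sum.
  by apply: eq_bigr => j _; rewrite gtensor_compE.
rewrite et; transitivity (\sum_(p <- s) \sum_(q <- s')
    \sum_j (mtens iota (hp p (m j)) (hp q (x j)) : gtensor M K)).
  rewrite -(eq_bigr _ (fun p _ => exchange_big _ _ _ _ _ _)) /= exchange_big /=.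
  apply: eq_bigr => j _.
  rewrite {1}(hp_sum_in hM us (s0 j)) mtens_suml; apply: eq_bigr => p _.
  by rewrite {1}(hp_sum_in hK us' (s0' j)) mtens_sumr.
by apply: big1 => p _; apply: big1 => q _; exact: t0.
Qed.

(** Uniqueness of components is tested in each bidegree: [gtensor_comp p q] kills homogeneous
    tensors of degree other than [p + q], and a tensor killed by all of these maps is 0. *)
Lemma graded_gtensor : graded_Sym_module (gtensor M K).
Proof.
have d0 i : gdeg (gtensor M K) i 0.
  by exists 0%N, (fun=> 0), (fun=> 0), (fun=> 0), (fun=> 0); split;
    [case|rewrite big_ord0].
split=> [i|||].
- split=> // x y xi yi; apply: gtensor_gdegD => //.
  by rewrite -scaleN1r -[i]add0r; apply: gtensor_gdegZ => //;
    rewrite -(rmorphN1 (mC k n)); exact: Sym_degC.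
- exact: gtensor_gdegZ.
- move=> t; have [r [m [x ->]]] := mtensE t.
  have [s [us s0]] := common_support m hM.
  have [s' [us' s0']] := common_support x hK.
  suff H (l : seq (int * int)) (u : int * int -> gtensor M K) :
      (forall pq, gdeg (gtensor M K) (pq.1 + pq.2) (u pq)) ->
      exists (s : seq int) (c : int -> gtensor M K),
        (forall i, gdeg (gtensor M K) i (c i)) /\
        \sum_(pq <- l) u pq = \sum_(i <- s) c i.
    have [|S [c [cd cE]]] := H [seq (p, q) | p <- s, q <- s']
      (fun pq => \sum_j mtens iota (hp pq.1 (m j)) (hp pq.2 (x j))).
      move=> [p q]; apply: (big_ind (gdeg (gtensor M K) (p + q))) => //.
        by move=> *; exact: gtensor_gdegD.
      move=> j _; apply: (@gtensor_gdeg p q) => //; first exact: (hp_deg hM).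
      exact: (hp_deg hK).
    exists S, c; split=> //; rewrite -cE big_allpairs.
    under [RHS]eq_bigr => p _ do rewrite exchange_big.
    rewrite exchange_big; apply: eq_bigr => j _.
    rewrite {1}(hp_sum_in hM us (s0 j)) mtens_suml; apply: eq_bigr => p _.
    by rewrite {1}(hp_sum_in hK us' (s0' j)) mtens_sumr.
  (* Different bidegrees may have the same total degree, so their components are grouped. *)
  move=> ud; exists (undup [seq pq.1 + pq.2 | pq <- l]).
  exists (fun i => \sum_(pq <- l | pq.1 + pq.2 == i) u pq); split.
    move=> i; apply: (big_ind (gdeg (gtensor M K) i)) => //.
      by move=> *; exact: gtensor_gdegD.
    by move=> pq /eqP <-.
  rewrite (exchange_big_dep xpredT) //= big_seq [RHS]big_seq.
  apply: eq_bigr => pq pql; rewrite big_mkcond (bigD1_seq (pq.1 + pq.2)) /=.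
  - by rewrite eqxx big1 ?addr0 // => i; rewrite eq_sym => /negPf ->.
  - by rewrite mem_undup; apply/mapP; exists pq.
  - exact: undup_uniq.
- move=> s c us cd cs i si; apply: gtensor_comp_eq0 => p q.
  have [pqi|/(gtensor_comp_deg (cd i))//] := eqVneq (p + q) i.
  apply: esym; apply: etrans (esym (gtensor_comp0 p q)) _; rewrite -cs.
  rewrite gtensor_comp_sum (bigD1_seq i) //= big1 ?addr0 // => j ji; apply: (gtensor_comp_deg (cd j)).
  by rewrite pqi eq_sym.
Qed.
End GradedTensor.

(** * Sections over subfans *)

Section SymRestriction.
Context (R : realType) (V : vectType R).
Implicit Types U W : {vspace V}.

Lemma Sres_const U W (a : Sym R U) : (Sres U W a)@_0%MM = a@_0%MM.
Proof.
apply: (@Sym_ext _ _ U _ (mcoeff 0%MM \o Sres U W) (mcoeff 0%MM)) a => [c|i] /=.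
  by rewrite SresC !mcoeffC !eqxx.
rewrite SresX raddf_sum /= big1; first by rewrite mcoeffX mnm1_eq0.
by move=> j _; rewrite mcoeffZ mcoeffX mnm1_eq0 mulr0.
Qed.

Lemma Sres_deg U W i (a : Sym R U) : Sym_deg i a -> Sym_deg i (Sres U W a).
Proof.
case=> [[q -> aq]|->]; last by right; rewrite raddf0.
rewrite [a]mpolyE raddf_sum big_seq.
apply: (gdeg_sum (@graded_Sym R _)) => m /(dhomog_mf aq) mq.
rewrite /= SresZ -mul_mpolyC -[Posz _]add0r; apply: Sym_degM; first exact: Sym_degC.
rewrite mpolyXE_id rmorph_prod /=.
have -> : (q.*2)%:Z = \sum_(i < \dim U) ((m i).*2)%:Z.
  by rewrite -mq /= mdegE (big_morph _ doubleD double0) (big_morph Posz PoszD (erefl _)).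
apply: Sym_deg_prod => j; rewrite rmorphXn /=.
left; exists (m j) => //; rewrite -[X in X.-homog]mul1n; apply: dhomogMn.
rewrite SresX; apply: rpred_sum => l _; apply: rpredZ.
by rewrite dhomogX /= mdeg1.
Qed.

Lemma Sres_surj U W (b : Sym R W) : (W <= U)%VS -> exists a, Sres U W a = b.
Proof.
move=> WU.
(* The [j]-th coordinate form of [W] is extended to [U] by composition with the projection onto [W];
   [phi j i] is its value on the [i]-th basis vector of [U]. *)
pose phi (j : 'I_(\dim W)) (i : 'I_(\dim U)) :=
  coord (vbasis W) j (projv W (vbasis U)`_i).
pose lifts := [tuple \sum_(i < \dim U) phi j i *: 'X_i : Sym R U | j < \dim W].
exists (b \mPo lifts).
apply: (@Sym_ext _ _ W _ (Sres U W \o comp_mpoly lifts) idfun) b => [c|j] /=.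
  by rewrite comp_mpolyC SresC.
rewrite comp_mpolyXU -tnth_nth tnth_mktuple raddf_sum /=.
under eq_bigr => i _ do rewrite SresZ SresX scaler_sumr.
rewrite exchange_big; under eq_bigr => l _ do under eq_bigr => i _ do rewrite scalerA.
under eq_bigr => l _ do rewrite -scaler_suml.
(* The extended form restricts to the original one because the projection fixes [W]. *)
have E (l : 'I_(\dim W)) : \sum_(i < \dim U) phi j i * coord (vbasis U) i (vbasis W)`_l = (j == l)%:R.
  have lW : (vbasis W)`_l \in W by apply: vbasis_mem; rewrite mem_nth // size_tuple.
  rewrite eq_sym -[RHS](coord_free l j (basis_free (vbasisP W))).
  rewrite -[in RHS](projv_id lW).
  rewrite [in RHS](coord_vbasis (subvP WU _ lW)) !linear_sum /=.
  by apply: eq_bigr => i _; rewrite !linearZ /= mulrC.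
rewrite (bigD1 j) //= E eqxx scale1r big1 ?addr0 // => l lj.
by rewrite E eq_sym (negPf lj) scale0r.
Qed.
End SymRestriction.

Section SectionCalculus.
Context (R : realType) (V : vectType R) (D : fan V).
Implicit Types (s t u : D) (L : {fset set V}).

Section OneSheaf.
Context (F : sheaf D).

Section Sections.
Context (L : {fset set V}).
Implicit Types x y : sections F L.

Lemma sections_ext x y :
  (forall t (tL : val t \in L), section_at x tL = section_at y tL) -> x = y.
Proof.
move=> xy; apply: val_inj; apply: functional_extensionality_dep => -[t tL].
exact: xy.
Qed.

Lemma sections_ex (y : forall t, val t \in L -> F t) :
  (forall t (tL : val t \in L) u (uL : val u \in L),
     face (val u) (val t) -> res F t u (y t tL) = y u uL) ->
  exists x, forall t (tL : val t \in L), section_at x tL = y t tL.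
Proof.
move=> yc; pose fam : families F L := fun i => y (val i) (valP i).
have fc : compatible fam by move=> t u; exact: yc.
exists (mk_submod (compatible_submod F L) fc) => t tL.
by rewrite /section_at /= /fam /=; congr (y t _); exact: bool_irrelevance.
Qed.

Lemma section_atD x y t (tL : val t \in L) :
  section_at (x + y) tL = section_at x tL + section_at y tL.
Proof. by []. Qed.

Lemma section_atZ a x t (tL : val t \in L) :
  section_at (a *: x) tL = Sres fullv \V_t a *: section_at x tL.
Proof. by []. Qed.

Lemma section_at_sum (I : Type) (r : seq I) (P : pred I) (f : I -> sections F L)
    t (tL : val t \in L) :
  section_at (\sum_(i <- r | P i) f i) tL = \sum_(i <- r | P i) section_at (f i) tL.
Proof. exact: (big_morph (fun x => section_at x tL)). Qed.

Lemma section_res x t u (tL : val t \in L) (uL : val u \in L) :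
  face (val u) (val t) -> res F t u (section_at x tL) = section_at x uL.
Proof. exact: (submodP x (exist _ t tL) (exist _ u uL)). Qed.

Lemma sections_deg i x : gdeg (sections F L) i x <->
  forall t (tL : val t \in L), gdeg (F t) i (section_at x tL).
Proof. by split=> [xi t tL|xi [t tL]]; exact: xi. Qed.
End Sections.

Lemma rhoE s (x : F s) t (ts : val t \in boundary s) :
  section_at (rho F s x) ts = res F s t x.
Proof. by []. Qed.

Hypothesis hF : graded_sheaf F.

Lemma graded_stalkV s : graded_Sym_module (stalkV F s).
Proof. by apply: (graded_rscal _ (hF.1 s)) => i a; exact: Sres_deg. Qed.

Lemma hp_stalkV s i (x : F s) : hp (M := stalkV F s) i x = hp i x.
Proof. by apply: (hp_dec (graded_stalkV s)); exact: (hp_hdec (hF.1 s) x). Qed.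

Lemma hp_res s t i (x : F s) : face (val t) (val s) ->
  hp i (res F s t x : F t) = res F s t (hp i x).
Proof.
move=> ts; have := hp_map (hF.1 s) (hF.1 t) (f := res F s t) (m := 0) _ _ i x.
rewrite addr0; apply; first exact: raddfB.
by move=> j y yj; rewrite addr0; exact: hF.2.
Qed.

Lemma graded_families L : graded_Sym_module (families F L).
Proof.
apply: (@graded_prod _ _ _ _ (enum_val (A := {: idx D L}))).
  by move=> i; exists (enum_rank i); rewrite enum_rankK.
by move=> t; exact: graded_stalkV.
Qed.

(** Restriction maps commute with taking components, so the components of a compatible family are
    compatible. *)
Lemma graded_sections L : graded_Sym_module (sections F L).
Proof.
apply: (graded_submod (compatible_submod F L) (graded_families L)) => x cx i.
have hpx (t : idx D L) : hp i x t = hp i (x t : F (val t)).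
  have := hp_map (graded_families L) (graded_stalkV (val t))
    (f := fun x : families F L => x t : stalkV F (val t)) (m := 0) _ _ i x.
  by rewrite addr0 hp_stalkV => <- // j y yj; rewrite addr0; exact: yj.
by move=> t u ut; rewrite !hpx -hp_res // cx.
Qed.

Lemma rho_deg s i (x : F s) : gdeg (F s) i x ->
  gdeg (sections F (boundary s)) i (rho F s x).
Proof.
by move=> xi; apply/sections_deg => t ts; rewrite rhoE; apply: hF.2 => //;
  exact: (@boundaryP _ _ _ _ (exist _ t ts)).
Qed.

Lemma graded_Kspace s : graded_space (Kspace F s).
Proof.
apply: graded_kernel; first exact: (graded_bar (graded_stalkV s)).
  exact: (graded_bar (graded_sections _)).
move=> i _ [x xi <-]; exists (rho F s x); last by rewrite bar_mapE.
exact: rho_deg.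
Qed.
End OneSheaf.

Section SectionMap.
Context (F E : sheaf D) (L : {fset set V}) (p : forall t, {linear F t -> E t}).
Hypothesis pr : forall t u, val t \in L -> val u \in L -> face (val u) (val t) ->
  forall x, p u (res F t u x) = res E t u (p t x).

Let fam (x : sections F L) : families E L :=
  fun i => p (val i) (section_at x (valP i)).

Let fam_compat x : compatible (fam x).
Proof.
move=> t u ut; rewrite /fam -pr ?(valP t) ?(valP u) //; congr (p _ _).
exact: section_res.
Qed.

Let sm (x : sections F L) : sections E L :=
  mk_submod (compatible_submod E L) (fam_compat x).

Let smE x t (tL : val t \in L) : section_at (sm x) tL = p t (section_at x tL).
Proof.
rewrite {1}/section_at /= /fam /=; congr (p t (section_at x _)).
exact: bool_irrelevance.
Qed.

Let smL : linear sm.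
Proof.
move=> a x y; apply: sections_ext => t tL.
by rewrite smE !section_atD !section_atZ linearP !smE.
Qed.

(** Commutation with restrictions is required on [L] only: in the induction, the maps at cones of
    higher dimension are arbitrary. *)
Definition section_map : {linear sections F L -> sections E L} := lin_of smL.

Lemma section_mapE x t (tL : val t \in L) :
  section_at (section_map x) tL = p t (section_at x tL).
Proof. exact: smE. Qed.
End SectionMap.

Lemma in_boundary s t : (val t \in boundary s) = `[< face (val t) (val s) >] && (t != s).
Proof. by rewrite !inE /= (valP t). Qed.

Lemma boundary_face s t : val t \in boundary s -> face (val t) (val s).
Proof. by rewrite in_boundary => /andP[/asboolP]. Qed.

Lemma face_sub (A B : set V) : face A B -> A `<=` B.
Proof. by case=> b _ -> x []. Qed.

Lemma face_anti s t : face (val s) (val t) -> face (val t) (val s) -> s = t.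
Proof. by move=> /face_sub st /face_sub ts; apply: val_inj; apply/seteqP. Qed.

(** In a fan a cone [u] contained in [s] is a face of [s], being the intersection of the two. *)
Lemma face_trans s t u : face (val t) (val s) -> face (val u) (val t) ->
  face (val u) (val s).
Proof.
move=> /face_sub ts /face_sub ut; have [_ _ _ iD] := fanP D.
have [+ _] := iD (val s) (val u) (valP s) (valP u).
suff -> : val s `&` val u = val u by [].
by apply/seteqP; split=> [x []//|x ux]; split=> //; apply/ts/ut.
Qed.

Lemma fan_cone s : is_cone (val s).
Proof. by have [_ cD _ _] := fanP D; apply: cD; exact: valP. Qed.

(** If the dimensions agreed, so would the spans, and the form that cuts out the face would vanish
    on all of [s]. *)
Lemma boundary_dim s t : val t \in boundary s -> (cdim (val t) < cdim (val s))%N.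
Proof.
rewrite in_boundary => /andP[/asboolP ts tns].
have tsV := face_space ts.
rewrite ltn_neqAle dimvS // andbT; apply: contraNneq tns => eqd.
have eV : \V_t = \V_s by apply/eqP; rewrite -(dimv_leqif_eq tsV); apply/eqP.
case: ts => b sb et; apply/eqP/val_inj; rewrite et; apply/seteqP.
split=> [x []//|x sx]; split=> //; rewrite /hyperplane /=.
have : [set` \V_s] x.
  rewrite (cspanE (fan_cone s)); exists x => //; exists 0; last exact: subr0.
  exact: (cone0 (fan_cone s)).
rewrite -eV (cspanE (fan_cone t)) => -[y ty [z tz <-]].
move: ty tz; rewrite et /hyperplane => -[_ /= by0] [_ /= bz0].
by rewrite linearB /= by0 bz0 subrr.
Qed.

Lemma boundary_boundary s t u : val t \in boundary s -> face (val u) (val t) ->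
  val u \in boundary s.
Proof.
move=> ts ut; rewrite in_boundary (asboolT (face_trans (boundary_face ts) ut)) /=.
apply/eqP => us; move: (ts); rewrite in_boundary => /andP[_ /eqP]; apply.
by apply: face_anti (boundary_face ts) _; rewrite -us.
Qed.

Lemma boundary_open s : fan_open D (boundary s).
Proof.
(* The boundary may be empty, as for the zero cone; it is then open without being a fan. *)
have [b0|bn0] := eqVneq (boundary s) fset0; [by left|right].
have bD : (boundary s `<=` D)%fset.
  by apply/fsubsetP => A; rewrite !inE => /and3P[].
have inD A : A \in boundary s -> exists t, val t = A.
  by move=> /(fsubsetP bD) AD; exists [` AD]%fset.
have [_ cD fD iD] := fanP D.
split=> //; split=> // [A|A B|A B].
- by move=> /inD[t <-]; exact: fan_cone.
- move=> As BA; have BD := fD _ _ (fsubsetP bD _ As) BA.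
  have [t et] := inD A As; rewrite -et in As BA.
  exact: (@boundary_boundary s t [` BD]%fset).
- by move=> /(fsubsetP bD) AD /(fsubsetP bD) BD; exact: iD.
Qed.

Lemma flabby_rho_surj (F : sheaf D) s : flabby F ->
  forall x : sections F (boundary s), exists y : F s, rho F s y = x.
Proof.
move=> fF x; have [y yx] := fF _ (boundary_open s) x.
exists (section_at y (valP s)); apply: sections_ext => t ts.
by rewrite rhoE -yx; apply: section_res; exact: boundary_face.
Qed.
End SectionCalculus.

(** * Residue modules and pure sheaves *)

Lemma submod_comb (A : nzRingType) (M : lmodType A) (P : set M) (hP : submod_prop P)
    (I : Type) (r : seq I) (Q : pred I) (c : I -> A) (x : I -> submod hP) :
  val (\sum_(i <- r | Q i) c i *: x i) = \sum_(i <- r | Q i) c i *: val (x i).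
Proof. exact: (big_morph (fun z : submod hP => val z)). Qed.

Section ResidueClasses.
Context (k : fieldType) (n : nat).
Local Notation A := {mpoly k[n]}.
Implicit Type M : gmod A.

Lemma bar_classZ M c (x : M) : bar_class M (c%:MP *: x) = c *: bar_class M x.
Proof. exact: (linearZZ (bar_class M) c (x : rscal (mC k n) M)). Qed.

Lemma bar_class_surj M (z : bar M) : exists x, bar_class M x = z.
Proof. by exists (qrepr z); exact: qreprK. Qed.

Lemma bar_class_max M a (x : M) : a@_0%MM = 0 -> bar_class M (a *: x) = 0.
Proof. by move=> a0; apply: qpi_rel; exists a, x. Qed.

Lemma bar_class_comb M (X : finType) (P : pred X) (c : X -> k) (v : X -> M) :
  bar_class M (\sum_(x | P x) (c x)%:MP *: v x) =
  \sum_(x | P x) c x *: bar_class M (v x).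
Proof.
rewrite (raddf_sum (bar_class M)); apply: eq_bigr => x _; exact: bar_classZ.
Qed.

Lemma bar_classB_comb M (X : finType) (P : pred X) (c : X -> k) (y : M) (v : X -> M) :
  bar_class M (y - \sum_(x | P x) (c x)%:MP *: v x) =
  bar_class M y - \sum_(x | P x) c x *: bar_class M (v x).
Proof. by rewrite -bar_class_comb; exact: (raddfB (bar_class M)). Qed.

Lemma bar_classB_map M (N : gmod A) (f : {linear M -> N}) (X : finType) (P : pred X)
    (c : X -> k) (y : M) (v : X -> M) :
  bar_class N (f (y - \sum_(x | P x) (c x)%:MP *: v x)) =
  bar_class N (f y) - \sum_(x | P x) c x *: bar_class N (f (v x)).
Proof.
rewrite -bar_classB_comb; congr (bar_class N _); rewrite raddfB raddf_sum /=.
by congr (_ - _); apply: eq_bigr => x _; rewrite linearZ.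
Qed.

Lemma bar_map_comb M (N : gmod A) (f : {linear M -> N}) (X : finType) (P : pred X)
    (c : X -> k) (v : X -> M) :
  bar_map f (\sum_(x | P x) c x *: bar_class M (v x)) =
  \sum_(x | P x) c x *: bar_class N (f (v x)).
Proof.
rewrite -!bar_class_comb bar_mapE; congr (bar_class N _); rewrite raddf_sum /=.
by apply: eq_bigr => x _; rewrite linearZ.
Qed.

Lemma bar_class_eq0 M (x : M) : bar_class M x = 0 ->
  exists r (a : 'I_r -> A) (y : 'I_r -> M),
    (forall i, (a i)@_0%MM = 0) /\ x = \sum_i a i *: y i.
Proof.
move=> /eqP; rewrite qpi_eq0 => /asboolP[s [sS ->]].
elim: s sS => [|p s IH] sS.
  by exists 0%N, (fun=> 0), (fun=> 0); split; [case|rewrite big_nil big_ord0].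
have [|r [a [y [a0 e]]]] := IH; first by move=> q qs; apply: sS; rewrite inE qs orbT.
have [b [z [b0 pz]]] := sS p (mem_head _ _).
exists r.+1, (fun i => if unlift ord0 i is Some j then a j else p.1%:MP * b).
exists (fun i => if unlift ord0 i is Some j then y j else z); split.
  move=> i; case: unliftP => [j _|_]; first exact: a0.
  by rewrite mul_mpolyC mcoeffZ b0 mulr0.
rewrite big_cons big_ord_recl unlift_none e; congr (_ + _).
  by rewrite pz rscalE scalerA.
by apply: eq_bigr => i _; rewrite liftK.
Qed.

(** A surjection maps m M onto m N: lift the module elements and keep the coefficients. It allows a
    lift to be corrected without changing its residue class. *)
Lemma bar_class_eq0_lift M (N : gmod A) (f : {linear M -> N}) (y : N) :
  (forall z, exists x, f x = z) -> bar_class N y = 0 ->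
  exists2 x, bar_class M x = 0 & f x = y.
Proof.
move=> fsurj /bar_class_eq0[r [a [z [a0 ->]]]].
have /choice[x hx] := fun i => fsurj (z i).
exists (\sum_i a i *: x i).
  by rewrite (raddf_sum (bar_class M)) big1 // => i _; exact: bar_class_max.
by rewrite raddf_sum; apply: eq_bigr => i _; rewrite /= linearZ /= hx.
Qed.

Lemma bar_map_surj M (N : gmod A) (f : {linear M -> N}) :
  (forall z, exists x, f x = z) -> forall z, exists x, bar_map f x = z.
Proof.
move=> fsurj z; have [y <-] := bar_class_surj z; have [x <-] := fsurj y.
by exists (bar_class M x); rewrite bar_mapE.
Qed.
End ResidueClasses.

Lemma finite_dim_quotient (k : fieldType) (W W' : lmodType k) (f : {linear W -> W'}) :
  (forall z, exists x, f x = z) -> finite_dim W -> finite_dim W'.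
Proof.
move=> fsurj [r [e he]]; exists r, (fun i => f (e i)) => z.
have [x <-] := fsurj z; have [c ->] := he x; exists c.
by rewrite raddf_sum; apply: eq_bigr => i _; rewrite /= linearZ.
Qed.

Lemma sum_image (V : nmodType) (J X : finType) (h : J -> X) (P : pred X) (f : X -> V) :
  injective h -> (forall x, P x <-> exists j, h j = x) ->
  \sum_j f (h j) = \sum_(x | P x) f x.
Proof.
move=> hinj hP; rewrite (partition_big h P) /=; last first.
  by move=> j _; apply/hP; exists j.
apply: eq_bigr => _ /hP[j <-]; rewrite (big_pred1 j) // => i.
by rewrite (inj_eq hinj).
Qed.

Lemma sum_split (V : nmodType) (X : finType) (P : pred X) (f g h : X -> V) :
  (forall x, P x -> f x = g x) -> (forall x, ~~ P x -> f x = h x) ->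
  \sum_x f x = \sum_(x | P x) g x + \sum_(x | ~~ P x) h x.
Proof.
by move=> fg fh; rewrite (bigID P) /=; congr (_ + _); apply: eq_bigr => x; auto.
Qed.

(** * Residues along a surjection of algebras preserving constant coefficients *)

Section RestrictedResidue.
Context (k : fieldType) (n0 n : nat).
Context (phi : {rmorphism {mpoly k[n0]} -> {mpoly k[n]}}).
Hypothesis phi0 : forall a, (phi a)@_0%MM = a@_0%MM.
Hypothesis phi_surj : forall b, exists a, phi a = b.
Hypothesis phiC : forall c, phi c%:MP = c%:MP.
Context (M : gmod {mpoly k[n]}).
Local Notation M0 := (grscal phi M).

(** A linear form maps m M into m, and [phi] carries the maximal ideal of one algebra into that of
    the other. *)
Lemma residue_coef (f : {linear M -> {mpoly k[n]}^o}) (x : M) :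
  bar_class M0 x = 0 -> (f x : {mpoly k[n]})@_0%MM = 0.
Proof.
move=> /bar_class_eq0[r [a [y [a0 ->]]]].
rewrite raddf_sum raddf_sum big1 // => i _.
rewrite /= rscalE linearZ /= -[RHS](mul0r ((f (y i) : {mpoly k[n]})@_0%MM)).
by rewrite -[X in X * _](a0 i) -phi0 -rmorphM.
Qed.

Lemma residue_of_coef (X : finType) (c : X -> {mpoly k[n]}) (e : X -> M) :
  (forall x, (c x)@_0%MM = 0) -> bar_class M0 (\sum_x c x *: e x) = 0.
Proof.
move=> c0; rewrite (raddf_sum (bar_class M0)) big1 // => x _.
have [a ea] := phi_surj (c x).
rewrite -ea; apply: (@bar_class_max k n0 M0 a (e x)).
by rewrite -phi0 ea.
Qed.

Lemma bar_class_combr (X : finType) (P : pred X) (c : X -> k) (v : X -> M) :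
  bar_class M0 (\sum_(x | P x) (c x)%:MP *: v x) =
  \sum_(x | P x) c x *: bar_class M0 (v x).
Proof.
rewrite -bar_class_comb; congr (bar_class M0 _); apply: eq_bigr => x _.
by rewrite rscalE phiC.
Qed.

Lemma bar_spanned (X : finType) (d : X -> int) (e : X -> M) : hbasis d e ->
  forall z : bar M0, exists c : X -> k, z = \sum_x c x *: bar_class M0 (e x).
Proof.
move=> [_ es _] z; have [x <-] := bar_class_surj z; have [c ex] := es x.
exists (fun x => (c x)@_0%MM); apply/eqP; rewrite -subr_eq0 -bar_class_combr.
rewrite -(raddfB (bar_class M0)) ex; apply/eqP.
have -> : \sum_x c x *: e x - \sum_x ((c x)@_0%MM)%:MP *: e x =
    \sum_x (c x - ((c x)@_0%MM)%:MP) *: e x :> M.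
  by rewrite -sumrB; apply: eq_bigr => y _; rewrite scalerBl.
apply: residue_of_coef => y; rewrite raddfB /= mcoeffC eqxx mulr1.
exact: subrr.
Qed.
End RestrictedResidue.

(** * Bases of the stalks of a pure sheaf with prescribed boundary values *)

Section PureSheaves.
Context (R : realType) (V : vectType R) (D : fan V) (F : sheaf D).
Hypothesis pF : pure F.
Implicit Types s t : D.

Let gF : graded_sheaf F. Proof. by case: pF. Qed.

Let Sc t (a : Sym R {:V}) : (Sres fullv \V_t a)@_0%MM = a@_0%MM.
Proof. exact: Sres_const. Qed.

Let Ss t (b : Sym R \V_t) : exists a, Sres fullv \V_t a = b.
Proof. exact: Sres_surj (subvf _). Qed.

Let SC t c : Sres fullv \V_t c%:MP = c%:MP :> Sym R \V_t.
Proof. exact: SresC. Qed.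

Lemma pure_hbasis t : exists r (d : 'I_r -> int) (e : 'I_r -> F t), hbasis d e.
Proof.
case: pF => _ _ /(_ t)[r [d [e [ed eu]]]]; exists r, d, e; split=> //.
  by move=> y; have [c [-> _]] := eu y; exists c.
move=> c c0 x; have [a [_ aU]] := eu 0.
have -> : c x = [ffun x => c x] x by rewrite ffunE.
rewrite -(aU [ffun x => c x]); last first.
  by rewrite -[LHS]c0; apply: eq_bigr => y _; rewrite ffunE.
rewrite (aU [ffun=> 0]) ?ffunE //.
by rewrite big1 // => y _; rewrite ffunE scale0r.
Qed.

Lemma bar_stalk_finite t : finite_dim (bar (stalkV F t)).
Proof.
have [r [d [e he]]] := pure_hbasis t; exists r, (fun i => bar_class (stalkV F t) (e i)).
by move=> z; have [c ->] := bar_spanned (@Sc t) (@Ss t) (@SC t) he z; exists c.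
Qed.

Lemma Kspace_hombasis t : exists (m : nat) (d : 'I_m -> int) (b : 'I_m -> Kspace F t),
  (forall i, gdeg (Kspace F t) (d i) (b i)) /\ rbasis xpredT b.
Proof.
apply: hombasis; first exact: graded_Kspace.
apply: (@indep_bounded_inj _ _ _ (val : Kspace F t -> bar (stalkV F t))).
  exact: val_inj.
exact: bar_stalk_finite.
Qed.

Lemma rho_surj t (x : sections F (boundary t)) : exists y : stalkV F t, rho F t y = x.
Proof. by apply: flabby_rho_surj; case: pF. Qed.

Lemma hp_rho t i (x : F t) : hp i (rho F t x) = rho F t (hp i x).
Proof.
have := hp_map (gF.1 t) (graded_sections gF (boundary t)) (f := rho F t) (m := 0)
  _ _ i x.
rewrite addr0; apply; first exact: (raddfB (rho F t)).
by move=> j y yj; rewrite addr0; exact: rho_deg.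
Qed.

Section Adapted.
Context (t : D).
Local Notation B := (sections F (boundary t)).
Local Notation FV := (stalkV F t).
Context (J X : finType) (dK : J -> int) (kap : J -> Kspace F t).
Context (d : X -> int) (beta : X -> B) (isK : pred X) (h : J -> X).
Hypotheses (kap_deg : forall j, gdeg (Kspace F t) (dK j) (kap j))
  (kapP : rbasis xpredT kap).
Hypotheses (h_inj : injective h) (hK : forall x, isK x <-> exists j, h j = x)
  (dh : forall j, d (h j) = dK j).
Hypotheses (beta0 : forall x, isK x -> beta x = 0)
  (beta_deg : forall x, gdeg B (d x) (beta x))
  (betaP : rbasis (fun x => ~~ isK x) (fun x => bar_class B (beta x))).

(* A residue class in the kernel lifts to an element restricting to zero:
   subtract from any lift an element of [m F_t] with the same restriction. *)
Lemma kernel_lift j : exists v : F t,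
  [/\ gdeg (F t) (dK j) v, rho F t v = 0 & bar_class FV v = val (kap j)].
Proof.
have [m mj em] := kap_deg j.
have : bar_class B (rho F t m) = 0.
  by rewrite -bar_mapE em; exact: (submodP (kap j)).
move=> /(bar_class_eq0_lift (f := rho F t) (@rho_surj t))[y y0 ey].
exists (hp (dK j) (m - y : F t)); split; first exact: (hp_deg (gF.1 t)).
  have e0 : rho F t (m - y) = 0.
    apply: etrans (raddfB _ m y) _.
    by apply/eqP; rewrite subr_eq0; apply/eqP; exact: esym ey.
  by rewrite -hp_rho e0 (hp0 (graded_sections gF _)).
have gFV := graded_stalkV gF t.
rewrite -(hp_stalkV gF) -(hp_bar gFV) raddfB /= y0 subr0 em.
by rewrite (hp_id (graded_bar gFV)) //; exact: kap_deg.
Qed.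

(** Since restriction to the boundary commutes with components, the component of degree [d x] of any
    lift of [beta x] is again a lift. *)
Lemma adapted_lifts : exists v : X -> F t,
  [/\ forall x, gdeg (F t) (d x) (v x), forall x, rho F t (v x) = beta x &
      forall j, bar_class FV (v (h j)) = val (kap j)].
Proof.
suff /choice[v hv] : forall x, exists v : F t, [/\ gdeg (F t) (d x) v,
    rho F t v = beta x & forall j, h j = x -> bar_class FV v = val (kap j)].
  by exists v; split=> [x|x|j]; [case: (hv x)|case: (hv x)|case: (hv (h j)) => _ _; apply].
move=> x; have [Kx|Kx] := boolP (isK x).
  have [j ej] := (hK x).1 Kx; have [v [vd v0 vk]] := kernel_lift j.
  exists v; split=> [||i ei]; first by rewrite -ej dh.
    by rewrite v0 beta0.
  by rewrite vk; congr (val (kap _)); apply: h_inj; rewrite ej.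
have [y ey] := rho_surj (beta x).
exists (hp (d x) y); split=> [||j ej]; first exact: (hp_deg (gF.1 t)).
  by rewrite -hp_rho ey; apply: (hp_id (graded_sections gF _)).
by case/negP: Kx; apply/hK; exists j.
Qed.

(** Spanning: the class of the restriction of [y] prescribes coefficients at the boundary
    generators; what remains of the class of [y] lies in K_t, where [kap] spans. Independence:
    restriction to the boundary kills the kernel generators and forces the other coefficients to
    vanish; the rest is a relation between the [kap j]. *)
Lemma adapted_basis : exists e : X -> F t,
  hbasis d e /\ forall x, rho F t (e x) = beta x.
Proof.
have [v [vd vrho vk]] := adapted_lifts; exists v; split=> //.
have [r [d0 [e0 he]]] := pure_hbasis t; have [_ es ei] := he.
have /choice[P vE] : forall x, exists c : 'I_r -> Sym R \V_t, v x = \sum_i c i *: e0 i.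
  by move=> x; exact: es.
have span (y : F t) : exists c : X -> R,
    bar_class FV y = \sum_x c x *: bar_class FV (v x).
  have [c hc] := betaP.1 (bar_class B (rho F t y)).
  pose z : bar FV :=
    bar_class FV ((y : FV) - \sum_(x | ~~ isK x) (c x)%:MP *: (v x : FV)).
  have zK : kernel (bar_map (rho F t)) z.
    apply: etrans (bar_mapE (rho F t) _) _.
    apply: etrans (bar_classB_map (rho F t) _ _ _ _) _.
    rewrite hc; apply/eqP; rewrite subr_eq0.
    by apply/eqP/eq_bigr => x _; rewrite vrho.
  have [c' hc'] := kapP.1 (mk_submod (kernel_submod _) zK).
  (* The coefficients at the [kap j], moved to [X] along [h] and set to 0 off its image. *)
  pose cK x := if [pick j | h j == x] is Some j then c' j else 0.
  have cKh j : cK (h j) = c' j.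
    rewrite /cK; case: pickP => [i /eqP/h_inj -> //|/(_ j)].
    by rewrite eqxx.
  exists (fun x => if isK x then cK x else c x).
  have zE : z = \sum_(x | isK x) cK x *: bar_class FV (v x).
    apply: etrans (congr1 val hc') _; apply: etrans (submod_comb _ _ _ _) _.
    rewrite -(sum_image _ h_inj hK); apply: eq_bigr => j _.
    by rewrite cKh vk.
  have yE : bar_class FV y = z + \sum_(x | ~~ isK x) c x *: bar_class FV (v x).
    by rewrite /z bar_classB_comb subrK.
  rewrite yE zE; apply: esym; apply: sum_split => x; first by move->.
  by move=> /negPf ->.
have combE (c : X -> R) : \sum_x (c x)%:MP *: (v x : FV) =
    \sum_l (\sum_x (c x)%:MP * P x l) *: e0 l :> F t.
  transitivity (\sum_x \sum_l ((c x)%:MP * P x l) *: e0 l).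
    apply: eq_bigr => x _.
    apply: etrans (congr1 (fun a : Sym R \V_t => a *: v x) (SC t (c x))) _.
    rewrite vE scaler_sumr; by apply: eq_bigr => l _; rewrite scalerA.
  by rewrite exchange_big; apply: eq_bigr => l _; rewrite scaler_suml.
have constE (c : X -> R) l :
    (\sum_x (c x)%:MP * P x l)@_0%MM = \sum_x c x * (P x l)@_0%MM.
  by rewrite raddf_sum; apply: eq_bigr => x _; rewrite /= mul_mpolyC mcoeffZ.
apply: (hbasis_of_residue (gF.1 t) he vd vE).
- move=> i; have [c hc] := span (e0 i); exists c => j.
  (* The coordinate function of index [j] in the basis [e0]; by [residue_coef] it turns an equality
     of residue classes into one of constant coefficients. *)
  have [f hf] := hbasis_lift (N := (Sym R \V_t)^o) (fun l => ((l == j)%:R : Sym R \V_t)) he.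
  have fE (a : 'I_r -> Sym R \V_t) : f (\sum_i a i *: e0 i) = a j.
    rewrite hf (bigD1 j) //= eqxx [X in X + _]mulr1 big1 ?addr0 // => l /negPf ->.
    exact: mulr0.
  have eE : (e0 i : FV) - \sum_x (c x)%:MP *: (v x : FV) =
      \sum_l ((i == l)%:R - \sum_x (c x)%:MP * P x l) *: e0 l :> F t.
    rewrite combE [in LHS](_ : e0 i = \sum_l (i == l)%:R *: e0 l).
      by rewrite -sumrB; apply: eq_bigr => l _; rewrite scalerBl.
    rewrite (bigD1 i) //= eqxx scale1r big1 ?addr0 // => l.
    by rewrite eq_sym => /negPf ->; rewrite scale0r.
  have : bar_class FV ((e0 i : FV) - \sum_x (c x)%:MP *: (v x : FV)) = 0.
    by rewrite bar_classB_comb hc subrr.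
  move=> /(residue_coef (@Sc t) f); rewrite eE fE raddfB /= constE.
  have -> : ((i == j)%:R : Sym R \V_t)@_0%MM = (i == j)%:R.
    by case: eqP; rewrite ?mcoeff0 // mcoeff1 eqxx.
  by move/eqP; rewrite subr_eq0 => /eqP.
- move=> c c0.
  have V0 : \sum_x c x *: bar_class FV (v x) = 0.
    rewrite -bar_class_comb combE.
    by apply: (residue_of_coef (@Sc t) (@Ss t)) => i; rewrite constE.
  have cN x : ~~ isK x -> c x = 0.
    apply: betaP.2.
    have h0 : \sum_x c x *: bar_class B (rho F t (v x)) = 0.
      apply: etrans (esym (bar_map_comb (rho F t) xpredT c v)) _.
      by apply: etrans (congr1 _ V0) _; exact: raddf0.
    transitivity (\sum_(x | ~~ isK x) c x *: bar_class B (rho F t (v x))).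
      by apply: eq_bigr => y _; rewrite vrho.
    apply: etrans h0; apply: big_rmcond => y; rewrite negbK => Ky.
    by rewrite vrho beta0 // raddf0 scaler0.
  move=> x; have [/hK[j <-]|/cN //] := boolP (isK x).
  apply: (kapP.2 (c \o h)) => //; apply: val_inj.
  apply: etrans (submod_comb _ _ _ _) _.
  transitivity (\sum_(x | isK x) c x *: bar_class FV (v x)).
    by rewrite -(sum_image _ h_inj hK); apply: eq_bigr => i _; rewrite vk.
  apply: etrans V0; apply: big_rmcond => y /cN ->; exact: scale0r.
Qed.
End Adapted.
End PureSheaves.

(** * Adapted bases of simple sheaves *)

Lemma rbasis_bij (k : fieldType) (W W' : lmodType k) (f : {linear W -> W'})
    (X : finType) (P : pred X) (b : X -> W) : bijective f ->
  rbasis P b -> rbasis P (fun x => f (b x)).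
Proof.
move=> [g gK Kg] [bs bi]; split=> [w|c c0].
  have [c ec] := bs (g w); exists c; rewrite -[LHS]Kg ec raddf_sum.
  by apply: eq_bigr => x _; rewrite /= linearZ.
apply: bi; apply: (can_inj gK); rewrite raddf0 -[RHS]c0 raddf_sum.
by apply: eq_bigr => x _; rewrite /= linearZ.
Qed.

Lemma sum_unit (W : nmodType) (f : unit -> W) : \sum_x f x = f tt.
Proof. by rewrite (big_pred1 tt) // => -[]. Qed.

Lemma rbasis_eq (k : fieldType) (W : lmodType k) (X : finType) (P : pred X)
    (b b' : X -> W) : b =1 b' -> rbasis P b -> rbasis P b'.
Proof. by move=> /funext ->. Qed.

Lemma bar_map_bij (k : fieldType) n (M N : gmod {mpoly k[n]}) (f : {linear M -> N}) :
  bijective f -> bijective (bar_map f).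
Proof.
move=> [g gK Kg].
have fsurj z : exists x, f x = z by exists (g z).
have /choice[h hh] := bar_map_surj fsurj.
suff inj : injective (bar_map f) by exists h => // x; apply: inj; rewrite hh.
apply: raddf_inj => x; have [y <-] := bar_class_surj x.
move=> y0; have {y0} : bar_class N (f y) = 0 by rewrite -bar_mapE; exact: y0.
by move=> /(bar_class_eq0_lift (f := f) fsurj)[z z0 /(can_inj gK) <-].
Qed.

Section FreeTensor.
Context (k : fieldType) (n : nat).
Local Notation A := {mpoly k[n]}.

Lemma hbasis_image (M N : gmod A) (f : {linear M -> N}) (X : finType) d (e : X -> M) :
  gmod_iso f -> hbasis d e -> hbasis d (fun x => f (e x)).
Proof.
move=> [[g gK Kg] fd] [ed es ei].
have fE (c : X -> A) : \sum_x c x *: f (e x) = f (\sum_x c x *: e x).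
  by rewrite raddf_sum; apply: eq_bigr => x _; rewrite /= linearZ.
split=> [x|y|c]; first by apply/fd; exact: ed.
  by have [c ec] := es (g y); exists c; rewrite fE -ec Kg.
by rewrite fE -(raddf0 f) => /(can_inj gK)/ei.
Qed.

Definition Sym_one : Sym_self k n := 1 : A.

Lemma Sym_oneZ (a : A) : a *: Sym_one = a.
Proof. exact: mulr1. Qed.

Lemma hbasis_Sym : hbasis (M := Sym_self k n) (fun _ : unit => 0) (fun=> Sym_one).
Proof.
split=> [_|y|c c0 []]; first exact: Sym_degC.
  by exists (fun=> y); rewrite sum_unit Sym_oneZ.
by rewrite -[RHS]c0 sum_unit Sym_oneZ.
Qed.

Lemma hbasis_gtensor (W : gmod k) (m : nat) (d : 'I_m -> int) (b : 'I_m -> W) :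
  (forall i, gdeg W (d i) (b i)) -> rbasis xpredT b ->
  hbasis (M := gtensor (Sym_self k n) W) d (fun i => mtens (mC k n) Sym_one (b i)).
Proof.
move=> bd hb; have [c [bc cb]] := rbasis_coord hb.
pose T i := tcoord (mC k n) (Sym_self k n) c i.
have sE (a : 'I_m -> A) : \sum_i a i *: mtens (mC k n) Sym_one (b i) =
    \sum_i mtens (mC k n) (a i : Sym_self k n) (b i).
  by apply: eq_bigr => i _; rewrite mtensZl Sym_oneZ.
split=> [i|y|a].
- apply: (gtensor_gdeg (p := 0) (q := d i)) => //; last exact: add0r.
  exact: (Sym_degC _ 1).
- exists (fun i => T i y); rewrite sE; exact: tcoord_sum.
- rewrite sE => a0 i; have := congr1 (T i) a0.
  rewrite raddf0 raddf_sum (bigD1 i) //= big1.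
    by rewrite addr0 /T tcoord_basis // eqxx.
  by move=> j ji; rewrite /T tcoord_basis // eq_sym (negPf ji).
Qed.
End FreeTensor.

Section AdaptedBases.
Context (R : realType) (V : vectType R) (D : fan V).
Implicit Types (s t u : D) (F E G : sheaf D).

Definition commutes_at F E (p : forall t, {linear F t -> E t}) t u :=
  forall x, p u (res F t u x) = res E t u (p t x).

Section BijectiveSectionMap.
Context (F E : sheaf D) (L : {fset set V}) (p : forall t, {linear F t -> E t}).
Hypothesis pr : forall t u, val t \in L -> val u \in L -> face (val u) (val t) ->
  commutes_at p t u.
Hypothesis pbij : forall t, val t \in L -> bijective (p t).

Lemma section_map_bij : bijective (section_map pr).
Proof.
(* Inverses exist on [L] only; elsewhere 0 is the default. *)
have exq t : exists q : E t -> F t,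
    val t \in L -> cancel (p t) q /\ cancel q (p t).
  have [/pbij[q qK Kq]|_] := boolP (val t \in L); last by exists (fun=> 0).
  by exists q.
pose q t := sval (cid (exq t)); have hq t : val t \in L ->
  cancel (p t) (q t) /\ cancel (q t) (p t) := svalP (cid (exq t)).
have inj : injective (section_map pr).
  move=> x y xy; apply: sections_ext => t tL; have [qK _] := hq t tL.
  by apply: (can_inj qK); rewrite -!(section_mapE pr) xy.
have surj z : exists x, section_map pr x = z.
  have [|x hx] := @sections_ex _ _ _ F L (fun t tL => q t (section_at z tL)).
    move=> t tL u uL ut; have [_ Kq] := hq t tL; have [qK' Kq'] := hq u uL.
    by apply: (can_inj qK'); rewrite (pr tL uL ut) Kq Kq'; exact: section_res.
  exists x; apply: sections_ext => t tL; rewrite section_mapE hx.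
  by have [_ Kq] := hq t tL; exact: Kq.
have /choice[g hg] := surj.
by exists g => // x; apply: inj; rewrite hg.
Qed.
End BijectiveSectionMap.

(* The [e x] with [isK x] lift a basis of the kernel [K_t]; the others restrict
   to a minimal generating family of the sections over the boundary. *)
Definition adapted G t (X : finType) (d : X -> int) (e : X -> G t) (isK : pred X) :=
  [/\ hbasis d e, forall x, isK x -> rho G t (e x) = 0 &
      rbasis (fun x => ~~ isK x)
        (fun x => bar_class (sections G (boundary t)) (rho G t (e x)))].

Lemma sections_zero G L : (forall u, val u \in L -> forall x : G u, x = 0) ->
  forall x : sections G L, x = 0.
Proof. by move=> G0 x; apply: sections_ext => t tL; rewrite (G0 _ tL (section_at x tL)). Qed.

Lemma rbasis_zero (W : lmodType R) (X : finType) (b : X -> W) (P : pred X) :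
  (forall w : W, w = 0) -> (forall x, ~~ P x) -> rbasis P b.
Proof.
move=> W0 P0; split=> [w|c _ x]; last by rewrite (negPf (P0 x)).
by exists (fun=> 0); rewrite (W0 w) big1 // => x _; rewrite scale0r.
Qed.

Lemma bar_zero n (M : gmod {mpoly R[n]}) : (forall x : M, x = 0) ->
  forall z : bar M, z = 0.
Proof. by move=> M0 z; have [x <-] := bar_class_surj z; rewrite (M0 x) raddf0. Qed.

Section Simple.
Context (s : D) (E : sheaf D).
Hypothesis sE : is_simple s E.

Lemma simple_zero t : (cdim (val t) <= cdim (val s))%N -> t != s ->
  forall x : E t, x = 0.
Proof. by case: sE => _ + _ _; apply. Qed.

Lemma simple_boundary_zero t : (cdim (val t) <= cdim (val s))%N ->
  forall x : sections E (boundary t), x = 0.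
Proof.
move=> ts; apply: sections_zero => u ut.
have us := leq_trans (boundary_dim ut) ts.
apply: simple_zero; first exact: ltnW.
by apply: contraTneq us => ->; rewrite ltnn.
Qed.

(** The stalks at all proper faces of [s] vanish, so the generator 1 of A_s has zero boundary values
    and there is nothing else to generate. *)
Lemma simple_adapted_self : exists d e, adapted (G := E) (t := s) (X := unit) d e xpredT
  /\ d tt = 0.
Proof.
case: sE => _ _ [f fiso] _.
exists (fun=> 0), (fun=> f (Sym_one R _)); split=> //; split.
- exact: (hbasis_image fiso (hbasis_Sym R _)).
- by move=> _ _; exact: simple_boundary_zero.
- apply: rbasis_zero => //; apply: bar_zero; exact: simple_boundary_zero.
Qed.

Lemma simple_adapted_small t : (cdim (val t) <= cdim (val s))%N -> t != s ->
  exists d e, adapted (G := E) (t := t) (X := void) d e xpred0.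
Proof.
move=> ts nts; have E0 := simple_zero ts nts.
exists (fun=> 0), (fun=> 0); split=> //.
- split=> [[]|y|c _ []]; exists (fun=> 0).
  by rewrite (E0 y) big1 // => x; rewrite scale0r.
- split=> [w|c _ []]; exists (fun=> 0).
  rewrite (bar_zero (simple_boundary_zero ts) w) big1 // => x _; exact: scale0r.
Qed.

(** For a homogeneous basis of residue classes of boundary sections, the generators 1 (x) [b i]
    restrict to [sec (b i)], whose class is [b i]. *)
Lemma simple_adapted_large t : (cdim (val s) < cdim (val t))%N ->
  finite_dim (bar (sections E (boundary t))) ->
  exists (m : nat) (d : 'I_m -> int) e, adapted (G := E) (t := t) d e xpred0.
Proof.
move=> st fin; have [gE _ _ /(_ t st)[sec [f [secK secd fiso fr]]]] := sE.
have [m [d [b [bd hb]]]] : exists (m : nat) (d : 'I_m -> int)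
    (b : 'I_m -> bar (sections E (boundary t))),
    (forall i, gdeg (bar (sections E (boundary t))) (d i) (b i)) /\ rbasis xpredT b.
  apply: hombasis; first exact: (graded_bar (graded_sections gE _)).
  by apply: (@indep_bounded_inj _ _ _ idfun) fin.
exists m, d, (fun i => f (mtens (mC R _) (Sym_one R _) (b i))); split=> //.
  exact: (hbasis_image fiso (hbasis_gtensor (\dim \V_t) bd hb)).
have rE i : rho E t (f (mtens (mC R _) (Sym_one R _) (b i))) = sec (b i).
  apply: sections_ext => u ut; apply: etrans (rhoE _ ut) _.
  apply: etrans (fr (Sym_one R _) (b i) u ut) _.
  exact: etrans (congr1 (fun a => a *: section_at (sec (b i)) ut) (rmorph1 _))
    (scale1r _).
apply: rbasis_eq hb => i; apply: esym.
exact: etrans (congr1 (bar_class _) (rE i)) (secK _).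
Qed.
End Simple.
End AdaptedBases.

(** * Direct sums *)

Lemma sum_only1 (W : nmodType) (I : finType) (f : I -> W) i :
  (forall j, j != i -> f j = 0) -> \sum_j f j = f i.
Proof. by move=> f0; rewrite (bigD1 i) //= big1 ?addr0. Qed.

Section Biproducts.
Context (R : realType) (V : vectType R) (D : fan V).
Implicit Types (s t u : D) (F G : sheaf D).

(* [G] is the direct sum of the sheaves [E i] with degrees shifted by [sh i],
   presented by its projections. *)
Definition biproduct G (T : finType) (E : T -> sheaf D) (sh : T -> int)
    (pr : forall i u, {linear G u -> E i u}) :=
  [/\ forall i t u, face (val u) (val t) -> commutes_at (pr i) t u,
      forall u (x : G u), (forall i, pr i u x = 0) -> x = 0,
      forall u (y : forall i, E i u), exists x, forall i, pr i u x = y i &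
      forall u n (x : G u), gdeg (G u) n x <->
        forall i, gdeg (E i u) (n - sh i) (pr i u x)].

Section OneBiproduct.
Context (G : sheaf D) (T : finType) (E : T -> sheaf D) (sh : T -> int).
Context (pr : forall i u, {linear G u -> E i u}).
Hypotheses (gE : forall i, graded_sheaf (E i)) (bG : biproduct sh pr).

Lemma biproduct_eq u (x y : G u) : (forall i, pr i u x = pr i u y) -> x = y.
Proof.
case: bG => _ pr0 _ _ xy; apply/eqP; rewrite -subr_eq0; apply/eqP/pr0 => i.
by rewrite raddfB /= xy subrr.
Qed.

(** The projections are jointly bijective, which determines the inclusions; linearity and
    commutation with restrictions are verified after projecting. *)
Lemma biproduct_in : exists inn : forall i u, {linear E i u -> G u},
  [/\ forall i u y, pr i u (inn i u y) = y,
      forall i j u y, i != j -> pr j u (inn i u y) = 0,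
      forall u x, x = \sum_i inn i u (pr i u x),
      forall i t u, face (val u) (val t) -> commutes_at (inn i) t u &
      forall i u n y, gdeg (E i u) n y -> gdeg (G u) (n + sh i) (inn i u y)].
Proof.
case: bG => prC pr0 prS prd.
have ex i u (y : E i u) : exists x, pr i u x = y /\ forall j, i != j -> pr j u x = 0.
  have [x hx] := prS u (dfwith (fun j => 0 : E j u) y).
  by exists x; split=> [|j ij]; rewrite hx ?dfwith_in ?dfwith_out.
pose f i u y := sval (cid (ex i u y)).
have f1 i u y : pr i u (f i u y) = y by case: (svalP (cid (ex i u y))).
have f0 i u y j : i != j -> pr j u (f i u y) = 0.
  by case: (svalP (cid (ex i u y))) => _; apply.
have fL i u : linear (f i u).
  move=> a x y; apply: biproduct_eq => j; rewrite linearP.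
  have [<-|ij] := eqVneq i j; first by rewrite !f1.
  by rewrite !f0 // scaler0 addr0.
pose g i u : {linear E i u -> G u} := lin_of (fL i u).
have g1 i u y : pr i u (g i u y) = y by exact: f1.
have g0 i j u y : i != j -> pr j u (g i u y) = 0 by exact: f0.
exists g; split=> //.
- move=> u x; apply: biproduct_eq => j; rewrite raddf_sum (bigD1 j) //= g1.
  by rewrite big1 ?addr0 // => i ij; exact: g0.
- move=> i t u ut y; apply: biproduct_eq => j; apply: etrans (esym (prC j t u ut _)).
  have [<-|ij] := eqVneq i j; first by rewrite !g1.
  by rewrite !g0 // raddf0.
- move=> i u n y yn; apply/prd => j; have [<-|ij] := eqVneq i j.
    by rewrite addrK g1.
  by rewrite g0 //; exact: (gdeg0 ((gE j).1 u)).
Qed.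

Section AdaptedBiproduct.
Context (t : D) (X : T -> finType) (d : forall i, X i -> int).
Context (e : forall i, X i -> E i t) (isK : forall i, pred (X i)).
Hypothesis he : forall i, adapted (@d i) (@e i) (@isK i).

Let sumE (W : nmodType) (P : forall i, pred (X i)) (f : {i : T & X i} -> W) :
  \sum_(p | P (tag p) (tagged p)) f p = \sum_i \sum_(x | P i x) f (Tagged X x).
Proof.
rewrite (sig_big_dep xpredT (fun i (x : X i) => P i x)
  (fun i x => f (Tagged X x))) /=.
by apply: eq_bigr => -[].
Qed.

(** Inclusions and projections also act on sections over the boundary ([SI], [SP]), so their residue
    classes decompose along the summands. Spanning is transported by the inclusions, independence is
    detected by the projections. *)
Lemma biproduct_adapted : exists e' : {i : T & X i} -> G t,
  adapted (fun p => d (tagged p) + sh (tag p)) e' (fun p => isK (tagged p)).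
Proof.
have [inn [pr_in pr_in0 in_pr inC in_deg]] := biproduct_in.
have prC := let: And4 prC _ _ _ := bG in prC.
pose f (p : {i : T & X i}) : G t := inn (tag p) t (e (tagged p)).
pose SI i : {linear sections (E i) (boundary t) -> sections G (boundary t)} :=
  section_map (fun u v _ _ => inC i u v).
pose SP i : {linear sections G (boundary t) -> sections (E i) (boundary t)} :=
  section_map (fun u v _ _ => prC i u v).
have SPI i y : SP i (SI i y) = y.
  by apply: sections_ext => u ut; rewrite !section_mapE pr_in.
have SPI0 i j y : i != j -> SP j (SI i y) = 0.
  by move=> ij; apply: sections_ext => u ut; rewrite !section_mapE pr_in0.
have SIP z : z = \sum_i SI i (SP i z).
  apply: sections_ext => u ut; rewrite section_at_sum.
  by rewrite {1}[section_at z ut]in_pr; apply: eq_bigr => i _; rewrite !section_mapE.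
have rhoI i y : rho G t (inn i t y) = SI i (rho (E i) t y).
  apply: sections_ext => u ut; rewrite section_mapE !rhoE.
  by apply: esym; exact: (inC i t u (boundary_face ut)).
exists f; split.
- split=> [p|y|c c0 [i x]].
  + by apply: in_deg; case: (he (tag p)) => -[ed _ _] _ _; exact: ed.
  + have ex i : exists c : X i -> Sym R \V_t, pr i t y = \sum_x c x *: e x.
      by case: (he i) => -[_ es _] _ _; exact: es.
    pose c i := sval (cid (ex i)); have hc i := svalP (cid (ex i)).
    exists (fun p => c (tag p) (tagged p)).
    rewrite (sumE (fun=> xpredT)) {1}[y]in_pr; apply: eq_bigr => i _.
    rewrite hc raddf_sum; apply: eq_bigr => x _.
    by rewrite /= linearZ.
  + case: (he i) => -[_ _ ei] _ _; apply: (ei (fun x => c (Tagged X x))).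
    have := congr1 (pr i t) c0; rewrite (sumE (fun=> xpredT)) raddf0.
    rewrite raddf_sum (bigD1 i) //= [X in _ + X]big1 ?addr0 => [h|j ji].
      rewrite -[RHS]h raddf_sum; apply: eq_bigr => z _ /=.
      by rewrite linearZ /= pr_in.
    rewrite raddf_sum big1 // => z _ /=; rewrite linearZ /= pr_in0 //.
    exact: scaler0.
- move=> [i x] /= Kx; case: (he i) => _ /(_ x Kx) e0 _.
  apply: etrans (rhoI i _) _; rewrite e0; exact: (raddf0 (SI i)).
- have fE p : bar_class _ (rho G t (f p)) =
      bar_class _ (SI (tag p) (rho (E (tag p)) t (e (tagged p)))) by rewrite rhoI.
  apply: rbasis_eq (fun p => esym (fE p)) _; split=> [w|c c0 [i x] Kx].
  + have [z <-] := bar_class_surj w.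
    have ex i : exists c : X i -> R, bar_class _ (SP i z) =
        \sum_(x | ~~ isK x) c x *: bar_class _ (rho (E i) t (e x)).
      by case: (he i) => _ _ [es _]; exact: es.
    pose c i := sval (cid (ex i)); have hc i := svalP (cid (ex i)).
    exists (fun p => c (tag p) (tagged p)).
    rewrite (sumE (fun i x => ~~ isK x)) {1}[z]SIP (raddf_sum (bar_class _)).
    apply: eq_bigr => i _; apply: etrans (esym (bar_mapE (SI i) _)) _.
    by rewrite hc; exact: bar_map_comb.
  + case: (he i) => _ _ [_ ei]; apply: (ei (fun x => c (Tagged X x))) Kx.
    have h := etrans (esym (bar_map_comb (SP i) _ c _)) (congr1 _ c0).
    rewrite raddf0 (sumE (fun i x => ~~ isK x)) in h.
    apply: etrans h; apply: esym; apply: etrans; first apply: (sum_only1 (i := i)).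
      move=> j ji; apply: big1 => z _.
      apply: etrans (scaler0 _ (c (Tagged X z))); congr (_ *: _).
      by apply: etrans (congr1 (bar_class _) (SPI0 j i _ ji)) _; exact: raddf0.
    by apply: eq_bigr => z _; congr (_ *: bar_class _ _); exact: SPI.
Qed.
End AdaptedBiproduct.
End OneBiproduct.
End Biproducts.

Section TensorDegrees.
Context (k : fieldType) (n : nat).
Local Notation A := {mpoly k[n]}.
Context (M : gmod A) (K : gmod k) (X : finType) (d : X -> int) (b : X -> K).
Context (c : X -> {linear K -> k^o}).
Hypotheses (hM : graded_Sym_module M) (hK : graded_space K).
Hypothesis bd : forall x, gdeg K (d x) (b x).
Hypothesis bc : forall w, w = \sum_x c x w *: b x.
Hypothesis cb : forall x y, c x (b y) = (x == y)%:R.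

Lemma coord_deg q w x : gdeg K q w -> q != d x -> c x w = 0.
Proof.
move=> wq qx; have : c x (hp (d x) w) = 0.
  by rewrite (hp_ne hK wq) ?raddf0 // eq_sym.
move=> <-; rewrite {2}[w]bc (hp_bigsum hK) raddf_sum (sum_only1 (i := x)) => [|y yx].
  by rewrite (hpZ0 hK) ?(hp_id hK) //= ?linearZ /= ?cb ?eqxx; [exact: esym (mulr1 _)|exact: scalar_deg0].
rewrite (hpZ0 hK) /=; last exact: scalar_deg0.
rewrite (hpE hK _ (bd y)); case: eqP => _; last by rewrite scaler0 raddf0.
by rewrite linearZ /= cb eq_sym (negPf yx) scaler0.
Qed.

Lemma gtensor_deg_coord i (t : gtensor M K) : gdeg (gtensor M K) i t <->
  forall x, gdeg M (i - d x) (tcoord (mC k n) M c x t).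
Proof.
split=> [[r [m [w [p [q [h ->]]]]]] x|td].
  rewrite raddf_sum; apply: (gdeg_sum hM) => j _ /=; have [mp wq pq] := h j.
  rewrite tcoordE; have [qx|qx] := eqVneq (q j) (d x); last first.
    by rewrite (coord_deg wq qx) rmorph0 scale0r; exact: (gdeg0 hM).
  rewrite -pq -qx addrK -[p j]add0r; apply: (gdegZ hM) mp; exact: Sym_degC.
rewrite (tcoord_sum (iota := mC k n) (M := M) bc t).
apply: (gdeg_sum (graded_gtensor hM hK)) => x _.
by apply: (gtensor_gdeg (td x) (bd x)); rewrite subrK.
Qed.
End TensorDegrees.

Lemma tcoord_map (k : fieldType) (A B : comNzRingType) (iota : {rmorphism k -> A})
    (kappa : {rmorphism k -> B}) (g : {rmorphism A -> B})
    (gk : forall a, g (iota a) = kappa a) (M : lmodType A) (N : lmodType B)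
    (K : lmodType k) (f : {linear M -> rscal g N}) (X : finType)
    (c : X -> {linear K -> k^o}) x (z : mtensor iota M K) :
  tcoord kappa N c x (mtensor_map gk f z) = f (tcoord iota M c x z).
Proof.
apply: (@mtensor_ext _ _ _ _ _ _ (tcoord kappa N c x \o mtensor_map gk f)
  (f \o tcoord iota M c x)) z => y w /=.
apply: etrans (congr1 (tcoord kappa N c x) (mtensor_mapE gk f _ _)) _.
by rewrite !tcoordE linearZ /= rscalE gk.
Qed.

(** * The sum of the tensor sheaves as a sum of shifted copies of the simple sheaves *)

Section SumOfTensors.
Context (R : realType) (V : vectType R) (D : fan V).
Implicit Types (s t u : D).
Context (E : D -> sheaf D) (K : D -> gmod R).
Context (m : D -> nat) (d : forall s, 'I_(m s) -> int).
Context (b : forall s, 'I_(m s) -> K s) (c : forall s, 'I_(m s) -> {linear K s -> R^o}).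
Hypotheses (gE : forall s, graded_sheaf (E s)) (hK : forall s, graded_space (K s)).
Hypothesis bd : forall s x, gdeg (K s) (d x) (b (s := s) x).
Hypothesis bc : forall s w, w = \sum_x c (s := s) x w *: b x.
Hypothesis cb : forall s x y, c (s := s) x (b y) = (x == y)%:R.
Local Notation G := (dsum_sheaf (fun s => tensor_sheaf (E s) (K s))).
Local Notation T := {s : D & 'I_(m s)}.

Let pf (p : T) u (x : G u) : E (tag p) u :=
  tcoord (mC R _) (E (tag p) u) (c (s := tag p)) (tagged p) (x (tag p)).

Let pfL p u : linear (@pf p u).
Proof. by move=> a x y; rewrite /pf prodmD prodmZ linearP. Qed.

Definition dsum_pr p u : {linear G u -> E (tag p) u} := lin_of (@pfL p u).

Let dsum_prE s j u x :
  dsum_pr (Tagged _ j : T) u x = tcoord (mC R _) (E s u) (c (s := s)) j (x s).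
Proof. by []. Qed.

Lemma dsum_biproduct : biproduct (fun p : T => d (tagged p)) dsum_pr.
Proof.
split.
- move=> [s j] t u ut x; rewrite !dsum_prE.
  exact: (tcoord_map (@SresC R V \V_t \V_u) (res (E s) t u) (c (s := s)) j (x s)).
- move=> u x x0; apply: functional_extensionality_dep => s.
  rewrite (tcoord_sum (iota := mC R _) (M := E s u) (bc (s := s)) (x s)).
  by apply: big1 => j _; rewrite -dsum_prE x0 mtens0l.
- move=> u y; exists (fun s => \sum_j
      (mtens (mC R _) (y (Tagged (fun s => 'I_(m s)) j)) (b (s := s) j)
        : gtensor (E s u) (K s))).
  move=> [s j]; rewrite dsum_prE raddf_sum (sum_only1 (i := j)) => [|i ij] /=.
    by rewrite tcoord_basis // eqxx.
  by rewrite tcoord_basis // eq_sym (negPf ij).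
- move=> u n x; split=> [xn [s j]|xn s].
    exact: ((gtensor_deg_coord ((gE s).1 u) (hK s) (bd (s := s)) (bc (s := s))
      (cb (s := s)) n (x s)).1 (xn s) j).
  apply/(gtensor_deg_coord ((gE s).1 u) (hK s) (bd (s := s)) (bc (s := s))
      (cb (s := s))) => j.
  exact: (xn (Tagged (fun s => 'I_(m s)) j)).
Qed.

Lemma graded_dsum : graded_sheaf G.
Proof.
have [prC _ _ prd] := dsum_biproduct.
split=> [t|t u ut i x xi].
  apply: (@graded_prod _ _ _ _ (enum_val (A := {: D}))).
    by move=> s; exists (enum_rank s); rewrite enum_rankK.
  by move=> s; apply: graded_gtensor => //; case: (gE s).
apply/prd => p; rewrite prC //; apply: (gE (tag p)).2 => //.
exact: (prd t i x).1.
Qed.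
End SumOfTensors.

(** * The decomposition *)

Lemma finite_dim_bij (k : fieldType) (W W' : lmodType k) (f : {linear W -> W'}) :
  bijective f -> finite_dim W' -> finite_dim W.
Proof.
move=> [g gK Kg] [r [e he]]; exists r, (g \o e) => x; have [c ec] := he (f x).
exists c; apply: (can_inj gK); rewrite ec raddf_sum.
by apply: eq_bigr => i _; rewrite /= linearZ /= Kg.
Qed.

(** * Extension of an isomorphism from the boundary to a cone *)

Section ExtendIsomorphism.
Context (R : realType) (V : vectType R) (D : fan V) (F G : sheaf D).
Hypotheses (pF : pure F) (gG : graded_sheaf G).
Implicit Types (s t u : D).

Let gF : graded_sheaf F. Proof. by case: pF. Qed.

Section Extension.
Context (f : forall u, {linear G u -> F u}) (t : D).
Hypothesis fiso : forall u, val u \in boundary t -> gmod_iso (f u).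
Hypothesis fC : forall u v, val u \in boundary t -> val v \in boundary t ->
  face (val v) (val u) -> commutes_at f u v.

Let fbd := section_map fC.

Let fbd_bij : bijective fbd.
Proof. by apply: section_map_bij => u /fiso[]. Qed.

Lemma boundary_finite_dim : finite_dim (bar (sections G (boundary t))).
Proof.
apply: (finite_dim_bij (bar_map_bij fbd_bij)).
apply: (finite_dim_quotient (f := bar_map (rho F t))).
  exact: (bar_map_surj (f := rho F t) (rho_surj pF (t := t))).
exact: bar_stalk_finite.
Qed.

Context (X J : finType) (d : X -> int) (e : X -> G t) (isK : pred X).
Context (dK : J -> int) (kap : J -> Kspace F t) (h : J -> X).
Hypothesis he : adapted d e isK.
Hypotheses (kap_deg : forall j, gdeg (Kspace F t) (dK j) (kap j))
  (kapP : rbasis xpredT kap).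
Hypotheses (h_inj : injective h) (hK : forall x, isK x <-> exists j, h j = x)
  (dh : forall j, d (h j) = dK j).

Lemma extend_iso : exists g : {linear G t -> F t}, gmod_iso g /\
  forall u, val u \in boundary t -> forall x, f u (res G t u x) = res F t u (g x).
Proof.
have [eG e0 eP] := he; have [ed es _] := eG.
(* The boundary values of the basis of [G t], carried over to F; [adapted_basis] lifts them to a
   basis of [F t]. *)
pose beta x := fbd (rho G t (e x)).
have beta0 x : isK x -> beta x = 0 by move=> /e0; rewrite /beta => ->; exact: raddf0.
have beta_deg x : gdeg (sections F (boundary t)) (d x) (beta x).
  apply/sections_deg => u ut; rewrite section_mapE; apply/(fiso ut).2.
  exact: ((sections_deg _ _).1 (rho_deg gG (ed x))).
have betaP : rbasis (fun x => ~~ isK x) (fun x => bar_class _ (beta x)).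
  apply: rbasis_eq (rbasis_bij (bar_map_bij fbd_bij) eP) => x.
  exact: (bar_mapE fbd).
have [eF [heF rF]] := adapted_basis pF kap_deg kapP h_inj hK dh beta0 beta_deg betaP.
have [g gE] := hbasis_lift eF eG; exists g; split.
  exact: (hbasis_iso (gG.1 t) (gF.1 t) eG heF gE).
move=> u ut x; have [c ->] := es x; rewrite gE !raddf_sum.
apply: eq_bigr => y _ /=.
have fe : f u (res G t u (e y)) = res F t u (eF y).
  have := congr1 (fun z => section_at z ut) (rF y); rewrite rhoE => ->.
  by rewrite section_mapE rhoE.
by rewrite linearZ /= rscalE linearZ /= fe linearZ.
Qed.
End Extension.
End ExtendIsomorphism.

Section Decomposition.
Context (R : realType) (V : vectType R) (D : fan V) (F : sheaf D) (E : D -> sheaf D).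
Hypotheses (pF : pure F) (sE : forall s, is_simple s (E s)).
Implicit Types (s t u : D).

Let gE s : graded_sheaf (E s). Proof. by case: (sE s). Qed.

Let gF : graded_sheaf F. Proof. by case: pF. Qed.

Local Notation G := (dsum_sheaf (fun s => tensor_sheaf (E s) (Kspace F s))).

(** The maps are given at all cones and constrained only in dimensions below [n], which avoids
    families indexed by part of the fan. *)
Let iso_below (n : nat) := exists f : forall u, {linear G u -> F u},
  (forall u, (cdim (val u) < n)%N -> gmod_iso (f u)) /\
  (forall u v : D, (cdim (val u) < n)%N -> face (val v) (val u) -> commutes_at f u v).

Definition Kbasis_data s := {m : nat & (('I_m -> int) * ('I_m -> Kspace F s))%type}.

Lemma Kbasis_ex s : exists z : Kbasis_data s,
  (forall i, gdeg (Kspace F s) ((tagged z).1 i) ((tagged z).2 i)) /\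
  rbasis xpredT (tagged z).2.
Proof.
have [m [d [b h]]] := Kspace_hombasis pF s.
by exists (existT _ m (d, b)).
Qed.

Definition adapted_data s t :=
  {X : finType & ((X -> int) * (X -> E s t) * pred X)%type}.

(** Recording that [isK] holds for a single generator of degree 0 if s = t, and for none otherwise,
    makes the kernel generators of the whole sum correspond to the basis of K_t. *)
Definition simple_adapted_prop s t (z : adapted_data s t) :=
  let: existT X (d, e, isK) := z in
  [/\ adapted d e isK, s = t -> exists x0 : X, [/\ forall x, x = x0, isK x0 & d x0 = 0] &
      s != t -> forall x, ~~ isK x].

Lemma simple_adapted s t :
  ((cdim (val s) < cdim (val t))%N -> finite_dim (bar (sections (E s) (boundary t)))) ->
  exists z : adapted_data s t, simple_adapted_prop z.
Proof.
move=> fin; have [<-|st] := eqVneq s t.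
  have [d [e [he d0]]] := simple_adapted_self (sE s).
  exists (existT _ (unit : finType) (d, e, xpredT)); split=> // [_|].
    by exists tt; split=> // -[].
  by rewrite eqxx.
have [ts|lt] := leqP (cdim (val t)) (cdim (val s)).
  have [|d [e he]] := simple_adapted_small (sE s) ts; first by rewrite eq_sym.
  exists (existT _ (void : finType) (d, e, xpred0)); split=> // est.
  by rewrite est eqxx in st.
have [m [d [e he]]] := simple_adapted_large (sE s) lt (fin lt).
exists (existT _ ('I_m : finType) (d, e, xpred0)); split=> // est.
by rewrite est eqxx in st.
Qed.

Let extend n (f : forall u, {linear G u -> F u}) :
  (forall u, (cdim (val u) < n)%N -> gmod_iso (f u)) ->
  (forall u v : D, (cdim (val u) < n)%N -> face (val v) (val u) -> commutes_at f u v) ->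
  forall t, cdim (val t) = n -> exists g : {linear G t -> F t}, gmod_iso g /\
  forall u, val u \in boundary t -> forall x, f u (res G t u x) = res F t u (g x).
Proof.
move=> fiso fC t tn.
have bn u : val u \in boundary t -> (cdim (val u) < n)%N.
  by move=> /boundary_dim; rewrite tn.
have fiso' u (ut : val u \in boundary t) := fiso u (bn u ut).
have fC' u v (ut : val u \in boundary t) (_ : val v \in boundary t) := fC u v (bn u ut).
pose m s := tag (sval (cid (Kbasis_ex s))).
pose d s : 'I_(m s) -> int := (tagged (sval (cid (Kbasis_ex s)))).1.
pose b s : 'I_(m s) -> Kspace F s := (tagged (sval (cid (Kbasis_ex s)))).2.
have bd s i : gdeg (Kspace F s) (d s i) (b s i).
  by case: (svalP (cid (Kbasis_ex s))) => h _; exact: h.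
have hb s : rbasis xpredT (b s) by case: (svalP (cid (Kbasis_ex s))).
pose c s := sval (cid (rbasis_coord (hb s))).
have hc s := svalP (cid (rbasis_coord (hb s))).
have bc s := (hc s).1; have cb s := (hc s).2.
have hKs s := graded_Kspace gF s.
have bG := dsum_biproduct gE hKs bd bc cb.
have gG := graded_dsum gE hKs bd bc cb.
pose T := {s : D & 'I_(m s)}.
have finB := boundary_finite_dim pF fiso' fC'.
(* An index [p] exhibits the sheaf of [tag p] as a summand of G up to shift, so its boundary
   residues are a quotient of those of G. *)
have finE (p : T) : finite_dim (bar (sections (E (tag p)) (boundary t))).
  have [inn [pr_in _ _ inC _]] := biproduct_in (fun p : T => gE (tag p)) bG.
  have [prC _ _ _] := bG.
  pose SP := section_map (fun u v (_ : val u \in boundary t) (_ : val v \in boundary t) =>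
    prC p u v).
  apply: (finite_dim_quotient (f := bar_map SP)) finB.
  apply: bar_map_surj => z.
  exists (section_map (fun u v (_ : val u \in boundary t)
    (_ : val v \in boundary t) => inC p u v) z).
  by apply: sections_ext => u ut; rewrite !section_mapE pr_in.
pose a (p : T) := sval (cid (simple_adapted (t := t) (fun _ => finE p))).
have ha (p : T) : simple_adapted_prop (a p) :=
  svalP (cid (simple_adapted (t := t) (fun _ => finE p))).
pose X (p : T) := tag (a p).
pose dX (p : T) : X p -> int := (tagged (a p)).1.1.
pose eX (p : T) : X p -> E (tag p) t := (tagged (a p)).1.2.
pose kX (p : T) : pred (X p) := (tagged (a p)).2.
have hX (p : T) : adapted (@dX p) (@eX p) (@kX p).
  by move: (ha p); rewrite /dX /eX /kX /X; case: (a p) => Y [[? ?] ?] [].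
have sX (p : T) : tag p = t ->
    exists x0 : X p, [/\ forall x, x = x0, kX p x0 & dX p x0 = 0].
  by move: (ha p); rewrite /dX /eX /kX /X; case: (a p) => Y [[? ?] ?] [].
have nX (p : T) : tag p != t -> forall x, ~~ kX p x.
  by move: (ha p); rewrite /dX /eX /kX /X; case: (a p) => Y [[? ?] ?] [].
have [e he] := biproduct_adapted (fun p : T => gE (tag p)) bG hX.
(* [Tj j] is the copy of E_t attached to the [j]-th basis vector of K_t, and [x0 j] is its only
   generator; the shift moves its degree 0 to [d t j]. *)
pose Tj (j : 'I_(m t)) : T := Tagged (fun s => 'I_(m s)) j.
pose x0 j := sval (cid (sX (Tj j) erefl)).
have hx0 j := svalP (cid (sX (Tj j) erefl)).
apply: (extend_iso pF gG fiso' fC' he (bd t) (hb t)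
  (h := fun j => Tagged X (x0 j))).
- move=> i j /(congr1 tag)/= /eqP; rewrite eq_Tagged => /eqP; exact.
- move=> q; split=> [|[j <-]]; last by case: (hx0 j).
  case: q => p x /= Kx.
  have [pt|/nX/(_ x)] := eqVneq (tag p) t; last by rewrite Kx.
  move: x Kx; case: p pt => s j /= st; subst s => x _.
  by exists j; congr (Tagged X _); case: (hx0 j) => h _ _; exact: esym (h x).
- by move=> j; case: (hx0 j) => _ _ /= ->; rewrite add0r.
Qed.

Let iso_below_all n : iso_below n.
Proof.
elim: n => [|n [f [fiso fC]]].
  exists (fun u => lin_of (f := fun=> 0) (fun a x y =>
    esym (etrans (congr1 (+%R^~ 0) (scaler0 _ a)) (addr0 0)))).
  by split.
have ext := extend fiso fC.
pose f' u : {linear G u -> F u} :=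
  if pselect (cdim (val u) = n) is left un then sval (cid (ext u un)) else f u.
have f'E u : (cdim (val u) < n)%N -> f' u = f u.
  by rewrite /f'; case: pselect => // un; rewrite {1}un ltnn.
have f'N u : cdim (val u) = n -> gmod_iso (f' u) /\
    forall v, val v \in boundary u -> forall x, f v (res G u v x) = res F u v (f' u x).
  by rewrite /f'; case: pselect => // un _; exact: (svalP (cid (ext u un))).
exists f'; split=> [u|u v].
  by rewrite ltnS leq_eqVlt => /orP[/eqP/f'N[]//|un]; rewrite f'E //; exact: fiso.
rewrite ltnS leq_eqVlt => un vu x.
have [->|uv] := eqVneq v u; first by rewrite !res_id.
(* A proper face has smaller dimension, where [f'] agrees with [f]. *)
have vb : val v \in boundary u by rewrite in_boundary uv andbT; apply/asboolP.
have vn : (cdim (val v) < n)%N.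
  apply: leq_trans (boundary_dim vb) _.
  by case/orP: un => [/eqP ->|/ltnW].
case/orP: un => [/eqP/f'N[_ h]|un]; rewrite f'E; [exact: h|by []| |by []].
by rewrite f'E //; exact: fC.
Qed.

Lemma pure_decomposition : sheaf_iso F G.
Proof.
have [f [fiso fC]] := iso_below_all (\dim {:V}).+1.
have dV u : (cdim (val u) < (\dim {:V}).+1)%N by rewrite ltnS dimvS // subvf.
have ex u : exists g : {linear F u -> G u}, cancel g (f u) /\ cancel (f u) g.
  have [[g gK Kg] _] := fiso u (dV u).
  exists (lin_of (can2_linear gK Kg)); split; [exact: Kg|exact: gK].
pose g u := sval (cid (ex u)).
have gf u : cancel (g u) (f u) by case: (svalP (cid (ex u))).
have fg u : cancel (f u) (g u) by case: (svalP (cid (ex u))).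
exists g; split=> [u|u v vu x].
  split; first by exists (f u); [exact: gf|exact: fg].
  move=> i x; have [_ fd] := fiso u (dV u).
  by rewrite -{2}[x]gf fd.
by apply: (can_inj (fg v)); rewrite gf (fC u v (dV u) vu) gf.
Qed.
End Decomposition.

(** * Existence of simple sheaves *)

Section LinearSection.
Context (k : fieldType).

(* By Zorn, a subspace maximal among those meeting [ker pi] trivially is a
   complement of [ker pi]. *)
Lemma linear_section (N W : lmodType k) (pi : {linear N -> W}) :
  (forall w, exists x, pi x = w) -> exists sg : {linear W -> N}, cancel sg pi.
Proof.
move=> pis.
(* Membership of 0 is not demanded, since the union of the empty chain is empty; [C0] adjoins 0
   afterwards. *)
pose P (C : set N) := (forall a u v, C u -> C v -> C (a *: u + v)) /\
  (forall x, C x -> pi x = 0 -> x = 0).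
have [F FP Ftot|C [[Cl Ck] Cmax]] := @Zorn_bigcup N P.
  split=> [a u v [A FA Au] [B FB Bv]|x [A FA Ax]].
    have [AB|BA] := Ftot A B FA FB.
      by exists B => //; apply: (FP B FB).1 => //; exact: AB.
    by exists A => //; apply: (FP A FA).1 => //; exact: BA.
  by apply: (FP A FA).2.
pose C0 : set N := [set c | c = 0 \/ C c].
have C0l a u v : C0 u -> C0 v -> C0 (a *: u + v).
  case=> [->|Cu]; first by rewrite scaler0 add0r.
  case=> [->|Cv]; last by right; exact: Cl.
  (* As 0 may be missing from [C], the multiple a u is obtained as (a - 1) u + u. *)
  rewrite addr0; right; have := Cl (a - 1) u u Cu Cu.
  by rewrite scalerBl scale1r subrK.
have C0k x : C0 x -> pi x = 0 -> x = 0 by case=> // Cx; exact: Ck.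
have full x : exists2 c, C0 c & pi c = pi x.
  apply: contrapT => nx.
  pose C' : set N := [set y | exists a, exists2 c, C0 c & y = a *: x + c].
  apply: (Cmax C').
    split=> [c Cc|C'C]; first by exists 0, c; [right|rewrite scale0r add0r].
    have Cx : C x by apply: C'C; exists 1, 0; [left|rewrite scale1r addr0].
    by apply: nx; exists x => //; right.
  split=> [b _ _ [a [c Cc ->]] [a' [c' Cc' ->]]|_ [a [c Cc ->]]].
    exists (b * a + a'), (b *: c + c'); first exact: C0l.
    by rewrite scalerDr scalerA scalerDl addrACA.
  have [->|a0] := eqVneq a 0; first by rewrite scale0r add0r => /(C0k _ Cc).
  rewrite linearD linearZ /= => h; case: nx; exists (- a^-1 *: c).
    by rewrite -[_ *: c]addr0; apply: C0l => //; left.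
  apply: (scalerI a0); move/eqP: h; rewrite addr_eq0 => /eqP ->.
  by rewrite linearZ /= scalerA mulrN mulfV // scaleN1r.
have /choice[sg hsg] : forall w, exists c, C0 c /\ pi c = w.
  by move=> w; have [x <-] := pis w; have [c Cc e] := full x; exists c.
have sgL : linear sg.
  move=> a u v; apply/eqP; rewrite eq_sym -subr_eq0; apply/eqP/C0k.
    have [[Cu _] [Cv _]] := (hsg u, hsg v); have [Cw _] := hsg (a *: u + v).
    rewrite -scaleN1r [X in C0 X]addrC; exact: (C0l _ _ _ Cw (C0l _ _ _ Cu Cv)).
  by rewrite raddfB /= linearP /= !(hsg _).2 subrr.
by exists (lin_of sgL) => w; exact: (hsg w).2.
Qed.

(** From an ungraded section keep, on vectors of degree [i], the component of degree [i] of the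
    value. As [pi] commutes with components, this is still a section. *)
Lemma graded_linear_section (N W : gmod k) (pi : {linear N -> W}) :
  graded_space N -> graded_space W ->
  (forall i x, gdeg N i x -> gdeg W i (pi x)) -> (forall w, exists x, pi x = w) ->
  exists sg : {linear W -> N}, cancel sg pi /\
    forall i w, gdeg W i w -> gdeg N i (sg w).
Proof.
move=> hN hW pid /linear_section[sg0 sg0K].
have hp_pi i x : hp i (pi x) = pi (hp i x).
  have := hp_map hN hW (f := pi) (m := 0) _ _ i x; rewrite addr0; apply.
    exact: raddfB.
  by move=> j y; rewrite addr0; exact: pid.
have /choice[s hs] : forall w : W, exists s : seq int,
    [/\ uniq s, forall i, i \notin s -> hp i w = 0 & w = \sum_(i <- s) hp i w].
  by move=> w; exact: (hp_sum hW).
pose sg w := \sum_(i <- s w) hp i (sg0 (hp i w)).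
have sgE i w : hp i (sg w) = hp i (sg0 (hp i w)).
  rewrite (hp_bigsum hN); have [us s0 _] := hs w.
  have [iw|iw] := boolP (i \in s w).
    rewrite (bigD1_seq i) //= (hp_id hN (hp_deg hN _ _)) big1 ?addr0 // => j ji.
    by rewrite (hp_ne hN (hp_deg hN _ _)) // eq_sym.
  rewrite s0 // raddf0 (hp0 hN) big1_seq // => j /andP[_ jw].
  rewrite (hp_ne hN (hp_deg hN _ _)) //.
  by apply: contraNneq iw => ->.
have sgL : linear sg.
  move=> a u v; apply: (hp_eq hN) => i.
  rewrite (hpD hN) (hpZ0 hN) ?sgE; last exact: scalar_deg0.
  rewrite (hpD hW) (hpZ0 hW) ?linearP /=; last exact: scalar_deg0.
  by rewrite (hpD hN) (hpZ0 hN) //; exact: scalar_deg0.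
exists (lin_of sgL); split=> [w|i w wi].
  apply: (hp_eq hW) => i; rewrite hp_pi [hp i (lin_of _ _)]sgE -hp_pi sg0K.
  exact: (hp_id hW (hp_deg hW _ _)).
suff -> : lin_of sgL w = hp i (lin_of sgL w) by exact: (hp_deg hN).
apply: (hp_eq hN) => j; have [->|ji] := eqVneq j i.
  by rewrite (hp_id hN (hp_deg hN _ _)).
rewrite (hp_ne hN (hp_deg hN i _) ji) [hp j _]sgE (hp_ne hW wi ji) raddf0.
exact: (hp0 hN).
Qed.

Lemma bar_section n (M : gmod {mpoly k[n]}) : graded_Sym_module M ->
  exists sec : {linear bar M -> rscal (mC k n) M},
    (forall v, bar_class M (sec v) = v) /\
    forall i v, gdeg (bar M) i v -> gdeg M i (sec v).
Proof.
move=> hM; apply: (@graded_linear_section (grscal (mC k n) M) (bar M) (bar_class M)).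
- exact: graded_mC.
- exact: graded_bar.
- by move=> i x xi; exists x.
- exact: bar_class_surj.
Qed.
End LinearSection.

Section GradedIso.
Context (A : nzRingType).

Lemma gmod_iso_comp (M N P : gmod A) (f : {linear M -> N}) (g : {linear N -> P}) :
  gmod_iso f -> gmod_iso g -> gmod_iso (g \o f : {linear M -> P}).
Proof.
move=> [fb fd] [gb gd]; split; first exact: bij_comp.
by move=> i x; split=> [/gd/fd|/fd/gd].
Qed.

Lemma gmod_iso_inv (M N : gmod A) (f : {linear M -> N}) : gmod_iso f ->
  exists g : {linear N -> M}, [/\ gmod_iso g, cancel f g & cancel g f].
Proof.
move=> [[g gK Kg] fd]; exists (lin_of (can2_linear gK Kg)); split=> //.
by split=> [|i x]; [exists f|split=> [/fd|xi]; [rewrite Kg|apply/fd; rewrite Kg]].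
Qed.
End GradedIso.

Section GradedTensorMap.
Context (k : fieldType) (n : nat) (M : gmod {mpoly k[n]}).
Local Notation iota := (mC k n).

Section Map.
Context (K K' : gmod k) (f : {linear K -> K'}).

Let b (m : M) (x : K) : gtensor M K' := mtens iota m (f x).

Let bl a m m' x : b (a *: m + m') x = a *: b m x + b m' x.
Proof. by rewrite /b mtensDl mtensZl. Qed.

Let br c m x x' : b m (c *: x + x') = iota c *: b m x + b m x'.
Proof. by rewrite /b linearP mtensDr mtensZ mtensZl. Qed.

Definition gtensor_map : {linear gtensor M K -> gtensor M K'} := mlift bl br.

Lemma gtensor_mapE m x : gtensor_map (mtens iota m x) = mtens iota m (f x).
Proof. exact: (mliftE bl br). Qed.

Lemma gtensor_map_deg : (forall i x, gdeg K i x -> gdeg K' i (f x)) ->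
  forall i t, gdeg (gtensor M K) i t -> gdeg (gtensor M K') i (gtensor_map t).
Proof.
move=> fd i t [r [m [x [p [q [h ->]]]]]]; exists r, m, (f \o x), p, q; split.
  by move=> j; have [mp xq pq] := h j; split=> //; exact: fd.
by rewrite raddf_sum; apply: eq_bigr => j _; exact: gtensor_mapE.
Qed.
End Map.

Lemma gtensor_map_can (K K' : gmod k) (f : {linear K -> K'}) (g : {linear K' -> K}) :
  cancel f g -> cancel (gtensor_map f) (gtensor_map g).
Proof.
move=> fK t; have [r [m [x ->]]] := mtensE t.
rewrite (raddf_sum (gtensor_map f)) raddf_sum; apply: eq_bigr => i _ /=.
apply: etrans (congr1 _ (gtensor_mapE _ _ _)) _.
by apply: etrans (gtensor_mapE _ _ _) _; rewrite fK.
Qed.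

Lemma gtensor_map_iso (K K' : gmod k) (f : {linear K -> K'}) :
  gmod_iso f -> gmod_iso (gtensor_map f).
Proof.
move=> fi; have [g [[_ gd] fK gK]] := gmod_iso_inv fi; have [_ fd] := fi.
have fd' i x : gdeg K i x -> gdeg K' i (f x) by move=> /fd.
have gd' i x : gdeg K' i x -> gdeg K i (g x) by move=> /gd.
split; first by exists (gtensor_map g); exact: gtensor_map_can.
move=> i t; split=> [ti|]; last exact: gtensor_map_deg.
by rewrite -(gtensor_map_can fK t); exact: gtensor_map_deg.
Qed.
End GradedTensorMap.

Lemma bar_map_iso (k : comNzRingType) n (M N : gmod {mpoly k[n]}) (f : {linear M -> N}) :
  bijective (bar_map f) -> gmod_iso f -> gmod_iso (bar_map f).
Proof.
move=> bij [[g gK Kg] fd]; split=> // i z; split=> [[y yi ey]|[x xi <-]].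
  exists (g y); first by apply/fd; rewrite Kg.
  by apply: (bij_inj bij); rewrite bar_mapE Kg.
by exists (f x); [exact/fd|rewrite bar_mapE].
Qed.

Section GradedPair.
Context (A : nzRingType) (dA : int -> set A) (M N : gmod A).

Definition gpair : gmod A :=
  @GMod A (M * N)%type (fun i => [set x | gdeg M i x.1 /\ gdeg N i x.2]).

Lemma graded_pair : is_graded dA M -> is_graded dA N -> is_graded dA gpair.
Proof.
move=> hM hN; pose P i (x : gpair) : gpair := (hp i x.1, hp i x.2).
apply: (@graded_of_proj _ _ _ P) => /=.
- move=> i; split; first by split; [exact: (gdeg0 hM)|exact: (gdeg0 hN)].
  by move=> x y [x1 x2] [y1 y2]; split; [exact: (gdegB hM)|exact: (gdegB hN)].
- move=> i j a x ai [x1 x2]; split; [exact: (gdegZ hM)|exact: (gdegZ hN)].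
- by move=> i x; split; [exact: (hp_deg hM)|exact: (hp_deg hN)].
- move=> i j x [x1 x2]; rewrite /P (hpE hM _ x1) (hpE hN _ x2).
  by case: eqP => // _; case: x x1 x2.
- by move=> i x y; rewrite /P (hpB hM) (hpB hN).
- move=> x; have [s [us s0 _]] := hp_sum hM x.1; have [s' [us' s0' _]] := hp_sum hN x.2.
  pose w := undup (s ++ s'); exists w.
  have sumE (l : seq int) :
      \sum_(i <- l) P i x = (\sum_(i <- l) hp i x.1, \sum_(i <- l) hp i x.2).
    by elim: l => [|i l IH]; rewrite ?big_nil ?big_cons ?IH.
  rewrite sumE -(hp_sum_in hM) ?undup_uniq //; last first.
    by move=> i; rewrite mem_undup mem_cat negb_or => /andP[/s0].
  rewrite -(hp_sum_in hN) ?undup_uniq //; first by case: x {s0 s0' sumE}.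
  by move=> i; rewrite mem_undup mem_cat negb_or => /andP[_ /s0'].
Qed.
End GradedPair.

Section SimpleExistence.
Context (R : realType) (V : vectType R) (D : fan V).
Implicit Types (s t u : D) (E F : sheaf D) (L : {fset set V}).

(** The last clause of [is_simple] with a variable set [L] for the boundary: in the induction step
    [L] is empty outside the new dimension. *)
Definition simple_at E t L :=
  let Ebd := sections E L in
  exists sec : {linear bar Ebd -> rscal (mC R _) Ebd},
  exists f : {linear gtensor (Sym_self R (\dim \V_t)) (bar Ebd) -> E t},
    [/\ forall v, bar_class Ebd (sec v) = v,
        forall i v, gdeg (bar Ebd) i v -> gdeg Ebd i (sec v),
        gmod_iso f &
        forall (a : Sym R \V_t) v u (uL : val u \in L),
          res E t u (f (mtens (mC R _) (a : Sym_self R _) v)) =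
          Sres \V_t \V_u a *: section_at (sec v) uL].

Section Transfer.
Context (E E' : sheaf D) (L : {fset set V}) (g : forall u, {linear E u -> E' u}).
Hypothesis gC : forall t u, val t \in L -> val u \in L -> face (val u) (val t) ->
  commutes_at g t u.
Hypothesis gi : forall u, val u \in L -> gmod_iso (g u).

Local Notation B := (sections E L).
Local Notation B' := (sections E' L).

Let Phi := section_map gC.

Let Phi_bij : bijective Phi.
Proof. by apply: section_map_bij => u /gi[]. Qed.

Let Phi_deg i x : gdeg B' i (Phi x) <-> gdeg B i x.
Proof.
split=> /sections_deg h; apply/sections_deg => u uL.
  by apply/(gi uL).2; rewrite -(section_mapE gC).
by rewrite section_mapE; apply/(gi uL).2.
Qed.

(** The stalk of [E'] is described by sections of [E], whereas the clause speaks of sections of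
    [E']. The maps [g] identify the two over [L], and the section and the structure map are
    conjugated by the induced isomorphism of residue spaces. *)
Lemma simple_at_transfer t (sec : {linear bar B -> rscal (mC R _) B})
    (f : {linear gtensor (Sym_self R (\dim \V_t)) (bar B) -> E' t}) :
  (forall v, bar_class B (sec v) = v) ->
  (forall i v, gdeg (bar B) i v -> gdeg B i (sec v)) -> gmod_iso f ->
  (forall (a : Sym R \V_t) v u (uL : val u \in L),
     res E' t u (f (mtens (mC R _) (a : Sym_self R _) v)) =
     Sres \V_t \V_u a *: g u (section_at (sec v) uL)) ->
  simple_at E' t L.
Proof.
move=> secK secd fi fr.
have bi : gmod_iso (bar_map Phi).
  by apply: bar_map_iso; [exact: bar_map_bij Phi_bij|exact: conj Phi_bij Phi_deg].
have [psi [psi_i psiK Kpsi]] := gmod_iso_inv bi.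
pose sec0 (v : bar B') : rscal (mC R _) B' := Phi (sec (psi v)).
have sec0L : linear sec0.
  move=> a x y; rewrite /sec0 (linearP psi) (linearP sec).
  exact: (linearP Phi).
exists (lin_of sec0L), (f \o gtensor_map (Sym_self R _) psi : {linear _ -> _}); split.
- move=> v; apply: etrans (esym (bar_mapE Phi _)) _.
  by rewrite secK; exact: Kpsi.
- by move=> i v vi; apply/Phi_deg; apply: secd; apply/psi_i.2.
- by apply: gmod_iso_comp fi; exact: gtensor_map_iso.
- move=> a v u uL; have e := gtensor_mapE psi (a : Sym_self R (\dim \V_t)) v.
  apply: etrans (congr1 (fun z => res E' t u (f z)) e) _.
  apply: etrans (fr a (psi v) u uL) _; congr (_ *: _).
  by apply: esym; exact: section_mapE.
Qed.
End Transfer.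

(** * The initial stage: a skyscraper sheaf *)

Section Skyscraper.
Context (s : D).

(** A product over the proofs of [t = s] is the algebra if they are equal and 0 otherwise, without
    transport along the equality. *)
Definition sky_stalk t : gmod (Sym R \V_t) :=
  gprod (fun _ : t = s => Sym_self R (\dim \V_t)).

Let sky_fun t u (x : sky_stalk t) : rscal (Sres \V_t \V_u) (sky_stalk u) :=
  fun _ => if pselect (t = s) is left e then Sres \V_t \V_u (x e) else 0.

Let sky_funL t u : linear (@sky_fun t u).
Proof.
move=> a x y; apply: functional_extensionality_dep => e; rewrite /sky_fun.
rewrite prodmD rscalE prodmZ; case: pselect => e'; last by rewrite scaler0 addr0.
apply: etrans (rmorphD (Sres \V_t \V_u) (a * x e' : Sym R _) (y e')) _.
by congr (_ + _); exact: (rmorphM (Sres \V_t \V_u)).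
Qed.

Definition sky_res t u : {linear sky_stalk t -> rscal (Sres \V_t \V_u) (sky_stalk u)} :=
  lin_of (@sky_funL t u).

Let sky_resE t u (x : sky_stalk t) (e : u = s) : (sky_res t u x : sky_stalk u) e =
  if pselect (t = s) is left e' then Sres \V_t \V_u (x e') else 0.
Proof. by []. Qed.

Fact sky_res_id t (x : sky_stalk t) : sky_res t t x = x.
Proof.
apply: functional_extensionality_dep => e; rewrite [LHS]sky_resE.
case: pselect => // e'; rewrite Sres_id; congr (x _); exact: Prop_irrelevance.
Qed.

Fact sky_res_comp t u v : face (val u) (val t) -> face (val v) (val u) ->
  forall x : sky_stalk t, sky_res u v (sky_res t u x : sky_stalk u) = sky_res t v x.
Proof.
move=> ut vu x; apply: functional_extensionality_dep => ev; rewrite [LHS]sky_resE.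
rewrite [RHS]sky_resE; case: pselect => eu.
  rewrite sky_resE; case: pselect => et; last exact: raddf0.
  by apply: Sres_comp; exact: face_space.
(* If [t] and [v] both equal [s], antisymmetry forces the intermediate face [u] to be [s] too. *)
case: pselect => // et; case: eu; subst v; subst t.
exact: face_anti ut vu.
Qed.

Definition sky : sheaf D := Sheaf sky_res_id sky_res_comp.

Lemma graded_sky : graded_sheaf sky.
Proof.
split=> [t|t u ut i x xi e].
  have [e|ne] := pselect (t = s).
    apply: (@graded_prod _ _ _ 1%N (fun=> e)) => [e'|_]; last exact: graded_Sym.
    by exists ord0; exact: Prop_irrelevance.
  by apply: (@graded_prod _ _ _ 0%N (fun j : 'I_0 => match notF (ltn_ord j) with end)).
apply: (eq_ind_r (fun z => Sym_deg i z) _ (sky_resE x e)); case: pselect => [e'|_]; last by right.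
exact: (Sres_deg _ (xi e')).
Qed.

Lemma sky_zero t : t != s -> forall x : sky t, x = 0.
Proof.
by move=> /eqP ts x; apply: functional_extensionality_dep => e; case: (ts e).
Qed.

Lemma sky_self : exists f : {linear Sym_self R (\dim \V_s) -> sky s}, gmod_iso f.
Proof.
have fL : linear (fun (a : Sym_self R (\dim \V_s)) => (fun=> a) : sky s) by [].
exists (lin_of fL); split.
  exists (fun x : sky s => x erefl) => // x.
  by apply: functional_extensionality_dep => e; congr (x _); exact: Prop_irrelevance.
by move=> i a; split=> [/(_ erefl)|ai e].
Qed.
End Skyscraper.

(** * The inductive stage: adding the modules of one dimension *)

Section ExtensionSheaf.
Context (E : sheaf D) (gE : graded_sheaf E) (L : D -> {fset set V}).
Hypothesis hL : forall t, L t = boundary t \/ L t = fset0.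
Context (sec : forall t, {linear bar (sections E (L t)) ->
  rscal (mC R _) (sections E (L t))}).
Hypothesis secd : forall t i v, gdeg (bar (sections E (L t))) i v ->
  gdeg (sections E (L t)) i (sec t v).

Local Notation N t := (gtensor (Sym_self R (\dim \V_t)) (bar (sections E (L t)))).

Let in_L t u : val u \in L t -> val u \in boundary t.
Proof. by case: (hL t) => ->; rewrite ?inE. Qed.

Let L_face t u (v : D) : val u \in L t -> face (val v) (val u) -> val v \in L t.
Proof. by case: (hL t) => ->; [exact: boundary_boundary|rewrite inE]. Qed.

Let L_skip t u (v : D) : val u \in boundary t -> val u \notin L t -> val v \notin L t.
Proof. by case: (hL t) => -> ut; [rewrite ut|rewrite !inE]. Qed.

(* Totalized by [0] outside [L t]. *)
Let sat t (x : sections E (L t)) u : E u :=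
  if pselect (val u \in L t) is left p then section_at x p else 0.

Let satE t (x : sections E (L t)) u (p : val u \in L t) : sat x u = section_at x p.
Proof.
rewrite /sat; case: pselect => // q; congr (section_at x _).
exact: bool_irrelevance.
Qed.

Let sat_out t (x : sections E (L t)) u : val u \notin L t -> sat x u = 0.
Proof. by move=> /negP ut; rewrite /sat; case: pselect. Qed.

Let satP t c (x y : sections E (L t)) u :
  sat (c%:MP *: x + y) u = (c%:MP : Sym R \V_u) *: sat x u + sat y u.
Proof.
rewrite /sat; case: pselect => [p|_]; last by rewrite scaler0 addr0.
by rewrite section_atD section_atZ SresC.
Qed.

Let sat_res t (x : sections E (L t)) u (v : D) : val u \in L t -> face (val v) (val u) ->
  res E u v (sat x u) = sat x v.
Proof. by move=> p vu; rewrite (satE _ p) (satE _ (L_face p vu)); exact: section_res. Qed.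

Section Restriction.
Context (t u : D).

Let rb (a : Sym_self R (\dim \V_t)) (w : bar (sections E (L t))) :
  rscal (Sres \V_t \V_u) (E u) := Sres \V_t \V_u a *: sat (sec t w) u.

Let rb_l a m m' w : rb (a *: m + m') w = a *: rb m w + rb m' w.
Proof.
pose S := sat (sec t w) u; pose r : Sym R \V_t -> Sym R \V_u := Sres \V_t \V_u.
have e : r (a *: m + m') = r a * r m + r m'.
  apply: etrans (rmorphD (Sres \V_t \V_u) (a * m : Sym R _) m') _.
  by congr (_ + _); exact: (rmorphM (Sres \V_t \V_u)).
apply: etrans (congr1 (fun z => z *: S) e) _.
by apply: etrans (scalerDl S _ _) _; rewrite -scalerA.
Qed.

Let rb_r c m w w' : rb m (c *: w + w') = mC R _ c *: rb m w + rb m w'.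
Proof.
pose r : Sym R \V_t -> Sym R \V_u := Sres \V_t \V_u.
have e : sat (sec t (c *: w + w')) u =
    (c%:MP : Sym R \V_u) *: sat (sec t w) u + sat (sec t w') u.
  by rewrite (linearP (sec t)); exact: satP.
apply: etrans (congr1 (fun z => r m *: z) e) _.
apply: etrans (scalerDr _ _ _) _; congr (_ + _).
apply: etrans (scalerA _ _ _) _; rewrite mulrC -scalerA.
exact: (congr1 (fun z : Sym R \V_u => z *: (r m *: sat (sec t w) u))
  (esym (SresC \V_t \V_u c))).
Qed.

Definition new_res : {linear N t -> rscal (Sres \V_t \V_u) (E u)} := mlift rb_l rb_r.

Lemma new_resE (a : Sym R \V_t) w :
  new_res (mtens (mC R _) (a : Sym_self R _) w) = Sres \V_t \V_u a *: sat (sec t w) u.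
Proof. exact: (mliftE rb_l rb_r). Qed.
End Restriction.

Lemma new_res_out t u (y : N t) : val u \notin L t -> new_res t u y = 0.
Proof.
move=> ut; have [r [m [x ->]]] := mtensE y; rewrite raddf_sum big1 // => i _.
by apply: etrans (new_resE _ _ _) _; rewrite sat_out // scaler0.
Qed.

Lemma new_res_comp t u (v : D) (y : N t) : val u \in L t -> face (val v) (val u) ->
  res E u v (new_res t u y : E u) = new_res t v y.
Proof.
move=> ut vu.
apply: (@mtensor_ext _ _ _ _ _ _ (res E u v \o new_res t u) (new_res t v)) y => a w.
apply: etrans (congr1 (res E u v) (new_resE u a w)) _.
apply: etrans (linearZZ (res E u v) _ _) _.
apply: etrans; last exact: esym (new_resE v a w).
have tu : (\V_u <= \V_t)%VS by apply: face_space; exact: boundary_face (in_L ut).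
exact: (congr2 (fun (z : Sym R \V_v) (y : E v) => z *: y)
  (Sres_comp a (face_space vu) tu) (sat_res (sec t w) ut vu)).
Qed.

Lemma new_res_deg t u i (y : N t) : gdeg (N t) i y -> gdeg (E u) i (new_res t u y).
Proof.
move=> [r [m [x [p [q [h ->]]]]]]; rewrite raddf_sum; apply: (gdeg_sum (gE.1 u)) => j _.
have [mp xq <-] := h j.
apply: (eq_ind_r (fun z => gdeg (E u) _ z) _ (new_resE u (m j) (x j))).
apply: (gdegZ (gE.1 u)); first exact: Sres_deg.
rewrite /sat; case: pselect => [ut|_]; last exact: (gdeg0 (gE.1 u)).
by move: (secd xq) => /sections_deg; apply.
Qed.

(** The identity for [u = t] and 0 otherwise: under restriction to a proper face the new summand
    only reaches the old stalk, through [new_res]. *)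
Let cast t u (y : N t) : N u := dfwith (fun v => 0 : N v) y u.

Let cast_id t (y : N t) : cast t y = y.
Proof. by rewrite /cast dfwith_in. Qed.

Let cast_ne t u (y : N t) : t != u -> cast u y = 0.
Proof. by move=> tu; rewrite /cast dfwith_out. Qed.

(** Old stalk and new module are added at every cone. In the induction at least one of them
    vanishes, so that no case distinction enters the type of the stalk. *)
Definition ext_stalk t := gpair (E t) (N t).

Let ext_fun t u (x : ext_stalk t) : rscal (Sres \V_t \V_u) (ext_stalk u) :=
  ((res E t u x.1 : E u) + (new_res t u x.2 : E u), cast u x.2) : ext_stalk u.

Let ext_funL t u : linear (@ext_fun t u).
Proof.
move=> a x y; pose r : Sym R \V_t -> Sym R \V_u := Sres \V_t \V_u.
have e1 : (res E t u (a *: x.1 + y.1) : E u) + (new_res t u (a *: x.2 + y.2) : E u) =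
    r a *: ((res E t u x.1 : E u) + (new_res t u x.2 : E u)) +
    ((res E t u y.1 : E u) + (new_res t u y.2 : E u)).
  apply: etrans (congr2 (fun z w : E u => z + w)
    (linearP (res E t u) a x.1 y.1) (linearP (new_res t u) a x.2 y.2)) _.
  apply: etrans (addrACA _ _ _ _) _; congr (_ + _).
  exact: esym (scalerDr _ _ _).
have e2 : cast u (a *: x.2 + y.2) = Sres \V_t \V_u a *: cast u x.2 + cast u y.2.
  have [<-|tu] := eqVneq t u; last by rewrite !cast_ne // scaler0 addr0.
  by rewrite !cast_id Sres_id.
by apply: etrans (congr2 (fun (z : E u) (w : N u) => (z, w) : ext_stalk u) e1 e2) _.
Qed.

Definition ext_res t u : {linear ext_stalk t -> rscal (Sres \V_t \V_u) (ext_stalk u)} :=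
  lin_of (@ext_funL t u).

Let ext_resE t u (x : ext_stalk t) : ext_res t u x =
  ((res E t u x.1 : E u) + (new_res t u x.2 : E u), cast u x.2) :> ext_stalk u.
Proof. by []. Qed.

Let notin_L t : val t \notin L t.
Proof. by apply/negP => /in_L; rewrite in_boundary eqxx andbF. Qed.

Fact ext_res_id t (x : ext_stalk t) : ext_res t t x = x.
Proof.
rewrite ext_resE cast_id res_id new_res_out ?notin_L // addr0.
by case: x.
Qed.

Fact ext_res_comp t u v : face (val u) (val t) -> face (val v) (val u) ->
  forall x : ext_stalk t, ext_res u v (ext_res t u x : ext_stalk u) = ext_res t v x.
Proof.
move=> ut vu x; have [etu|tu] := eqVneq t u.
  by subst u; apply: (congr1 (ext_res t v)); exact: ext_res_id.
have utb : val u \in boundary t by rewrite in_boundary eq_sym tu andbT; apply/asboolP.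
have tv : t != v.
  by apply: contra_neq tu => etv; subst v; exact: face_anti vu ut.
have e1 : (res E u v ((res E t u x.1 : E u) + (new_res t u x.2 : E u)) : E v) +
    (new_res u v (cast u x.2) : E v) = (res E t v x.1 : E v) + (new_res t v x.2 : E v).
  have -> : (new_res u v (cast u x.2) : E v) = 0.
    by rewrite (cast_ne _ tu); exact: raddf0.
  rewrite addr0; apply: etrans (raddfD (res E u v) _ _) _.
  apply: (congr2 (fun z w : E v => z + w)); first exact: res_comp.
  (* If a boundary cone is missing from [L t], then [L t] is empty and the new module restricts to 0
     at both cones. *)
  have [uL|uL] := boolP (val u \in L t); first exact: new_res_comp.
  rewrite !new_res_out; [exact: raddf0|exact: L_skip uL|exact: uL].
have e2 : cast v (cast u x.2) = cast v x.2.
  rewrite (cast_ne _ tu) (cast_ne _ tv).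
  by have [<-|uv] := eqVneq u v; rewrite ?cast_id ?cast_ne.
exact: (congr2 (fun (z : E v) (w : N v) => (z, w) : ext_stalk v) e1 e2).
Qed.

Definition ext_sheaf : sheaf D := Sheaf ext_res_id ext_res_comp.

Lemma graded_ext : graded_sheaf ext_sheaf.
Proof.
have gN t : graded_Sym_module (N t).
  apply: graded_gtensor; first exact: graded_Sym.
  by apply: graded_bar; exact: graded_sections.
split=> [t|t u ut i x [x1 x2]]; first exact: graded_pair (gE.1 t) (gN t).
have c1 : gdeg (E u) i ((res E t u x.1 : E u) + (new_res t u x.2 : E u)).
  by apply: (gdegD (gE.1 u)); [exact: gE.2|exact: new_res_deg].
have c2 : gdeg (N u) i (cast u x.2).
  have [<-|tu] := eqVneq t u; first by rewrite cast_id.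
  by rewrite cast_ne //; exact: (gdeg0 (gN u)).
exact: conj c1 c2.
Qed.

Lemma ext_old_linear t : linear (fun x : E t => (x, 0) : ext_sheaf t).
Proof.
move=> a x y; have e : a *: (0 : N t) + 0 = 0 by rewrite scaler0 addr0.
exact: (congr1 (fun w : N t => (a *: x + y, w) : ext_stalk t) (esym e)).
Qed.

Definition ext_old t : {linear E t -> ext_sheaf t} := lin_of (@ext_old_linear t).

Lemma ext_oldC t u : commutes_at ext_old t u.
Proof.
move=> x; have e1 : (res E t u x : E u) + (new_res t u 0 : E u) = res E t u x.
  by apply: etrans (congr1 (fun z : E u => res E t u x + z) (raddf0 (new_res t u))) _;
    exact: addr0.
have e2 : cast u (0 : N t) = 0.
  by have [<-|tu] := eqVneq t u; [exact: cast_id|exact: cast_ne].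
exact: esym (congr2 (fun (z : E u) (w : N u) => (z, w) : ext_stalk u) e1 e2).
Qed.

Lemma ext_old_iso t : (forall y : N t, y = 0) -> gmod_iso (ext_old t).
Proof.
move=> N0; split.
  exists fst => // -[x y]; by rewrite (N0 y).
move=> i x; split=> [h|xi]; first exact: h.1.
have gN : graded_Sym_module (N t).
  apply: graded_gtensor; first exact: graded_Sym.
  by apply: graded_bar; exact: graded_sections.
exact: conj xi (gdeg0 gN i).
Qed.

Lemma ext_new_linear t : linear (fun y : N t => (0, y) : ext_sheaf t).
Proof.
move=> a x y; have e : a *: (0 : E t) + 0 = 0 by rewrite scaler0 addr0.
exact: (congr1 (fun z : E t => (z, a *: x + y) : ext_stalk t) (esym e)).
Qed.

Definition ext_new t : {linear N t -> ext_sheaf t} := lin_of (@ext_new_linear t).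

Lemma ext_new_iso t : (forall x : E t, x = 0) -> gmod_iso (ext_new t).
Proof.
move=> E0; split.
  exists snd => // -[x y]; by rewrite (E0 x).
move=> i y; split=> [h|yi]; first exact: h.2.
exact: conj (gdeg0 (gE.1 t) i) yi.
Qed.

Lemma ext_newE t u (a : Sym R \V_t) w (uL : val u \in L t) :
  res ext_sheaf t u (ext_new t (mtens (mC R _) (a : Sym_self R _) w)) =
  Sres \V_t \V_u a *: ext_old u (section_at (sec t w) uL).
Proof.
have tu : t != u.
  by have := in_L uL; rewrite in_boundary => /andP[_]; rewrite eq_sym.
pose y : N t := mtens (mC R _) (a : Sym_self R _) w.
have e1 : (res E t u 0 : E u) + (new_res t u y : E u) =
    Sres \V_t \V_u a *: section_at (sec t w) uL.
  apply: etrans (congr1 (fun z : E u => z + (new_res t u y : E u)) (raddf0 (res E t u))) _.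
  by apply: etrans (add0r _) _; rewrite -(satE _ uL); exact: new_resE.
apply: etrans (congr2 (fun (z : E u) (w : N u) => (z, w) : ext_stalk u)
  e1 (cast_ne y tu)) _.
exact: (linearZZ (ext_old u)).
Qed.
End ExtensionSheaf.
End SimpleExistence.

Section SimpleExists.
Context (R : realType) (V : vectType R) (D : fan V) (s : D).
Implicit Types (t u : D) (E : sheaf D).

(** The stage of the construction in dimensions below [n], extended by zero: each stage is thus a
    sheaf on the whole fan. *)
Let simple_below (n : nat) E :=
  [/\ graded_sheaf E,
      forall t, (((cdim (val t) <= cdim (val s)) && (t != s)) || (n <= cdim (val t)))%N ->
        forall x : E t, x = 0,
      exists f : {linear Sym_self R (\dim \V_s) -> E s}, gmod_iso f &
      forall t, (cdim (val s) < cdim (val t) < n)%N -> simple_at E t (boundary t)].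

Let simple_below_start : exists E, simple_below (cdim (val s)).+1 E.
Proof.
exists (sky s); split.
- exact: graded_sky.
- move=> t h; apply: sky_zero; case/orP: h => [/andP[]//|].
  by apply: contraTneq => ->; rewrite ltnn.
- exact: sky_self.
- by move=> t; rewrite ltnS andbC; case: leqP.
Qed.

Let simple_below_step n E : (cdim (val s) < n)%N -> simple_below n E ->
  exists E', simple_below n.+1 E'.
Proof.
move=> sn [gE E0 [f fi] Es].
(* Over the empty set the residue space is 0, so new modules appear in dimension [n] only. *)
pose L t := if cdim (val t) == n then boundary t else fset0.
have hL t : L t = boundary t \/ L t = fset0.
  by rewrite /L; case: eqP => _; [left|right].
pose sec t := sval (cid (bar_section (graded_sections gE (L t)))).
have secP t := svalP (cid (bar_section (graded_sections gE (L t)))).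
have secK t : forall v, bar_class _ (sec t v) = v := (secP t).1.
have secd t := (secP t).2.
have N0 t : cdim (val t) != n ->
    forall y : gtensor (Sym_self R (\dim \V_t)) (bar (sections E (L t))), y = 0.
  move=> tn y; have [r [m [x ->]]] := mtensE y; rewrite big1 // => i _.
  have -> : x i = 0; last exact: mtens0r.
  apply: bar_zero; apply: sections_zero => u.
  by rewrite /L (negPf tn) inE.
have old_iso t : cdim (val t) != n -> gmod_iso (ext_old hL sec t).
  by move=> /N0; exact: ext_old_iso.
have bn t u : val u \in boundary t -> (cdim (val t) <= n)%N -> cdim (val u) != n.
  by move=> /boundary_dim ut tn; rewrite ltn_eqF // (leq_trans ut).
exists (ext_sheaf hL sec); split.
- exact: graded_ext.
- move=> t h [x y]; have tn : cdim (val t) != n.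
    case/orP: h => [/andP[ts _]|]; last by move=> h; rewrite gtn_eqF.
    by rewrite ltn_eqF // (leq_ltn_trans ts).
  rewrite (N0 t tn y) (E0 t _ x) //.
  by case/orP: h => [-> //|/ltnW ->]; rewrite orbT.
- exists (ext_old hL sec s \o f : {linear _ -> _}).
  by apply: gmod_iso_comp fi (old_iso s _); rewrite ltn_eqF.
- move=> t /andP[st]; rewrite ltnS leq_eqVlt => tn.
  (* In dimension [n] the new summand supplies the module and its restrictions; below [n] the
     earlier structure maps are composed with [ext_old]. *)
  have [tn'|tn'] := eqVneq (cdim (val t)) n.
    have eL : L t = boundary t by rewrite /L tn' eqxx.
    have {}oldi u (uL : val u \in L t) : gmod_iso (ext_old hL sec u).
      by apply: old_iso; apply: (bn t); rewrite -?eL ?tn'.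
    have oldC u v (_ : val u \in L t) (_ : val v \in L t)
      (_ : face (val v) (val u)) : commutes_at (ext_old hL sec) u v := ext_oldC hL sec (t := u) v.
    have E0t : forall x : E t, x = 0 by apply: E0; rewrite tn' leqnn orbT.
    have := simple_at_transfer oldC oldi (secK t) (secd t)
      (ext_new_iso gE hL sec E0t) (fun a v u => @ext_newE _ _ _ _ _ hL sec t u a v).
    by rewrite eL.
  have {}tn : (cdim (val t) < n)%N by case/orP: tn => // /eqP; move/eqP: tn'.
  have oldi u (ut : val u \in boundary t) : gmod_iso (ext_old hL sec u).
    by apply: old_iso; apply: (bn t) => //; exact: ltnW.
  have oldC u v (_ : val u \in boundary t) (_ : val v \in boundary t)
    (_ : face (val v) (val u)) : commutes_at (ext_old hL sec) u v := ext_oldC hL sec (t := u) v.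
  have [|sc [h [scK scd hi hr]]] := Es t; first by rewrite st.
  pose h' : {linear gtensor (Sym_self R (\dim \V_t)) (bar (sections E (boundary t))) ->
    ext_sheaf hL sec t} := ext_old hL sec t \o h.
  have h'i : gmod_iso h' by apply: gmod_iso_comp hi (old_iso t _); rewrite ltn_eqF.
  apply: (simple_at_transfer oldC oldi scK scd h'i) => a v u ut.
  apply: etrans (esym (ext_oldC hL sec u (h (mtens (mC R _) (a : Sym_self R _) v)))) _.
  by rewrite hr; exact: (linearZZ (ext_old hL sec u)).
Qed.

Let simple_below_all n : (cdim (val s) < n)%N -> exists E, simple_below n E.
Proof.
elim: n => // n IH; rewrite ltnS leq_eqVlt => /orP[/eqP <-|sn].
  exact: simple_below_start.
by have [E hE] := IH sn; exact: simple_below_step hE.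
Qed.

Lemma simple_exists : exists E, is_simple s E.
Proof.
have dV u : (cdim (val u) < (\dim {:V}).+1)%N by rewrite ltnS dimvS // subvf.
have [E [gE E0 Ei Es]] := simple_below_all (dV s); exists E; split=> //.
- by move=> t ts nts; apply: E0; rewrite ts nts.
- by move=> t st; apply: Es; rewrite st dV.
Qed.
End SimpleExists.

Theorem theorem2p3 (R : realType) (V : vectType R) (D : fan V) (F : sheaf D) :
  pure F ->
  (forall s : D, graded_space (Kspace F s) /\ finite_dim (Kspace F s)) /\
  (forall s : D, exists E : sheaf D, is_simple s E) /\
  (forall E : D -> sheaf D, (forall s, is_simple s (E s)) ->
     sheaf_iso F (dsum_sheaf (fun s => tensor_sheaf (E s) (Kspace F s)))).
Proof.
move=> pF; split=> [s|].
  split; first by case: pF => gF _ _; exact: graded_Kspace.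
  by have [m [d [b [_ hb]]]] := Kspace_hombasis pF s; exact: rbasis_finite_dim hb.
split=> [s|E sE]; first exact: simple_exists.
exact: pure_decomposition.
Qed.
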